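(* Let $(X,m)$ be a $\sigma$-finite measure space, let $\mu$ be a probability measure on $\mathbb Z$ that is an M-measure, and let $T$ be a bounded linear operator on $L^1(X,m)$ that is $S_\mu$-bounded. Let $s>0$, $r>0$ and $\alpha>-1$ be real numbers with $sr>\alpha+1$. Then the generalized square function $$Q^{T_\mu}_{\alpha,s,r}f=\Big(\sum_{n=1}^\infty n^\alpha|T_\mu^n(I-T_\mu)^rf|^s\Big)^{1/s}$$ is bounded in $L^1$, i.e. there is a constant $C$ with $\lVert Q^{T_\mu}_{\alpha,s,r}f\rVert_1\le C\lVert f\rVert_1$ for all $f\in L^1(X,m)$.
   Context: M-measures: let $\mu$ be a probability measure on $\mathbb Z$ whose Fourier transform $\hat\mu(t)=\sum_k\mu(k)e^{-2\pi ikt}$ is twice continuously differentiable on $0<|t|<1$. $\mu$ is an M-measure if there exist a continuous function $h$ on $|t|\le 1/2$ with $h(0)=0$ and $h(-t)=h(t)$, continuously differentiable on $0<|t|<1/2$, and positive constants $c$ (possibly different in each condition) such that for $0<t<1/2$: (i) $|\hat\mu(t)|\le 1-c\,h(t)$; (ii) $|t\,\hat\mu'(t)|\le c\,h(t)$; (iii) $|\hat\mu'(t)|\le c\,h'(t)$; (iv) $|t\,\hat\mu''(t)|\le c\,h'(t)$; (v) $h(t)\le c\,t\,h'(t)$. $S_\mu$-bounded: let $\Lambda$ be the additive subsemigroup of $\mathbb Z$ generated by the union of the supports of the convolution powers $\mu^n=\mu*\cdots*\mu$, $n\ge1$. $T$ is $S_\mu$-bounded if $\sup_{n\in\Lambda}\lVert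 T^n\rVert<\infty$ ($T$ is implicitly required to be invertible if $\Lambda$ contains negative integers). Then $T_\mu f=\sum_k\mu(k)T^kf$ is a well-defined power bounded operator. Fractional powers: for $0<\theta<1$ and $k\ge1$ put $g(\theta,k)=\frac{\theta|\theta-1|\cdots|\theta-k+1|}{k!}\ge0$, so that $(1-x)^\theta=1-\sum_{k\ge1}g(\theta,k)x^k$ for $|x|\le1$. For a power bounded operator $R$, $(I-R)^\theta=I-\sum_{k\ge1}g(\theta,k)R^k$, and for real $r>0$, $(I-R)^r=(I-R)^{\lfloor r\rfloor}(I-R)^{r-\lfloor r\rfloor}$ (with $(I-R)^0=I$). Absolute values, powers and sums of functions are taken pointwise a.e. *)

(* Defs.v *)
From mathcomp Require Import all_boot all_order all_algebra.
From mathcomp Require Import complex.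
From mathcomp Require Import all_classical all_reals all_analysis.

Set Implicit Arguments.
Unset Strict Implicit.
Unset Printing Implicit Defensive.

Import Order.TTheory GRing.Theory Num.Theory.
Import numFieldNormedType.Exports.

Local Open Scope classical_set_scope.
Local Open Scope ring_scope.
Local Open Scope complex_scope.

(** Sums over the integers, along the partial sums over [-N, N].  They are only
    applied to absolutely convergent families, for which the order of summation
    is irrelevant. *)

Definition psumZ (V : nmodType) (F : int -> V) (N : nat) : V :=
  \sum_(i < N.*2.+1) F (i%:Z - N%:Z).

Definition sumZ (R : realType) (F : int -> R) : R := limn (psumZ F).

(** Probability measures on Z, given by their mass functions. *)

Definition is_probability (R : realType) (mu : int -> R) : Prop :=
  (forall k, 0 <= mu k) /\ (\esum_(k in [set: int]) (mu k)%:E = 1)%E.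

Definition conv (R : realType) (mu nu : int -> R) (k : int) : R :=
  sumZ (fun j => mu j * nu (k - j)).

(* [iter n (conv mu) mu] is the convolution power of exponent [n.+1]. *)
Definition Lambda (R : realType) (mu : int -> R) : set int :=
  smallest [set A : set int | forall a b, A a -> A b -> A (a + b)]
    (\bigcup_n [set k | iter n (conv mu) mu k != 0]).

Definition fourier (R : realType) (mu : int -> R) (t : R) : R[i] :=
  sumZ (fun k => mu k * cos (2 * pi * k%:~R * t)) -i*
  sumZ (fun k => mu k * sin (2 * pi * k%:~R * t)).

(** Derivatives of complex-valued functions of a real variable. *)

Definition cderive (R : realType) (F : R -> R[i]) (t : R) : R[i] :=
  derive1 (fun u => complex.Re (F u)) t +i*
  derive1 (fun u => complex.Im (F u)) t.

(* Meant for open [A]. *)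
Definition C1_on (R : realType) (A : set R) (f : R -> R) : Prop :=
  forall t, A t -> derivable f t 1 /\ {for t, continuous (derive1 f)}.

Definition C2_on (R : realType) (A : set R) (f : R -> R) : Prop :=
  (forall t, A t -> derivable f t 1) /\ C1_on A (derive1 f).

Definition is_Mmeasure (R : realType) (mu : int -> R) : Prop :=
  let F := fourier mu in
  let punctured r := [set t : R | 0 < `|t| < r] in
  [/\ is_probability mu,
      C2_on (punctured 1) (fun t => complex.Re (F t)),
      C2_on (punctured 1) (fun t => complex.Im (F t)) &
      exists h : R -> R,
        [/\ {within `[- 2^-1, 2^-1], continuous h},
            h 0 = 0,
            (forall t, `|t| <= 2^-1 -> h (- t) = h t),
            C1_on (punctured 2^-1) h &
            [/\ exists2 c : R, 0 < c & forall t, 0 < t < 2^-1 ->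
                  Normc.normc (F t) <= 1 - c * h t,
                exists2 c : R, 0 < c & forall t, 0 < t < 2^-1 ->
                  Normc.normc (t%:C * cderive F t) <= c * h t,
                exists2 c : R, 0 < c & forall t, 0 < t < 2^-1 ->
                  Normc.normc (cderive F t) <= c * derive1 h t,
                exists2 c : R, 0 < c & forall t, 0 < t < 2^-1 ->
                  Normc.normc (t%:C * cderive (cderive F) t) <= c * derive1 h t &
                exists2 c : R, 0 < c & forall t, 0 < t < 2^-1 ->
                  h t <= c * (t * derive1 h t)]]].

(** L^1 is used through representatives: its elements are functions [f] with
    [L1 K m f], equality is equality almost everywhere, and an operator is a map
    on functions that is compatible with it.  The set [K] of scalars is either
    the real line or the complex plane, see [scalar_field]. *)

Definition scalar_field (R : realType) (K : set R[i]) : Prop :=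
  K = range (real_complex R) \/ K = [set: R[i]].

Section L1.
Context (d : measure_display) (X : measurableType d) (R : realType).
Variables (K : set R[i]) (m : {measure set X -> \bar R}).

Local Notation op := ((X -> R[i]) -> X -> R[i]).

Definition L1 : set (X -> R[i]) := [set f |
  [/\ forall x, K (f x),
      (fun x => complex.Re (f x)) \in Lfun m 1 &
      (fun x => complex.Im (f x)) \in Lfun m 1]].

Definition L1norm (f : X -> R[i]) : \bar R :=
  (\int[m]_x (Normc.normc (f x))%:E)%E.

Definition aeeq (f g : X -> R[i]) : Prop := {ae m, forall x, f x = g x}.

Definition opnorm (T : op) : \bar R :=
  ereal_sup [set L1norm (T f) | f in [set f | L1 f /\ (L1norm f <= 1)%E]].

Definition bounded_op (T : op) : Prop :=
  [/\ forall f, L1 f -> L1 (T f),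
      forall f g, L1 f -> L1 g -> aeeq f g -> aeeq (T f) (T g),
      forall a f g, K a -> L1 f -> L1 g ->
        aeeq (T (fun x => a * f x + g x)) (fun x => a * T f x + T g x) &
      (opnorm T < +oo)%E].

Definition is_inverse (T S : op) : Prop :=
  bounded_op S /\ forall f, L1 f -> aeeq (S (T f)) f /\ aeeq (T (S f)) f.

Definition invertible (T : op) : Prop :=
  exists S, is_inverse T S.

Definition inv_op (T : op) : op :=
  xget (id : op) [set S | is_inverse T S].

Definition powZ (T : op) (k : int) : op :=
  match k with
  | Posz n => iter n T
  | Negz n => iter n.+1 (inv_op T)
  end.

Definition Smu_bounded (mu : int -> R) (T : op) : Prop :=
  (forall n : int, Lambda mu n -> n < 0 -> invertible T) /\
  (ereal_sup [set opnorm (powZ T n) | n in Lambda mu] < +oo)%E.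

(* The limit in L^1 norm, unique up to a.e. equality. *)
Definition L1lim (u : nat -> X -> R[i]) : X -> R[i] :=
  xget (fun=> 0 : R[i]) [set g | L1 g /\
    (fun N => L1norm (fun x => u N x - g x)) @ \oo --> 0%E].

Definition Tmu (mu : int -> R) (T : op) (f : X -> R[i]) : X -> R[i] :=
  L1lim (fun N x => psumZ (fun k => (mu k)%:C * powZ T k f x) N).

Definition gcoef (theta : R) (k : nat) : R :=
  (\prod_(0 <= j < k) `|theta - j%:R|) / k`!%:R.

Definition id_sub (A : op) (f : X -> R[i]) : X -> R[i] :=
  fun x => f x - A f x.

(* [(I - A)^theta], for [0 <= theta < 1]. *)
Definition frac_id_sub (A : op) (theta : R)
    (f : X -> R[i]) : X -> R[i] :=
  if theta == 0 then f else
  id_sub (fun f => L1lim (fun N x =>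
    \sum_(1 <= k < N.+1) (gcoef theta k)%:C * iter k A f x)) f.

(* [(I - A)^r], for [0 < r]. *)
Definition rpow_id_sub (A : op) (r : R)
    (f : X -> R[i]) : X -> R[i] :=
  iter (Num.truncn r) (id_sub A) (frac_id_sub A (r - (Num.truncn r)%:R) f).

Definition square_fun (A : op) (alpha s r : R)
    (f : X -> R[i]) (x : X) : \bar R :=
  ((\sum_(1 <= n <oo)
      (n%:R `^ alpha * Normc.normc (iter n A (rpow_id_sub A r f) x) `^ s)%:E)
   `^ s^-1)%E.

End L1.

(* Main.v *)
Require Import Defs.
From mathcomp Require Import all_boot all_order all_algebra.
From mathcomp Require Import complex.
From mathcomp Require Import all_classical all_reals all_analysis.
From mathcomp Require Import measurable_realfun.
From mathcomp Require Import ring lra zify.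

(** The proof dominates the square function pointwise by a series that can be
    integrated term by term; only the decay of the norms of
    T_mu^n (I - T_mu)^r is then needed.

    Let a_n and d_n be the moduli of T_mu^n (I - T_mu)^r f and of
    T_mu^n (I - T_mu)^(r+1) f, and choose delta with (alpha + 1) / s < delta < r.
    As a_(n+1) <= a_n + d_n, summation by parts bounds n^delta a_n, for all n at
    once, by V = a_1 + sum_j (((j+1)^delta - j^delta) a_j + (j+1)^delta d_j).
    Hence sum_n n^alpha a_n^s <= V^s sum_n n^(alpha - delta s), where the last
    series converges ([square_sum_le]).  If the L^1 norms of a_n and d_n are
    O(n^-r) and O(n^-(r+1)), the integral of V is at most a constant times the
    norm of f ([square_fun_bounded]).

    These two decays hold for every power bounded operator A such that
    A^n - A^(n+1) has norm O(1/n).  For 0 < th < 1, the series of (I - A)^th is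
    cut at k = n: below, A^n - A^(n+k) has norm O(k/n); above, the coefficients
    have sum O(n^-th) ([frac_power_decay]).  Each further factor I - A gains
    1/n, since half of the n steps can be spent on it
    ([integer_power_decay]).

    The powers T^k, for k in the semigroup that carries the convolution powers
    of mu, are uniformly bounded.  So T_mu is power bounded, and the norm of
    T_mu^n - T_mu^(n+1) is at most a constant times
    sum_k |mu^n(k) - mu^(n+1)(k)|.  Truncating mu to [-N, N] turns this into a
    statement on Laurent polynomials in T; the truncation error is the mass of
    mu outside of [-N, N] and vanishes in the limit ([Tmu_ritt]).

    It remains to see that sum_k |mu^n(k) - mu^(n+1)(k)| = O(1/n)
    ([Mmeasure_ritt]).  With F the Fourier transform of mu and
    E(t) = - (C / n) exp (- c n h(t)), the conditions on an M-measure bound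
    G = F^n (1 - F) on 0 < t < 1/2 by |G| <= t E', |G'| <= E', |G''| <= E' / t,
    while the total increase of E is O(1/n).  The Fourier coefficient of G at k
    is estimated trivially on t < 1/|k|, and by two integrations by parts on
    t > 1/|k|.  Summing over dyadic blocks of k the contributions of dyadic
    intervals of t leaves a constant times the total increase of E
    ([fourier_sum_le]).  No integral is taken: the primitives of trigonometric
    polynomials are explicit, and increments are compared through the mean
    value theorem ([norm1_diff_poly_le]). *)

Set Implicit Arguments.
Unset Strict Implicit.
Unset Printing Implicit Defensive.

Import Order.TTheory GRing.Theory Num.Theory.
Import numFieldNormedType.Exports.
Local Open Scope classical_set_scope.
Local Open Scope ring_scope.

(** * Seminormed spaces and operators up to null elements *)

(** Elements of L^1 are represented by functions, so the norm is only a seminorm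
    [p], defined on a larger space and used on the subspace [L]. *)
Record seminorm (R : realType) (V : lmodType R) (L : set V) (p : V -> R)
  : Prop := Seminorm {
  sn0 : L 0;
  snD : forall f g, L f -> L g -> L (f + g);
  snZ : forall a f, L f -> L (a *: f);
  sn_ge0 : forall f, 0 <= p f;
  sn_triangle : forall f g, L f -> L g -> p (f + g) <= p f + p g;
  sn_scale : forall a f, L f -> p (a *: f) = `|a| * p f }.

(** An operator acts on representatives, hence is linear only up to elements of
    seminorm zero. *)
Record oper (R : realType) (V : lmodType R) (L : set V) (p : V -> R)
    (M : R) (A : V -> V) : Prop := Oper {
  op_ge0 : 0 <= M;
  op_in : forall f, L f -> L (A f);
  op_lin : forall a f g, L f -> L g -> p (A (a *: f + g) - (a *: A f + A g)) = 0;
  op_bound : forall f, L f -> p (A f) <= M * p f }.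

Section Seminorm.
Context (R : realType) (V : lmodType R) (L : set V) (p : V -> R).
Hypothesis S : seminorm L p.

Lemma snN f : L f -> L (- f).
Proof. by move=> Lf; rewrite -scaleN1r; exact: (snZ S). Qed.

Lemma snB f g : L f -> L g -> L (f - g).
Proof. by move=> Lf Lg; apply: (snD S) => //; exact: snN. Qed.

Lemma sn_sum (I : Type) (s : seq I) (P : pred I) (F : I -> V) :
  (forall i, P i -> L (F i)) -> L (\sum_(i <- s | P i) F i).
Proof. by move=> LF; apply: big_ind => //; [exact: (sn0 S)|exact: (snD S)]. Qed.

Lemma sn_p0 : p 0 = 0.
Proof. by rewrite -(scale0r 0) (sn_scale S) ?normr0 ?mul0r//; exact: (sn0 S). Qed.

Lemma sn_opp f : L f -> p (- f) = p f.
Proof. by move=> Lf; rewrite -scaleN1r (sn_scale S)// normrN1 mul1r. Qed.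

Lemma sn_dist f g : L f -> L g -> p (f - g) = p (g - f).
Proof. by move=> Lf Lg; rewrite -opprB sn_opp//; exact: snB. Qed.

Lemma sn_dist_tri g f h : L f -> L g -> L h -> p (f - h) <= p (f - g) + p (g - h).
Proof.
move=> Lf Lg Lh; have -> : f - h = (f - g) + (g - h) by rewrite addrA subrK.
by apply: (sn_triangle S); exact: snB.
Qed.

Lemma sn_le_dist f g : L f -> L g -> p f <= p (f - g) + p g.
Proof.
move=> Lf Lg; rewrite -{1}(subrK g f); apply: (sn_triangle S) => //; exact: snB.
Qed.

Lemma sn_eq f g : L f -> L g -> p (f - g) = 0 -> p f = p g.
Proof.
move=> Lf Lg fg; apply/le_anti; rewrite (le_trans (sn_le_dist Lf Lg)) ?fg ?add0r//=.
by rewrite (le_trans (sn_le_dist Lg Lf)) // sn_dist// fg add0r.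
Qed.

Lemma sn_sum_le (I : Type) (s : seq I) (P : pred I) (F : I -> V) :
  (forall i, P i -> L (F i)) ->
  p (\sum_(i <- s | P i) F i) <= \sum_(i <- s | P i) p (F i).
Proof.
move=> LF; elim: s => [|i s IH]; first by rewrite !big_nil sn_p0.
rewrite !big_cons; case: ifPn => // Pi.
apply: le_trans (sn_triangle S _ _) _; [exact: LF|exact: sn_sum|].
by rewrite lerD2l.
Qed.

Section Operators.
Context (M : R) (A : V -> V).
Hypothesis OA : oper L p M A.

Lemma op_null f : L f -> p f = 0 -> p (A f) = 0.
Proof.
move=> Lf pf; apply/le_anti; rewrite (sn_ge0 S) andbT.
by rewrite (le_trans (op_bound OA Lf))// pf mulr0.
Qed.

Lemma op_comb_le a f g : L f -> L g -> p (A (a *: f + g)) <= `|a| * p (A f) + p (A g).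
Proof.
move=> Lf Lg; have LAf := op_in OA Lf; have LAg := op_in OA Lg.
have LaA : L (a *: A f) by exact: (snZ S).
have -> : p (A (a *: f + g)) = p (a *: A f + A g).
  apply: sn_eq; [|exact: (snD S)|exact: (op_lin OA)].
  by apply: (op_in OA); apply: (snD S) => //; exact: (snZ S).
by rewrite -(sn_scale S)//; apply: (sn_triangle S).
Qed.

Lemma op_sub f g : L f -> L g -> p (A (f - g) - (A f - A g)) = 0.
Proof.
move=> Lf Lg; have := op_lin OA (-1) Lg Lf.
by rewrite !scaleN1r ![- _ + _]addrC.
Qed.

Lemma op_subE f g : L f -> L g -> p (A (f - g)) = p (A f - A g).
Proof.
move=> Lf Lg; apply: sn_eq; last exact: op_sub.
  by apply: (op_in OA); exact: snB.
by apply: snB; exact: (op_in OA).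
Qed.

Lemma op_lipschitz f g : L f -> L g -> p (A f - A g) <= M * p (f - g).
Proof. by move=> Lf Lg; rewrite -op_subE//; apply: (op_bound OA); exact: snB. Qed.

Lemma op_zero : p (A 0) = 0.
Proof. by apply: op_null; [exact: (sn0 S)|exact: sn_p0]. Qed.

Lemma op_sum_le (I : Type) (s : seq I) (a : I -> R) (F : I -> V) :
  (forall i, L (F i)) ->
  p (A (\sum_(i <- s) a i *: F i)) <= \sum_(i <- s) `|a i| * p (A (F i)).
Proof.
move=> LF; elim: s => [|i s IH]; first by rewrite !big_nil op_zero.
rewrite !big_cons; apply: le_trans (op_comb_le _ _ _) _ => //.
  by apply: sn_sum => j _; exact: (snZ S).
by rewrite lerD2l.
Qed.

Lemma op_sum (I : Type) (s : seq I) (a : I -> R) (F : I -> V) :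
  (forall i, L (F i)) ->
  p (A (\sum_(i <- s) a i *: F i) - \sum_(i <- s) a i *: A (F i)) = 0.
Proof.
move=> LF; elim: s => [|i s IH]; first by rewrite !big_nil subr0 op_zero.
rewrite !big_cons; apply/le_anti; rewrite (sn_ge0 S) andbT.
have Ls : L (\sum_(j <- s) a j *: F j).
  by apply: sn_sum => j _; exact: (snZ S).
have LAs : L (\sum_(j <- s) a j *: A (F j)).
  by apply: sn_sum => j _; apply: (snZ S); exact: (op_in OA).
have La : L (a i *: A (F i)) by apply: (snZ S); exact: (op_in OA).
have LA : L (A (\sum_(j <- s) a j *: F j)) by exact: (op_in OA).
have := sn_dist_tri (f := A (a i *: F i + \sum_(j <- s) a j *: F j))
  (g := a i *: A (F i) + A (\sum_(j <- s) a j *: F j))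
  (h := a i *: A (F i) + \sum_(j <- s) a j *: A (F j)).
rewrite (op_lin OA)// opprD addrACA subrr !add0r IH; apply.
- by apply: (op_in OA); apply: (snD S) => //; exact: (snZ S).
- exact: (snD S).
- exact: (snD S).
Qed.

Lemma op_iter_in n f : L f -> L (iter n A f).
Proof. by move=> Lf; elim: n => //= n; exact: (op_in OA). Qed.

End Operators.

Lemma op_comp (M N : R) (A B : V -> V) :
  oper L p M A -> oper L p N B -> oper L p (M * N) (A \o B).
Proof.
move=> OA OB; split => [|f Lf|a f g Lf Lg|f Lf] /=.
- exact: mulr_ge0 (op_ge0 OA) (op_ge0 OB).
- by apply: (op_in OA); exact: (op_in OB).
- have LBf := op_in OB Lf; have LBg := op_in OB Lg.
  have LBfg : L (B (a *: f + g)).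
    by apply: (op_in OB); apply: (snD S) => //; exact: (snZ S).
  have Ls : L (a *: B f + B g) by apply: (snD S) => //; exact: (snZ S).
  have LA h : L h -> L (A h) by exact: (op_in OA).
  apply/le_anti; rewrite (sn_ge0 S) andbT.
  apply: le_trans (sn_dist_tri (g := A (a *: B f + B g)) _ _ _) _; try exact: LA.
    by apply: (snD S); [apply: (snZ S)|]; exact: LA.
  rewrite (op_lin OA)// addr0.
  by rewrite (le_trans (op_lipschitz OA LBfg Ls))// (op_lin OB)// mulr0.
- rewrite -mulrA (le_trans (op_bound OA (op_in OB Lf)))//.
  by rewrite ler_wpM2l ?(op_ge0 OA)// (op_bound OB).
Qed.

Lemma op_weaken (M N : R) (A : V -> V) : oper L p M A -> 0 <= N ->
  (forall f, L f -> p (A f) <= N * p f) -> oper L p N A.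
Proof. by move=> OA N0 bA; split => //; [exact: (op_in OA)|exact: (op_lin OA)]. Qed.

Lemma op_id : oper L p 1 id.
Proof.
split => // [a f g Lf Lg|f Lf]; last by rewrite mul1r.
by rewrite subrr sn_p0.
Qed.

Lemma op_iter (M N : R) (A : V -> V) : oper L p N A -> 0 <= M ->
  (forall n f, L f -> p (iter n A f) <= M * p f) ->
  forall n, oper L p M (iter n A).
Proof.
move=> OA M0 bA n; suff [K OK] : exists K, oper L p K (iter n A).
  exact: op_weaken OK M0 (bA n).
elim: n => [|n [K OK]]; first by exists 1; exact: op_id.
by exists (N * K); exact: op_comp OA OK.
Qed.

End Seminorm.

(** * Fractional powers of a Ritt operator *)

Section FractionalCoefficients.
Context (R : realType) (th : R).
Hypothesis th01 : 0 < th < 1.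

(** [frac_tail n] is the coefficient of x^n in (1 - x)^(th - 1), that is the sum
    of the coefficients of (1 - x)^th up to x^n; the latter sum to 0, so it is
    also the tail of the [gcoef th k] over k > n. *)
Definition frac_tail (n : nat) : R := \prod_(j < n) (1 - th / j.+1%:R).

Lemma frac_tailS n : frac_tail n.+1 = frac_tail n * (1 - th / n.+1%:R).
Proof. by rewrite /frac_tail big_ord_recr. Qed.

Lemma frac_tail_ge0 n : 0 <= frac_tail n.
Proof.
apply: prodr_ge0 => j _; rewrite subr_ge0 ler_pdivrMr ?ltr0n// mul1r.
have /andP[_ /ltW t1] := th01; apply: (le_trans t1); by rewrite ler1n.
Qed.

Lemma gcoefE k : gcoef th k.+1 = th / k.+1%:R * frac_tail k.
Proof.
rewrite /gcoef; elim: k => [|k IH].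
  have /andP[t0 _] := th01.
  by rewrite big_nat1 subr0 gtr0_norm// /frac_tail big_ord0 mulr1 (_ : 1`! = 1%N).
rewrite big_nat_recr//= factS natrM invfM.
have -> : `|th - k.+1%:R| = k.+1%:R - th.
  rewrite ltr0_norm ?opprB// subr_lt0.
  have /andP[_ t1] := th01; apply: (lt_le_trans t1); by rewrite ler1n.
move: IH; set P := \prod_(0 <= i < k.+1) _ => IH.
transitivity (P / k.+1`!%:R * ((k.+1%:R - th) / k.+2%:R)); first by ring.
rewrite IH frac_tailS.
have k1 : k.+1%:R != 0 :> R by rewrite pnatr_eq0.
have k2 : k.+2%:R != 0 :> R by rewrite pnatr_eq0.
by field; rewrite ?k1 ?k2 ?nat1r// -?natrD// ?pnatr_eq0.
Qed.

Lemma gcoef_diff k : gcoef th k.+1 = frac_tail k - frac_tail k.+1.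
Proof. by rewrite gcoefE frac_tailS; ring. Qed.

Lemma gcoef_ge0 k : 0 <= gcoef th k.
Proof. by rewrite divr_ge0// prodr_ge0. Qed.

Lemma sum_gcoef m n : (m <= n)%N ->
  \sum_(m.+1 <= k < n.+1) gcoef th k = frac_tail m - frac_tail n.
Proof.
move=> mn; rewrite -(subnK mn); elim: (n - m)%N => [|d IH].
  by rewrite add0n big_geq// subrr.
by rewrite addSn big_nat_recr/= ?ltnS ?leq_addl// IH gcoef_diff addrA subrK.
Qed.

(** Partial sums of k g_k are th times coefficients of (1 - x)^(th - 2), which have
    this closed form.  Hence no asymptotics of the coefficients are required. *)
Lemma sum_mul_gcoef n :
  \sum_(1 <= k < n.+1) k%:R * gcoef th k = th * (n%:R * frac_tail n / (1 - th)).
Proof.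
have t1 : 1 - th != 0 by have /andP[_ t1] := th01; rewrite subr_eq0 gt_eqF.
elim: n => [|n IH]; first by rewrite big_geq// !mul0r mulr0.
rewrite big_nat_recr//= IH gcoefE frac_tailS.
have n1 : 1 + n%:R != 0 :> R by rewrite nat1r pnatr_eq0.
by rewrite -nat1r; field; rewrite t1 n1.
Qed.

(** Factor by factor: 1 - th/j <= exp (- th/j) <= ((j + 1)/j)^(-th). *)
Lemma frac_tail_le n : frac_tail n <= n.+1%:R `^ (- th).
Proof.
have /andP[t0 t1] := th01.
elim: n => [|n IH]; first by rewrite /frac_tail big_ord0 powR1.
rewrite frac_tailS.
have step : 1 - th / n.+1%:R <= (n.+2%:R / n.+1%:R) `^ (- th).
  have n1 : 0 < n.+1%:R :> R by rewrite ltr0n.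
  have q0 : 0 < n.+2%:R / n.+1%:R :> R by rewrite divr_gt0 ?ltr0n.
  rewrite /powR gt_eqF//.
  have -> : - th * ln (n.+2%:R / n.+1%:R) = - (th * ln (n.+2%:R / n.+1%:R))
    by rewrite mulNr.
  apply: le_trans (expR_ge1Dx _); rewrite lerD2l lerN2 ler_pM2l//.
  have : ln (1 + n.+1%:R^-1) <= n.+1%:R^-1 :> R.
    rewrite -ler_expR lnK ?expR_ge1Dx// posrE addr_gt0 ?invr_gt0//.
  suff -> : n.+2%:R / n.+1%:R = 1 + n.+1%:R^-1 :> R by [].
  by rewrite -nat1r mulrDl mul1r mulfV ?gt_eqF// addrC.
have -> : n.+2%:R = n.+1%:R * (n.+2%:R / n.+1%:R) :> R.
  by rewrite mulrCA mulfV ?mulr1 ?pnatr_eq0.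
rewrite powRM ?divr_ge0//.
apply: ler_pM => //; first exact: frac_tail_ge0.
rewrite subr_ge0 ler_pdivrMr ?ltr0n// mul1r.
by apply: (le_trans (ltW t1)); rewrite ler1n.
Qed.

End FractionalCoefficients.

Lemma le_of_le_add_cvg0 (R : realType) (a b : R) (v : nat -> R) :
  v @ \oo --> 0 -> (\forall K \near \oo, a <= b + v K) -> a <= b.
Proof.
move=> v0 ab; apply/ler_addgt0Pr => e e0.
near \oo => K; apply: (@le_trans _ _ (b + v K)); first by near: K.
rewrite lerD2l; apply: le_trans (ler_norm _) _; apply/ltW; near: K.
by move/cvgr0Pnorm_lt : v0; apply.
Unshelve. all: by end_near. Qed.

(** The hypotheses on [A] make it a Ritt operator: power bounded, with
    differences of consecutive powers of order 1/n. *)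
Section RittDecay.
Context (R : realType) (V : lmodType R) (L : set V) (p : V -> R).
Hypothesis S : seminorm L p.
Context (N M C : R) (A : V -> V).
Hypotheses (OA : oper L p N A) (M0 : 0 <= M) (C0 : 0 <= C).
Hypothesis pb : forall n f, L f -> p (iter n A f) <= M * p f.
Hypothesis ritt : forall n f, L f ->
  p (iter n A f - iter n.+1 A f) <= C / n.+1%:R * p f.

Let On := op_iter S OA M0 pb.

Lemma ritt_lag n k f : L f ->
  p (iter n A f - iter (n + k) A f) <= k%:R * (C / n.+1%:R) * p f.
Proof.
move=> Lf; have LA j : L (iter j A f) by exact: (op_iter_in OA).
elim: k => [|k IH]; first by rewrite addn0 subrr (sn_p0 S) !mul0r.
apply: le_trans (sn_dist_tri S (g := iter (n + k) A f) _ _ _) _ => //.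
rewrite -natr1 mulrDl mulrDl mul1r lerD//.
rewrite addnS; apply: le_trans (ritt _ Lf) _.
rewrite ler_wpM2r ?(sn_ge0 S)// ler_wpM2l// lef_pV2 ?posrE ?ltr0n//.
by rewrite ler_nat ltnS leq_addr.
Qed.

Section FractionalPower.
Context (th : R) (B : V -> V).
Hypothesis th01 : 0 < th < 1.
Let u K f := \sum_(1 <= k < K.+1) gcoef th k *: iter k A f.
Hypothesis LB : forall f, L f -> L (B f).
Hypothesis limB : forall f, L f -> p (u K f - B f) @[K --> \oo] --> 0.

Let Lu K f : L f -> L (u K f).
Proof.
by move=> Lf; apply: (sn_sum S) => k _; apply: (snZ S); exact: (op_iter_in OA).
Qed.

Lemma frac_series_tail n f : L f ->
  p (u n f - B f) <= frac_tail th n * M * p f.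
Proof.
move=> Lf; have LA j : L (iter j A f) by exact: (op_iter_in OA).
have tail K : (n <= K)%N -> p (u n f - B f) <= frac_tail th n * M * p f + p (u K f - B f).
  move=> nK; apply: le_trans (sn_dist_tri S (g := u K f) _ _ _) _;
    [exact: Lu|exact: Lu|exact: LB|].
  rewrite lerD2r (sn_dist S); [|exact: Lu|exact: Lu].
  have -> : u K f - u n f = \sum_(n.+1 <= k < K.+1) gcoef th k *: iter k A f.
    by rewrite /u (big_cat_nat (n := n.+1))//= addrAC subrr add0r.
  apply: le_trans (sn_sum_le S _ _) _.
    by move=> k _; exact: (snZ S).
  apply: (@le_trans _ _ (\sum_(n.+1 <= k < K.+1) gcoef th k * (M * p f))).
    apply: ler_sum => k _; rewrite (sn_scale S)// ger0_norm ?gcoef_ge0//.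
    by rewrite ler_wpM2l ?gcoef_ge0// pb.
  rewrite -mulr_suml sum_gcoef// -mulrA ler_wpM2r ?mulr_ge0 ?(sn_ge0 S)//.
  by rewrite gerBl frac_tail_ge0.
by apply: (le_of_le_add_cvg0 (limB Lf)); exists n.
Qed.

(** Since the coefficients sum to 1,
    f - B f = frac_tail n f + sum_(k <= n) g_k (f - A^k f) + (u n f - B f).
    Under A^n, each f - A^k f has norm at most k (C / n) p f, and the partial sums
    of k g_k are of order n^(1 - th); the two other terms are controlled by
    frac_tail n alone. *)
Lemma frac_power_decay : exists2 D : R, 0 <= D &
  forall n f, L f -> p (iter n A (f - B f)) <= D * n.+1%:R `^ (- th) * p f.
Proof.
have /andP[t0 t1] := th01.
have t1' : 0 <= 1 - th by rewrite subr_ge0 ltW.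
have t0' := ltW t0.
have D0 : 0 <= M + th * C / (1 - th) + M * M.
  by apply: addr_ge0; [apply: addr_ge0 => //; apply: divr_ge0 => //|]; exact: mulr_ge0.
exists (M + th * C / (1 - th) + M * M) => // n f Lf.
have LA j : L (iter j A f) by exact: (op_iter_in OA).
pose w k := f - iter k A f.
have Lw k : L (w k) by exact: (snB S).
have split_f : f - B f = frac_tail th n *: f +
    (1%R *: (\sum_(1 <= k < n.+1) gcoef th k *: w k) + (u n f - B f)).
  rewrite scale1r addrA; have -> : \sum_(1 <= k < n.+1) gcoef th k *: w k =
      (1 - frac_tail th n) *: f - u n f.
    rewrite /u /w; under eq_bigr do rewrite scalerBr.
    rewrite sumrB -scaler_suml sum_gcoef// /frac_tail big_ord0//.
  by rewrite scalerBl scale1r addrA addrA [_ + (f - _)]addrC !subrK.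
have pin : 0 <= frac_tail th n by exact: frac_tail_ge0.
have Lsum : L (\sum_(1 <= k < n.+1) gcoef th k *: w k).
  by apply: (sn_sum S) => k _; exact: (snZ S).
have Lr : L (u n f - B f) by apply: (snB S); [exact: Lu|exact: LB].
suff H : p (iter n A (f - B f)) <=
   (M + th * C / (1 - th) + M * M) * frac_tail th n * p f.
  apply: (le_trans H); rewrite ler_wpM2r ?(sn_ge0 S)// ler_wpM2l//.
  exact: frac_tail_le.
rewrite split_f.
apply: le_trans (op_comb_le S (On n) _ _ _) _ => //.
  by apply: (snD S) => //; exact: (snZ S).
rewrite ger0_norm//.
have b1 : frac_tail th n * p (iter n A f) <= M * frac_tail th n * p f.
  by rewrite [M * _]mulrC -mulrA ler_wpM2l// pb.
have b3 : p (iter n A (u n f - B f)) <= M * M * frac_tail th n * p f.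
  apply: le_trans (pb n Lr) _; rewrite -!mulrA ler_wpM2l//.
  by rewrite mulrA [M * _]mulrC; exact: frac_series_tail.
have b2 : p (iter n A (\sum_(1 <= k < n.+1) gcoef th k *: w k)) <=
    th * C / (1 - th) * frac_tail th n * p f.
  apply: le_trans (op_sum_le S (On n) _ _ _) _ => //.
  apply: (@le_trans _ _ (\sum_(1 <= k < n.+1)
      k%:R * gcoef th k * (C / n.+1%:R * p f))).
    apply: ler_sum => k _; rewrite ger0_norm ?gcoef_ge0//.
    rewrite (op_subE S (On n))// -iterD.
    rewrite [k%:R * _]mulrC -[leRHS]mulrA ler_wpM2l ?gcoef_ge0//.
    by rewrite mulrA; exact: ritt_lag.
  rewrite -mulr_suml sum_mul_gcoef//.
  have -> : th * (n%:R * frac_tail th n / (1 - th)) * (C / n.+1%:R * p f) =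
     n%:R / n.+1%:R * (th * C / (1 - th) * frac_tail th n * p f) by ring.
  rewrite ler_piMl//.
    apply: mulr_ge0; last exact: (sn_ge0 S); apply: mulr_ge0 => //.
    by apply: divr_ge0 => //; exact: mulr_ge0.
  by rewrite ler_pdivrMr ?ltr0n// mul1r ler_nat.
have b2' := op_comb_le S (On n) 1 Lsum Lr.
rewrite normr1 mul1r in b2'.
apply: le_trans (lerD b1 (le_trans b2' (lerD b2 b3))) _.
by rewrite !mulrDl !addrA.
Qed.

End FractionalPower.

(** Of the n steps, the first half supplies the decay for m factors I - A, and
    the second half turns one more factor into a gain of 1/n. *)
Lemma integer_power_decay (U : V -> V) (th : R) : 0 <= th ->
  (forall f, L f -> L (U f)) ->
  (exists2 D : R, 0 <= D &
    forall n f, L f -> p (iter n A (U f)) <= D * n.+1%:R `^ (- th) * p f) ->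
  forall m, exists2 D : R, 0 <= D & forall n f, L f ->
    p (iter n A (iter m (fun g => g - A g) (U f))) <=
      D * n.+1%:R `^ (- (th + m%:R)) * p f.
Proof.
move=> th0 LU HU; elim=> [|m [D D0 IH]]; first by rewrite addr0.
exists (C * D * 2 `^ (1 + (th + m%:R))) => [|n f Lf].
  by rewrite !mulr_ge0 ?powR_ge0.
pose g := iter m (fun g => g - A g) (U f); have Lg : L g.
  by rewrite /g; elim: m {IH g} => [|k IHk] /=;
    [exact: LU|apply: (snB S) => //; exact: (op_in OA)].
have LAg := op_in OA Lg.
rewrite -[iter m.+1 _ _]/(g - A g) (op_subE S (On n))// -iterSr.
have nE : n = (n - n./2 + n./2)%N by rewrite subnK// -{2}(odd_double_half n) -addnn; lia.
have n1 : n.+1%:R / 2 <= (n - n./2).+1%:R :> R.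
  rewrite ler_pdivrMr// -natrM ler_nat; lia.
have n2 : n.+1%:R / 2 <= n./2.+1%:R :> R.
  rewrite ler_pdivrMr// -natrM ler_nat; lia.
(* One application of A is kept for the difference A^j - A^(j+1), where j is the
   half of n that is rounded up. *)
rewrite {1 2}nE -addSn !iterD.
have LAn : L (iter n./2 A g) by exact: (op_iter_in OA).
apply: (le_trans (ritt _ LAn)).
have h0 : 0 < n.+1%:R / 2 :> R by rewrite divr_gt0 ?ltr0n.
have thm : 0 <= th + m%:R by rewrite addr_ge0.
apply: (@le_trans _ _ (C / (n.+1%:R / 2) * (D * (n.+1%:R / 2) `^ (- (th + m%:R)) * p f))).
  apply: ler_pM.
  - by rewrite divr_ge0.
  - exact: (sn_ge0 S).
  - by rewrite ler_wpM2l// lef_pV2 ?posrE ?ltr0n//.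
  - apply: (le_trans (IH _ _ Lf)); rewrite ler_wpM2r ?(sn_ge0 S)// ler_wpM2l//.
    rewrite !powRN lef_pV2 ?posrE ?powR_gt0 ?ltr0n//.
    by apply: ge0_ler_powR => //; rewrite nnegrE ?ler0n ?ltW.
have -> : th + m.+1%:R = 1 + (th + m%:R) by rewrite -natr1; ring.
have -> : (C / (n.+1%:R / 2)) = C * (n.+1%:R / 2) `^ (- 1).
  by rewrite powR_inv1 ?ltW.
rewrite [leLHS]mulrA ler_wpM2r ?(sn_ge0 S)//.
rewrite mulrACA -powRD; last by rewrite (gt_eqF h0) implybT.
rewrite -opprD -[leRHS]mulrA ler_wpM2l ?mulr_ge0//.
rewrite powRM ?invr_ge0// [_ * _ `^ _]mulrC.
by rewrite -powR_inv1// -powRrM mulrNN mul1r.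
Qed.

End RittDecay.

(** * Laurent polynomials in an operator *)

(** The Laurent polynomial X^(-D) q, where X^k is replaced by [phi k].  The values
    of [phi] will be powers of an operator applied to a vector, or exponentials;
    a product of Laurent polynomials corresponds to a composition in the first
    case and to a product in the second. *)
Definition laurent (R : pzRingType) (W : lmodType R) (D : int) (q : seq R)
    (phi : int -> W) : W :=
  \sum_(i < size q) q`_i *: phi (i%:Z - D).

Section Laurent.
Context (R : comNzRingType) (W : lmodType R).
Implicit Types (D : int) (q : {poly R}) (phi : int -> W).

Lemma laurent_wide n D q phi : (size q <= n)%N ->
  laurent D q phi = \sum_(i < n) q`_i *: phi (i%:Z - D).
Proof.
move=> qn; rewrite /laurent (big_ord_widen n (fun i => q`_i *: phi (i%:Z - D)))//.
rewrite [RHS](bigID (fun i : 'I_n => (i < size q)%N))/= [X in _ = _ + X]big1 ?addr0//.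
by move=> i; rewrite -leqNgt => qi; rewrite nth_default// scale0r.
Qed.

Lemma laurentD D q1 q2 phi :
  laurent D (q1 + q2)%R phi = laurent D q1 phi + laurent D q2 phi.
Proof.
set n := maxn (size q1) (size q2).
rewrite (@laurent_wide n D (q1 + q2)) ?size_polyD//.
rewrite (@laurent_wide n D q1) ?leq_maxl// (@laurent_wide n D q2) ?leq_maxr//.
by rewrite -big_split/=; apply: eq_bigr => i _; rewrite coefD scalerDl.
Qed.

Lemma laurentZ D a q phi : laurent D (a *: q)%R phi = a *: laurent D q phi.
Proof.
rewrite (@laurent_wide (size q)) ?size_scale_leq// /laurent scaler_sumr.
by apply: eq_bigr => i _; rewrite coefZ scalerA.
Qed.

Lemma laurentB D q1 q2 phi :
  laurent D (q1 - q2)%R phi = laurent D q1 phi - laurent D q2 phi.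
Proof. by rewrite laurentD -[(- q2)%R]scaleN1r laurentZ scaleN1r. Qed.

Lemma laurent0 D phi : laurent D (0 : {poly R}) phi = 0.
Proof. by rewrite /laurent size_poly0 big_ord0. Qed.

Lemma laurent_sum D (I : Type) (s : seq I) (F : I -> {poly R}) phi :
  laurent D (\sum_(i <- s) F i)%R phi = \sum_(i <- s) laurent D (F i) phi.
Proof.
elim: s => [|i s IH]; first by rewrite !big_nil laurent0.
by rewrite !big_cons laurentD IH.
Qed.

Lemma laurent_mulXn k D q phi :
  laurent D ('X^k * q)%R phi = laurent D q (fun l => phi (l + k%:Z)).
Proof.
rewrite (@laurent_wide (k + size q)); last first.
  by rewrite (leq_trans (size_polyMleq _ _))// size_polyXn.
rewrite big_split_ord/= big1 ?add0r => [|i _]; last first.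
  by rewrite coefXnM ltn_ord scale0r.
apply: eq_bigr => i _; rewrite coefXnM ltnNge leq_addr/= addKn.
by congr (_ *: phi _); rewrite PoszD; ring.
Qed.

Lemma laurent_mul D1 D2 q1 q2 phi : laurent (D1 + D2) (q1 * q2)%R phi =
  laurent D1 q1 (fun k => laurent D2 q2 (fun l => phi (k + l))).
Proof.
rewrite {1}[q1](_ : _ = \sum_(i < size q1) q1`_i *: 'X^i); last first.
  by rewrite -poly_def coefK.
rewrite mulr_suml laurent_sum; apply: eq_bigr => i _.
rewrite -scalerAl laurentZ laurent_mulXn /laurent; congr (_ *: _).
by apply: eq_bigr => j _; congr (_ *: phi _); ring.
Qed.

End Laurent.

(** The l^1 norm of the coefficients, submultiplicative under the product of
    polynomials, that is under convolution. *)
Definition norm1 (R : numDomainType) (q : seq R) : R := \sum_(i < size q) `|q`_i|.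

Section Norm1.
Context (R : realDomainType).
Implicit Types q : {poly R}.

Lemma norm1_wide n q : (size q <= n)%N -> norm1 q = \sum_(i < n) `|q`_i|.
Proof.
move=> qn; rewrite /norm1 (big_ord_widen n (fun i => `|q`_i|))//.
rewrite [RHS](bigID (fun i : 'I_n => (i < size q)%N))/= [X in _ = _ + X]big1 ?addr0//.
by move=> i; rewrite -leqNgt => qi; rewrite nth_default// normr0.
Qed.

Lemma norm1_ge0 q : 0 <= norm1 q.
Proof. by apply: sumr_ge0. Qed.

Lemma norm1D q1 q2 : norm1 (q1 + q2)%R <= norm1 q1 + norm1 q2.
Proof.
set n := maxn (size q1) (size q2).
rewrite (@norm1_wide n (q1 + q2)) ?size_polyD//.
rewrite (@norm1_wide n q1) ?leq_maxl// (@norm1_wide n q2) ?leq_maxr//.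
by rewrite -big_split/=; apply: ler_sum => i _; rewrite coefD ler_normD.
Qed.

Lemma norm1Z a q : norm1 (a *: q)%R = `|a| * norm1 q.
Proof.
rewrite (@norm1_wide (size q)) ?size_scale_leq// /norm1 mulr_sumr.
by apply: eq_bigr => i _; rewrite coefZ normrM.
Qed.

Lemma norm1N q : norm1 (- q)%R = norm1 q.
Proof. by rewrite -scaleN1r norm1Z normrN1 mul1r. Qed.

Lemma norm1B q1 q2 : norm1 (q1 - q2)%R <= norm1 q1 + norm1 q2.
Proof. by rewrite (le_trans (norm1D _ _))// norm1N. Qed.

Lemma norm1_mulXn k q : norm1 ('X^k * q)%R = norm1 q.
Proof.
rewrite (@norm1_wide (k + size q)); last first.
  by rewrite (leq_trans (size_polyMleq _ _))// size_polyXn.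
rewrite big_split_ord/= big1 ?add0r => [|i _]; last first.
  by rewrite coefXnM ltn_ord normr0.
by apply: eq_bigr => i _; rewrite coefXnM ltnNge leq_addr/= addKn.
Qed.

Lemma norm1M q1 q2 : norm1 (q1 * q2)%R <= norm1 q1 * norm1 q2.
Proof.
rewrite {1}[q1](_ : _ = \sum_(i < size q1) q1`_i *: 'X^i); last first.
  by rewrite -poly_def coefK.
rewrite {2}/norm1 !mulr_suml.
elim/big_rec2: _ => [|i q y _ IH]; first by rewrite /norm1 size_poly0 big_ord0.
rewrite (le_trans (norm1D _ _))// lerD// -scalerAl norm1Z norm1_mulXn//.
Qed.

Lemma norm1X n q : norm1 q <= 1 -> norm1 (q ^+ n)%R <= 1.
Proof.
move=> q1; elim: n => [|n IH]; first by rewrite /norm1 size_poly1 big_ord1 coefC/= normr1.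
by rewrite exprS (le_trans (norm1M _ _))// mulr_ile1 ?norm1_ge0.
Qed.

Lemma norm1_subX n q1 q2 : norm1 q1 <= 1 -> norm1 q2 <= 1 ->
  norm1 (q1 ^+ n - q2 ^+ n)%R <= n%:R * norm1 (q1 - q2)%R.
Proof.
move=> h1 h2; elim: n => [|n IH].
  by rewrite !expr0 subrr /norm1 size_poly0 big_ord0 mul0r.
have -> : (q1 ^+ n.+1 - q2 ^+ n.+1 =
   q1 * (q1 ^+ n - q2 ^+ n) + (q1 - q2) * q2 ^+ n)%R by rewrite !exprS; ring.
rewrite (le_trans (norm1D _ _))// -natr1 [leRHS]mulrDl mul1r lerD//.
  by rewrite (le_trans (norm1M _ _))// -[leRHS]mul1r ler_pM ?norm1_ge0.
by rewrite (le_trans (norm1M _ _))// -[leRHS]mulr1 ler_pM ?norm1_ge0// norm1X.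
Qed.

End Norm1.

Section OperatorPolynomials.
Context (R : realType) (V : lmodType R) (L : set V) (p : V -> R).
Hypothesis S : seminorm L p.
Context (M : R) (G : set int) (Tk : int -> V -> V).
Hypothesis G0 : G 0.
Hypothesis GD : forall k l, G k -> G l -> G (k + l).
Hypothesis OT : forall k, G k -> oper L p M (Tk k).
Hypothesis T0 : forall f, Tk 0 f = f.
Hypothesis TD : forall k l f, G k -> G l -> L f ->
  p (Tk k (Tk l f) - Tk (k + l) f) = 0.
(* Outside of [G] the map [Tk k] is only used with a zero coefficient. *)
Hypothesis LT : forall k f, L f -> L (Tk k f).

Definition opoly (D : int) (q : seq R) (f : V) : V := laurent D q (fun k => Tk k f).

Definition supported (D : int) (q : seq R) : Prop :=
  forall i : nat, q`_i != 0 -> G (i%:Z - D).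

Let M0 : 0 <= M. Proof. exact: op_ge0 (OT G0). Qed.

Lemma opoly_in D q f : L f -> L (opoly D q f).
Proof. by move=> Lf; apply: (sn_sum S) => i _; apply: (snZ S); exact: LT. Qed.

Lemma opoly_bound D q f : supported D q -> L f ->
  p (opoly D q f) <= M * norm1 q * p f.
Proof.
move=> sq Lf; apply: le_trans (sn_sum_le S _ _) _.
  by move=> i _; apply: (snZ S); exact: LT.
rewrite [M * _]mulrC -mulrA mulr_suml; apply: ler_sum => i _.
rewrite (sn_scale S); last exact: LT.
have [->|qi] := eqVneq q`_i 0; first by rewrite normr0 !mul0r.
by rewrite ler_wpM2l// (op_bound (OT (sq _ qi))).
Qed.

Lemma opoly_oper D q : supported D q -> oper L p (M * norm1 q) (opoly D q).
Proof.
move=> sq; split=> [|f Lf|a f g Lf Lg|f Lf]; last exact: opoly_bound.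
- by rewrite mulr_ge0// sumr_ge0.
- exact: opoly_in.
rewrite /opoly /laurent scaler_sumr -big_split/= -sumrB.
have Lafg : L (a *: f + g) by apply: (snD S) => //; exact: (snZ S).
apply/le_anti; rewrite (sn_ge0 S) andbT.
apply: le_trans (sn_sum_le S _ _) _ => [i _|].
  apply: (snB S); first by apply: (snZ S); exact: LT.
  by apply: (snD S); do ?apply: (snZ S); exact: LT.
apply: sumr_le0 => i _.
have [->|qi] := eqVneq q`_i 0; first by rewrite !scale0r scaler0 addr0 subrr (sn_p0 S).
have -> : q`_i *: Tk (i%:Z - D) (a *: f + g) -
   (a *: (q`_i *: Tk (i%:Z - D) f) + q`_i *: Tk (i%:Z - D) g) =
   q`_i *: (Tk (i%:Z - D) (a *: f + g) -
     (a *: Tk (i%:Z - D) f + Tk (i%:Z - D) g)).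
  by rewrite scalerBr scalerDr !scalerA [a * _]mulrC.
rewrite (sn_scale S) ?(op_lin (OT (sq _ qi)))// ?mulr0//.
by apply: (snB S); [|apply: (snD S); [apply: (snZ S)|]]; exact: LT.
Qed.

Lemma supported_mul D1 D2 (q1 q2 : {poly R}) :
  supported D1 q1 -> supported D2 q2 -> supported (D1 + D2) (q1 * q2)%R.
Proof.
move=> s1 s2 k; rewrite coefM => nz.
suff [i ni] : exists i : 'I_k.+1, q1`_i * q2`_(k - i) != 0.
  have := ni; rewrite mulf_eq0 negb_or => /andP[/s1 h1 /s2 h2].
  have := GD h1 h2; congr G; rewrite -subzn; last by rewrite -ltnS ltn_ord.
  by ring.
apply/existsP; apply: contraNT nz => /existsPn h.
by apply/eqP/big1 => i _; apply/eqP; have := h i; rewrite negbK.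
Qed.

Lemma opoly_mul D1 D2 (q1 q2 : {poly R}) f :
  supported D1 q1 -> supported D2 q2 -> L f ->
  p (opoly D1 q1 (opoly D2 q2 f) - opoly (D1 + D2) (q1 * q2)%R f) = 0.
Proof.
move=> s1 s2 Lf; rewrite /opoly laurent_mul /laurent -sumrB.
apply/le_anti; rewrite (sn_ge0 S) andbT.
have Ls k : L (\sum_(i < size q2) q2`_i *: Tk (k + (i%:Z - D2)) f).
  by apply: (sn_sum S) => i _; apply: (snZ S); exact: LT.
have Lq : L (\sum_(i < size q2) q2`_i *: Tk (i%:Z - D2) f).
  by apply: (sn_sum S) => i _; apply: (snZ S); exact: LT.
apply: le_trans (sn_sum_le S _ _) _ => [i _|].
  by apply: (snB S); apply: (snZ S) => //; exact: LT.
apply: sumr_le0 => i _; rewrite -scalerBr (sn_scale S); last first.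
  by apply: (snB S) => //; exact: LT.
have [->|qi] := eqVneq q1`_i 0; first by rewrite normr0 !mul0r.
set k := i%:Z - D1; have Gk : G k by exact: s1.
apply: mulr_ge0_le0 => //.
apply: (@le_trans _ _ 0) => //.
apply: le_trans (sn_dist_tri S
  (g := \sum_(j < size q2) q2`_j *: Tk k (Tk (j%:Z - D2) f)) _ _ _) _ => //.
- exact: LT.
- by apply: (sn_sum S) => j _; apply: (snZ S); do 2 apply: LT.
rewrite (op_sum S (OT Gk)) ?add0r; last by move=> j; exact: LT.
rewrite -sumrB; apply: le_trans (sn_sum_le S _ _) _ => [j _|].
  by apply: (snB S); apply: (snZ S); do ?apply: LT.
apply: sumr_le0 => j _; rewrite -scalerBr (sn_scale S); last first.
  by apply: (snB S); do ?apply: LT.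
have [->|qj] := eqVneq q2`_j 0; first by rewrite normr0 !mul0r.
by rewrite TD ?mulr0//; exact: s2.
Qed.

Lemma supported1 : supported 0 (1 : {poly R}).
Proof. by move=> [|i]; rewrite coefC ?eqxx// subr0. Qed.

Lemma supportedX n D (q : {poly R}) : supported D q ->
  supported (n%:Z * D) (q ^+ n)%R.
Proof.
move=> sq; elim: n => [|n IH]; first by rewrite mul0r expr0; exact: supported1.
rewrite exprS (_ : n.+1%:Z * D = D + n%:Z * D) ?intS; last by ring.
exact: supported_mul.
Qed.

Lemma supportedB D (q1 q2 : {poly R}) : supported D q1 -> supported D q2 ->
  supported D (q1 - q2)%R.
Proof.
move=> s1 s2 i; have [q1i|/s1//] := eqVneq q1`_i 0.
by rewrite coefB q1i sub0r oppr_eq0; exact: s2.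
Qed.

Lemma supported_mulXn k D (q : {poly R}) : supported D q ->
  supported (k%:Z + D) ('X^k * q)%R.
Proof.
move=> sq i; rewrite coefXnM; case: ltnP => [_|ki]; first by rewrite eqxx.
by move=> /sq; congr G; rewrite -subzn//; ring.
Qed.

Lemma opoly_iter n D (q : {poly R}) f : supported D q -> L f ->
  p (iter n (opoly D q) f - opoly (n%:Z * D) (q ^+ n)%R f) = 0.
Proof.
move=> sq Lf; elim: n => [|n IH].
  by rewrite expr0 mul0r /= /opoly /laurent size_poly1 big_ord1 coefC/= scale1r T0 subrr
    (sn_p0 S).
rewrite iterS exprS (_ : n.+1%:Z * D = D + n%:Z * D) ?intS; last by ring.
have Oq := opoly_oper sq.
have Li : L (iter n (opoly D q) f) by exact: (op_iter_in Oq).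
apply/le_anti; rewrite (sn_ge0 S) andbT.
apply: le_trans (sn_dist_tri S (g := opoly D q (opoly (n%:Z * D) (q ^+ n)%R f)) _ _ _) _;
  try exact: opoly_in.
- by do 2 apply: opoly_in.
rewrite opoly_mul ?addr0//; last exact: supportedX.
apply: le_trans (op_lipschitz S Oq _ _) _ => //; first exact: opoly_in.
by rewrite IH mulr0.
Qed.

Lemma opoly_iter_bound n D (q : {poly R}) f : supported D q -> norm1 q <= 1 ->
  L f -> p (iter n (opoly D q) f) <= M * p f.
Proof.
move=> sq q1 Lf; rewrite (sn_eq S _ _ (opoly_iter n sq Lf)); last 2 first.
- by apply: op_iter_in (opoly_oper sq) _ _ _.
- exact: opoly_in.
apply: le_trans (opoly_bound (supportedX (n := n) sq) Lf) _.
by rewrite ler_wpM2r ?(sn_ge0 S)// ler_piMr// norm1X.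
Qed.

(** The exponent of X^D aligns the n-th and the (n+1)-st power of X^(-D) q on the
    common denominator X^((n+1) D). *)
Lemma opoly_iter_diff n (D : nat) (q : {poly R}) f : supported D%:Z q -> L f ->
  p (iter n (opoly D%:Z q) f - iter n.+1 (opoly D%:Z q) f) <=
  M * norm1 ('X^D * q ^+ n - q ^+ n.+1)%R * p f.
Proof.
move=> sq Lf; have Oq := opoly_oper sq.
have Li k : L (iter k (opoly D%:Z q) f) by exact: (op_iter_in Oq).
have e : n.+1%:Z * D%:Z = D%:Z + n%:Z * D%:Z by rewrite intS; ring.
have s0 := supported_mulXn (k := D) (supportedX (n := n) sq).
have s1 := supportedX (n := n.+1) sq; rewrite e in s1.
have s2 : supported (D%:Z + n%:Z * D%:Z) ('X^D * q ^+ n - q ^+ n.+1)%R by exact: supportedB.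
apply: le_trans (opoly_bound s2 Lf).
have -> : opoly (D%:Z + n%:Z * D%:Z) ('X^D * q ^+ n - q ^+ n.+1)%R f =
  opoly (n%:Z * D%:Z) (q ^+ n)%R f - opoly (n.+1%:Z * D%:Z) (q ^+ n.+1)%R f.
  rewrite e /opoly laurentB laurent_mulXn; congr (_ - _).
  by apply: eq_bigr => i _; congr (_ *: Tk _ _); ring.
apply: le_trans (sn_dist_tri S (g := opoly (n%:Z * D%:Z) (q ^+ n)%R f) _ _ _) _ => //.
  exact: opoly_in.
rewrite opoly_iter// add0r.
apply: le_trans (sn_dist_tri S (g := opoly (n.+1%:Z * D%:Z) (q ^+ n.+1)%R f) _ _ _) _ => //;
  try exact: opoly_in.
by rewrite [p (opoly _ _ _ - iter _ _ _)](sn_dist S) ?opoly_iter ?addr0//; exact: opoly_in.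
Qed.

End OperatorPolynomials.

(** * Limits of operators *)

(** The operators [A N] converge to [B] in operator norm, at speed [eta]; estimates
    on a fixed number of iterations pass to the limit. *)
Section OperatorLimit.
Context (R : realType) (V : lmodType R) (L : set V) (p : V -> R).
Hypothesis S : seminorm L p.
Context (M : R) (A : nat -> V -> V) (B : V -> V) (eta : nat -> R).
Hypothesis M0 : 0 <= M.
Hypothesis OA : forall N, oper L p M (A N).
Hypothesis pA : forall N n f, L f -> p (iter n (A N) f) <= M * p f.
Hypothesis LB : forall f, L f -> L (B f).
Hypothesis AB : forall N f, L f -> p (B f - A N f) <= eta N * p f.
Hypothesis eta0 : eta @ \oo --> 0.

Let LA N n f : L f -> L (iter n (A N) f).
Proof. exact: (op_iter_in (OA N)). Qed.

Lemma lim_oper : oper L p M B.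
Proof.
split=> [//|//|a f g Lf Lg|f Lf]; last first.
  apply: (@le_of_le_add_cvg0 _ _ _ (fun N => eta N * p f)).
    by rewrite -[0](mul0r (p f)); apply: cvgM => //; exact: cvg_cst.
  near=> N; apply: le_trans (sn_le_dist S (LB Lf) (op_in (OA N) Lf)) _.
  by rewrite addrC lerD ?(op_bound (OA N)) ?AB.
have Lafg : L (a *: f + g) by apply: (snD S) => //; exact: (snZ S).
have LBB : L (a *: B f + B g) by apply: (snD S); [apply: (snZ S)|]; exact: LB.
apply/le_anti; rewrite (sn_ge0 S) andbT.
apply: (@le_of_le_add_cvg0 _ _ _ (fun N => eta N * (p (a *: f + g) + (`|a| * p f + p g)))).
  by rewrite -[0](mul0r (p (a *: f + g) + (`|a| * p f + p g))); apply: cvgM => //;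
    exact: cvg_cst.
near=> N; rewrite add0r.
have LAf := op_in (OA N) Lf; have LAg := op_in (OA N) Lg.
have LAA : L (a *: A N f + A N g) by apply: (snD S) => //; exact: (snZ S).
apply: le_trans (sn_dist_tri S (g := A N (a *: f + g)) (LB Lafg) (op_in (OA N) Lafg) LBB) _.
rewrite mulrDr lerD ?AB//.
apply: le_trans (sn_dist_tri S (g := a *: A N f + A N g) (op_in (OA N) Lafg) LAA LBB) _.
rewrite (op_lin (OA N))// add0r opprD addrACA -scalerBr.
apply: le_trans (sn_triangle S _ _) _.
- by apply: (snZ S); apply: (snB S) => //; exact: LB.
- by apply: (snB S) => //; exact: LB.
rewrite (sn_scale S); last by apply: (snB S) => //; exact: LB.
rewrite (sn_dist S) ?(sn_dist S (f := A N g))//; try exact: LB.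
by rewrite mulrDr lerD ?AB// mulrCA ler_wpM2l// AB.
Unshelve. all: by end_near. Qed.

Lemma lim_iter n f : L f -> p (iter n B f - iter n (A N) f) @[N --> \oo] --> 0.
Proof.
move=> Lf; have LBn k : L (iter k B f) by exact: (op_iter_in lim_oper).
elim: n => [|n IH].
  by under eq_fun do rewrite subrr (sn_p0 S); exact: cvg_cst.
apply: (@squeeze_cvgr _ _ _ _ (fun=> 0)
  (fun N => eta N * p (iter n B f) + M * p (iter n B f - iter n (A N) f))).
- near=> N; rewrite (sn_ge0 S)/= .
  apply: le_trans (sn_dist_tri S (g := A N (iter n B f)) _ _ _) _;
    try exact: (LA N n.+1 Lf).
  + exact: (LBn n.+1).
  + exact: (op_in (OA N)).
  rewrite lerD ?AB//; apply: (op_lipschitz S (OA N)) => //; exact: LA.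
- exact: cvg_cst.
- rewrite [X in _ --> X](_ : 0 = 0 * p (iter n B f) + M * 0);
  last by rewrite mul0r mulr0 addr0.
  by apply: cvgD; apply: cvgM => //; exact: cvg_cst.
Unshelve. all: by end_near. Qed.

Lemma lim_iter_bound n f : L f -> p (iter n B f) <= M * p f.
Proof.
move=> Lf; apply: (le_of_le_add_cvg0 (lim_iter n Lf)); near=> N.
have LBn : L (iter n B f) by exact: (op_iter_in lim_oper).
apply: le_trans (sn_le_dist S LBn (LA N n Lf)) _.
by rewrite addrC lerD2r pA.
Unshelve. all: by end_near. Qed.

Lemma lim_iter_diff n C (c : nat -> R) : c @ \oo --> 0 ->
  (forall N f, L f -> p (iter n (A N) f - iter n.+1 (A N) f) <= (C + c N) * p f) ->
  forall f, L f -> p (iter n B f - iter n.+1 B f) <= C * p f.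
Proof.
move=> c0 AC f Lf; have LBn k : L (iter k B f) by exact: (op_iter_in lim_oper).
apply: (@le_of_le_add_cvg0 _ _ _ (fun N => c N * p f +
  p (iter n B f - iter n (A N) f) + p (iter n.+1 B f - iter n.+1 (A N) f))).
  rewrite [X in _ --> X](_ : 0 = 0 * p f + 0 + 0); last by rewrite mul0r !addr0.
  apply: cvgD; last exact: lim_iter.
  by apply: cvgD; [apply: cvgM => //; exact: cvg_cst|exact: lim_iter].
near=> N.
have LAn := LA N n Lf; have LAn1 := LA N n.+1 Lf.
apply: le_trans (sn_dist_tri S (g := iter n (A N) f) _ _ _) _ => //.
have := sn_dist_tri S (g := iter n.+1 (A N) f) LAn LAn1 (LBn n.+1).
have := AC N f Lf; rewrite mulrDl [p (iter n.+1 (A N) f - _)](sn_dist S)//.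
by lra.
Unshelve. all: by end_near. Qed.

End OperatorLimit.

(** * Symmetric sums over the integers *)

Section SymmetricSums.
Context (V : nmodType).
Implicit Types F : int -> V.

Lemma psumZ0 F : psumZ F 0 = F 0.
Proof. by rewrite /psumZ big_ord1 subrr. Qed.

Lemma psumZS F N : psumZ F N.+1 = psumZ F N + (F N.+1%:Z + F (- N.+1%:Z)).
Proof.
rewrite /psumZ doubleS big_ord_recl big_ord_recr/= sub0r addrC -addrA.
congr (_ + (F _ + _)); last by rewrite /bump/= -addnn; lia.
by apply: eq_bigr => i _; congr F; rewrite /bump/=; lia.
Qed.

Lemma psumZE F N : psumZ F N = F 0 + \sum_(1 <= m < N.+1) (F m%:Z + F (- m%:Z)).
Proof.
elim: N => [|N IH]; first by rewrite psumZ0 big_geq// addr0.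
by rewrite psumZS IH [in RHS]big_nat_recr//= -addrA.
Qed.

End SymmetricSums.

Section DominatedSums.
Context (R : realType) (mu : int -> R).
Hypothesis mu_prob : is_probability mu.

Let mu0 k : 0 <= mu k. Proof. exact: mu_prob.1. Qed.

Lemma psumZ_nondecreasing (F : int -> R) : (forall k, 0 <= F k) ->
  {homo psumZ F : m n / (m <= n)%N >-> m <= n}.
Proof.
move=> F0 m n mn; rewrite -(subnKC mn); elim: (n - m)%N => [|d IH].
  by rewrite addn0.
by rewrite addnS psumZS (le_trans IH)// lerDl addr_ge0.
Qed.

Lemma uniq_sum_le_psumZ (s : seq int) N : uniq s ->
  (forall k, k \in s -> (`|k| <= N)%N) -> \sum_(k <- s) mu k <= psumZ mu N.
Proof.
move=> us sN; pose t := [seq i%:Z - N%:Z | i <- iota 0 N.*2.+1].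
have -> : psumZ mu N = \sum_(k <- t) mu k.
  rewrite /t big_map /psumZ -[iota _ _]/(index_iota 0 N.*2.+1).
  by rewrite big_mkord.
have ut : uniq t.
  by rewrite map_inj_uniq ?iota_uniq// => i j; lia.
have st : perm_eq s [seq k <- t | k \in s].
  apply: uniq_perm => //; first exact: filter_uniq.
  move=> k; rewrite mem_filter; have [ks|//] := boolP (k \in s).
  apply/esym; apply/mapP; exists (absz (k + N%:Z)); last by have := sN k ks; lia.
  by rewrite mem_iota -addnn; have := sN k ks; lia.
rewrite (perm_big _ st) big_filter [leLHS]big_mkcond; apply: ler_sum => k _.
by case: ifP.
Qed.

Lemma psumZ_le1 N : psumZ mu N <= 1.
Proof.
pose t := [seq i%:Z - N%:Z | i <- iota 0 N.*2.+1].
have ut : uniq t by rewrite map_inj_uniq ?iota_uniq// => i j; lia.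
rewrite -lee_fin -mu_prob.2.
rewrite (_ : psumZ mu N = \sum_(k <- t) mu k); last first.
  rewrite /t big_map /psumZ -[iota _ _]/(index_iota 0 N.*2.+1).
  by rewrite big_mkord.
rewrite -sumEFin fsbig_seq//; apply: esum_ge; exists [set` t] => //.
by split => //; exact: finite_seq.
Qed.

Lemma psumZ_mu_cvg : psumZ mu N @[N --> \oo] --> (1 : R).
Proof.
apply/cvgrPdist_le => e e0.
have : ((1 - e)%:E < \esum_(k in [set: int]) (mu k)%:E)%E.
  by rewrite mu_prob.2 lte_fin ltrBlDr ltrDl.
move=> /ereal_sup_gt[_ [A [finA _] <-]]; rewrite fsbig_finite// sumEFin lte_fin => hA.
set s := finmap.enum_fset _ in hA.
exists (\max_(k <- s) `|k|)%N => // N /= hN.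
rewrite ger0_norm ?subr_ge0 ?psumZ_le1//.
have : \sum_(k <- s) mu k <= psumZ mu N.
  apply: uniq_sum_le_psumZ; first exact: finmap.fset_uniq.
  by move=> k ks; apply: leq_trans hN; exact: leq_bigmax_seq.
move: hA; lra.
Qed.

Definition mass_tail (N : nat) : R := 1 - psumZ mu N.

Lemma mass_tail_ge0 N : 0 <= mass_tail N.
Proof. by rewrite subr_ge0 psumZ_le1. Qed.

Lemma mass_tail_cvg0 : mass_tail N @[N --> \oo] --> (0 : R).
Proof.
by rewrite -(subrr 1); apply: cvgB; [exact: cvg_cst|exact: psumZ_mu_cvg].
Qed.

Section Dominated.
Context (F : int -> R).
Hypothesis F_le : forall k, `|F k| <= mu k.

Lemma psumZ_dist m n : (m <= n)%N ->
  `|psumZ F n - psumZ F m| <= psumZ mu n - psumZ mu m.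
Proof.
move=> mn; rewrite -(subnKC mn); elim: (n - m)%N => [|d IH].
  by rewrite addn0 !subrr normr0.
rewrite addnS !psumZS addrAC [leRHS]addrAC.
apply: le_trans (ler_normD _ _) _; apply: lerD => //.
by apply: le_trans (ler_normD _ _) _; apply: lerD.
Qed.

(** F is the difference of the nonnegative families mu + F and mu, whose symmetric
    sums are monotone and bounded. *)
Lemma psumZ_is_cvg : cvgn (psumZ F).
Proof.
have -> : psumZ F = psumZ (fun k => mu k + F k) - psumZ mu.
  apply/funext => N; rewrite -[RHS]/(psumZ _ N - psumZ mu N) /psumZ -sumrB.
  by apply: eq_bigr => i _; rewrite addrAC subrr add0r.
have ge k : 0 <= mu k + F k.
  by have := F_le k; rewrite ler_norml => /andP[h _]; rewrite addrC -(lerBlDr) sub0r.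
apply: is_cvgB; last by apply/cvg_ex; exists 1; exact: psumZ_mu_cvg.
apply: nondecreasing_is_cvgn; first by exact: psumZ_nondecreasing.
exists 2 => _ [N _ <-].
have := psumZ_le1 N; have := psumZ_dist (leq0n N).
rewrite !psumZ0 => h1 h2.
apply: (@le_trans _ _ (psumZ mu N + psumZ mu N)); last by lra.
rewrite /psumZ -big_split/=; apply: ler_sum => i _; rewrite lerD2l.
exact: le_trans (ler_norm _) (F_le _).
Qed.

Lemma sumZ_dist N : `|sumZ F - psumZ F N| <= mass_tail N.
Proof.
have c : `|psumZ F n - psumZ F N| @[n --> \oo] --> `|sumZ F - psumZ F N|.
  by apply: cvg_norm; apply: cvgB; [exact: psumZ_is_cvg|exact: cvg_cst].
rewrite -(cvg_lim _ c)//; apply: limr_le; first by apply/cvg_ex; eexists; exact: c.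
near=> n; apply: le_trans (psumZ_dist _) _; first by near: n; exact: nbhs_infty_ge.
by rewrite lerD2r psumZ_le1.
Unshelve. all: by end_near. Qed.

End Dominated.

End DominatedSums.

(** * Dyadic sums *)

Section DyadicPoints.
Context (R : realType).

Definition dy (i : nat) : R := 2^-1 ^+ i.

Lemma dy_gt0 i : 0 < dy i. Proof. by rewrite exprn_gt0// invr_gt0. Qed.

Lemma dyS i : dy i.+1 = dy i / 2. Proof. by rewrite /dy exprSr. Qed.

Lemma dy_diff i : dy i - dy i.+1 = dy i.+1.
Proof. by rewrite dyS; lra. Qed.

Lemma dy_half i : dy i.+1 <= 2^-1.
Proof. by rewrite /dy exprS ger_pMr ?invr_gt0// exprn_ile1 ?invr_ge0// invf_le1//
  ler1n. Qed.

Lemma dy_lt i : dy i.+1 < dy i.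
Proof. by rewrite dyS; have := dy_gt0 i; lra. Qed.

End DyadicPoints.

Section DyadicSums.
Context (R : realType) (e : nat -> R).
Hypothesis e0 : forall i, 0 <= e i.
Local Notation dy := (@dy R).

(** The j-th term P j satisfies P (j+1) = (P j + e j) / 2, which telescopes. *)
Lemma dyadic_sum_below J :
  \sum_(0 <= j < J) dy j * \sum_(0 <= i < j) e i / dy i <= \sum_(0 <= i < J) e i.
Proof.
pose P j := dy j * \sum_(0 <= i < j) e i / dy i.
have PS j : P j.+1 = (P j + e j) / 2.
  rewrite /P big_nat_recr//= dyS; have := dy_gt0 R j => /lt0r_neq0 h.
  by field.
have P0 j : 0 <= P j.
  apply: mulr_ge0; first exact/ltW/dy_gt0.
  by apply: sumr_ge0 => i _; apply: divr_ge0 => //; exact/ltW/dy_gt0.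
suff -> : \sum_(0 <= i < J) e i = \sum_(0 <= j < J) P j + 2 * P J.
  by rewrite lerDl mulr_ge0.
elim: J => [|J IH]; first by rewrite !big_geq// /P big_geq// !mulr0 addr0.
by rewrite !big_nat_recr//= IH PS; lra.
Qed.

(** The j-th term Q j satisfies Q j = e j + Q (j+1) / 2, which telescopes. *)
Lemma dyadic_sum_above J L : (J <= L)%N ->
  \sum_(0 <= j < J) (dy j)^-1 * \sum_(j <= i < L) e i * dy i <=
  2 * \sum_(0 <= i < L) e i.
Proof.
pose Q j := (dy j)^-1 * \sum_(j <= i < L) e i * dy i.
have QS j : (j < L)%N -> Q j = e j + Q j.+1 / 2.
  move=> jL; rewrite /Q big_ltn// dyS; have := dy_gt0 R j => /lt0r_neq0 h.
  by field.
have Q0 j : 0 <= Q j.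
  apply: mulr_ge0; first by rewrite invr_ge0; exact/ltW/dy_gt0.
  by apply: sumr_ge0 => i _; apply: mulr_ge0 => //; exact/ltW/dy_gt0.
have QL j : (j <= L)%N -> Q j <= \sum_(j <= i < L) e i.
  move=> jL; rewrite /Q mulr_sumr big_nat_cond [leRHS]big_nat_cond.
  apply: ler_sum => i /andP[/andP[ji _] _].
  rewrite mulrCA ler_piMr// mulrC ler_pdivrMr ?dy_gt0// mul1r.
  by rewrite ler_wiXn2l// ?invr_ge0// invf_le1// ler1n.
move=> JL.
suff : \sum_(0 <= j < J) Q j + Q 0%N = 2 * \sum_(0 <= i < J) e i + Q J.
  rewrite (big_cat_nat (n := J) (m := 0) (p := L))//= mulrDr => h.
  have : 0 <= \sum_(J <= i < L) e i by exact: sumr_ge0.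
  by have := QL _ JL; have := Q0 0%N; lra.
elim: J JL => [_|J IH JL]; first by rewrite !big_geq// mulr0.
by rewrite !big_nat_recr//=; rewrite mulrDr; have := IH (ltnW JL); have := QS _ JL; lra.
Qed.

End DyadicSums.

(** * Fourier coefficients of a function with a tame singularity *)

Section MeanValue.
Context (R : realType).
Implicit Types (f g : R -> R) (a b t : R).

Lemma is_der_eq f t (df dg : R) : is_derive t 1 f df -> df = dg -> is_derive t 1 f dg.
Proof. by move=> h <-. Qed.

Lemma is_der_cst c t : is_derive t (1 : R) (fun=> c : R) (0 : R).
Proof. exact: is_derive_cst. Qed.

Lemma is_der_add f g t (df dg : R) : is_derive t 1 f df -> is_derive t 1 g dg ->
  is_derive t 1 (fun x => f x + g x) (df + dg).
Proof. exact: is_deriveD. Qed.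

Lemma is_der_sub f g t (df dg : R) : is_derive t 1 f df -> is_derive t 1 g dg ->
  is_derive t 1 (fun x => f x - g x) (df - dg).
Proof. exact: is_deriveB. Qed.

Lemma is_der_mul f g t (df dg : R) : is_derive t 1 f df -> is_derive t 1 g dg ->
  is_derive t 1 (fun x => f x * g x) (df * g t + f t * dg).
Proof.
move=> hf hg; apply: (is_der_eq (is_deriveM hf hg)).
by rewrite addrC -[_ *: dg]/(_ * _) -[_ *: df]/(_ * _) [g t * _]mulrC.
Qed.

Lemma is_der_scale c f t (df : R) : is_derive t 1 f df ->
  is_derive t 1 (fun x => c * f x) (c * df).
Proof.
by move=> hf; apply: (is_der_eq (is_der_mul (is_der_cst c t) hf)); rewrite mul0r add0r.
Qed.

Lemma is_der_cos w t : is_derive t 1 (fun x => cos (w * x)) (- (w * sin (w * t))).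
Proof.
have h : is_derive t 1 (fun x => w * x) w.
  by apply: (is_der_eq (is_der_scale w (is_derive_id t 1))); rewrite mulr1.
have := @is_derive1_comp R cos ( *%R w) t _ _ (is_derive_cos (w * t)) h.
by move/is_der_eq; apply; rewrite mulNr mulrC.
Qed.

Lemma is_der_sin w t : is_derive t 1 (fun x => sin (w * x)) (w * cos (w * t)).
Proof.
have h : is_derive t 1 (fun x => w * x) w.
  by apply: (is_der_eq (is_der_scale w (is_derive_id t 1))); rewrite mulr1.
have := @is_derive1_comp R sin ( *%R w) t _ _ (is_derive_sin (w * t)) h.
by move/is_der_eq; apply; rewrite mulrC.
Qed.

Lemma mul_cos_le (a c x : R) : `|a| <= c -> `|a * cos x| <= c.
Proof.
move=> ac; apply: le_trans ac; rewrite normrM ler_piMr//.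
by rewrite ler_norml cos_geN1 cos_le1.
Qed.

Lemma mul_sin_le (a c x : R) : `|a| <= c -> `|a * sin x| <= c.
Proof.
move=> ac; apply: le_trans ac; rewrite normrM ler_piMr//.
by rewrite ler_norml sin_geN1 sin_le1.
Qed.

Lemma is_der_within f df a b : (forall t, a <= t <= b -> is_derive t 1 f (df t)) ->
  {within `[a, b], continuous f}.
Proof.
move=> h; apply: derivable_within_continuous => t; rewrite in_itv/= => /h ft.
exact: ex_derive.
Qed.

(** Stands for the integration of |f'| <= g' over [a, b]: the mean value theorem is
    applied to g - f and to g + f. *)
Lemma mean_value_le (f df g dg : R -> R) a b : a <= b ->
  {within `[a, b], continuous f} -> {within `[a, b], continuous g} ->
  (forall t, a < t < b -> is_derive t 1 f (df t)) ->
  (forall t, a < t < b -> is_derive t 1 g (dg t)) ->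
  (forall t, a < t < b -> `|df t| <= dg t) ->
  `|f b - f a| <= g b - g a.
Proof.
move=> ab cf cg hf hg le; have [<-|ab'] := eqVneq a b.
  by rewrite !subrr normr0.
have {}ab : a < b by rewrite lt_neqAle ab' ab.
have key (s : R) : `|s| = 1 -> s * (f b - f a) <= g b - g a.
  move=> s1.
  have [||c] := @MVT R (fun t => g t - s * f t) (fun t => dg t - s * df t) a b ab.
  - move=> t; rewrite in_itv/= => tab.
    by apply: is_der_sub; [exact: hg|apply: is_der_scale; exact: hf].
  - move=> t; apply: cvgB; first exact: cg.
    by apply: cvgM; [exact: cvg_cst|exact: cf].
  rewrite in_itv/= => cab h.
  have : 0 <= (dg c - s * df c) * (b - a).
    apply: mulr_ge0; last by rewrite subr_ge0 ltW.
    rewrite subr_ge0; apply: le_trans (le c cab).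
    by apply: le_trans (ler_norm _) _; rewrite normrM s1 mul1r.
  by rewrite -h; lra.
rewrite ler_norml; have := key 1 (normr1 _).
have := key (- 1); rewrite normrN1 => /(_ erefl).
rewrite mulN1r mul1r; lra.
Qed.

(** The bound on [f] holds at a point chosen by the mean value theorem for [E],
    and the bound on its derivative propagates it to the whole interval. *)
Lemma sup_le_increment (f df E dE : R -> R) a b (K1 K2 : R) : a < b ->
  0 <= K1 -> 0 <= K2 ->
  {within `[a, b], continuous f} -> {within `[a, b], continuous E} ->
  (forall t, a < t < b -> is_derive t 1 f (df t)) ->
  (forall t, a < t < b -> is_derive t 1 E (dE t)) ->
  (forall t, a < t < b -> `|f t| <= K1 * dE t) ->
  (forall t, a < t < b -> `|df t| <= K2 * dE t) ->
  forall t, a <= t <= b -> `|f t| <= (K1 / (b - a) + K2) * (E b - E a).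
Proof.
move=> ab K10 K20 cf cE hf hE b1 b2 t /andP[at_ tb].
have ba : 0 < b - a by rewrite subr_gt0.
have dmv x : x \in `]a, b[ -> is_derive x 1 E (dE x).
  by rewrite in_itv/=; exact: hE.
have [c] := @MVT R E dE a b ab dmv cE.
rewrite in_itv/= => cab Ec.
have dEc : dE c = (E b - E a) / (b - a) by rewrite Ec mulfK ?gt_eqF.
have fc : `|f c| <= K1 / (b - a) * (E b - E a).
  by apply: le_trans (b1 c cab) _; rewrite dEc [leRHS]mulrAC mulrA.
pose g x := K2 * E x; pose dg x := K2 * dE x.
have hg x : a < x < b -> is_derive x 1 g (dg x).
  by move=> xab; apply: is_der_scale; exact: hE.
have cg : {within `[a, b], continuous g}.
  by move=> x; apply: cvgM; [exact: cvg_cst|exact: cE].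
have sub x y (ax : a <= x) (yb : y <= b) : `[x, y] `<=` `[a, b].
  by apply: subset_itvScc.
have sub' x y z (ax : a <= x) (yb : y <= b) : x < z < y -> a < z < b.
  by move=> /andP[xz zy]; rewrite (le_lt_trans ax xz) (lt_le_trans zy yb).
have gmono x y : a <= x -> x <= y -> y <= b -> 0 <= g y - g x.
  move=> ax xy yb; have s1 := sub x y ax yb; rewrite -(normr0 R) -[X in `|X|](subrr 0).
  apply: (@mean_value_le (fun=> 0) (fun=> 0) g dg) => //.
  - by move=> z; exact: cvg_cst.
  - exact: continuous_subspaceW s1 cg.
  - by move=> z zxy; apply: hg; exact: sub' zxy.
  - by move=> z zxy; rewrite normr0; apply: le_trans (b2 z _) => //; exact: sub' zxy.
have fmono x y : a <= x -> x <= y -> y <= b -> `|f y - f x| <= g y - g x.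
  move=> ax xy yb; have s1 := sub x y ax yb.
  apply: (@mean_value_le f df g dg) => //.
  - exact: continuous_subspaceW s1 cf.
  - exact: continuous_subspaceW s1 cg.
  - by move=> z zxy; apply: hf; exact: sub' zxy.
  - by move=> z zxy; apply: hg; exact: sub' zxy.
  - by move=> z zxy; apply: b2; exact: sub' zxy.
move/andP: (cab) => [ac cb].
have ftc : `|f t - f c| <= K2 * (E b - E a).
  rewrite mulrBr -/(g b) -/(g a); have [tc|/ltW ct] := leP t c.
    have := fmono _ _ at_ tc (ltW cb); rewrite distrC.
    have := gmono _ _ (lexx a) at_ tb; have := gmono _ _ (ltW ac) (ltW cb) (lexx b).
    lra.
  have := fmono _ _ (ltW ac) ct tb.
  have := gmono _ _ at_ tb (lexx b); have := gmono _ _ (lexx a) (ltW ac) (ltW cb).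
  lra.
have := ler_normD (f t - f c) (f c); rewrite subrK => h.
by apply: le_trans h _; rewrite mulrDl addrC lerD.
Qed.

End MeanValue.

Lemma sin_pi_int (R : realType) (k : int) : sin (pi * k%:~R) = 0 :> R.
Proof.
have nat_case (n : nat) : sin (pi * n%:R) = 0 :> R.
  elim: n => [|n IH]; first by rewrite mulr0 sin0.
  by rewrite -natr1 mulrDr mulr1 sinDpi IH oppr0.
case: k => n; first exact: nat_case.
by rewrite NegzE mulrNz mulrN sinN nat_case oppr0.
Qed.

(** A and B are the real and imaginary parts of a function on ]0, 1/2], singular at
    0.  Its size and that of its first two derivatives are measured by the
    derivative of one nondecreasing function E, in a scale invariant way; all
    estimates are linear in the increments of E over dyadic intervals. *)
Section Dyadic.
Context (R : realType).
Local Notation dy := (@dy R).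

Context (A A1 A2 B B1 B2 E E1 : R -> R).
Hypothesis hA : forall t : R, 0 < t <= 2^-1 -> is_derive t 1 A (A1 t).
Hypothesis hA1 : forall t : R, 0 < t <= 2^-1 -> is_derive t 1 A1 (A2 t).
Hypothesis hB : forall t : R, 0 < t <= 2^-1 -> is_derive t 1 B (B1 t).
Hypothesis hB1 : forall t : R, 0 < t <= 2^-1 -> is_derive t 1 B1 (B2 t).
Hypothesis hE : forall t : R, 0 < t < 2^-1 -> is_derive t 1 E (E1 t).
Hypothesis cE : {within `[0, 2^-1], continuous E}.
Hypothesis bA : forall t : R, 0 < t < 2^-1 -> `|A t| <= t * E1 t.
Hypothesis bB : forall t : R, 0 < t < 2^-1 -> `|B t| <= t * E1 t.
Hypothesis bA1 : forall t : R, 0 < t < 2^-1 -> `|A1 t| <= E1 t.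
Hypothesis bB1 : forall t : R, 0 < t < 2^-1 -> `|B1 t| <= E1 t.
Hypothesis bA2 : forall t : R, 0 < t < 2^-1 -> `|A2 t| <= E1 t / t.
Hypothesis bB2 : forall t : R, 0 < t < 2^-1 -> `|B2 t| <= E1 t / t.
Hypothesis B_half : B 2^-1 = 0.

Definition incr (i : nat) : R := E (dy i) - E (dy i.+1).

Let inside i t : dy i.+2 < t < dy i.+1 -> 0 < t < 2^-1.
Proof.
move=> /andP[h1 h2]; rewrite (lt_trans (dy_gt0 _ _) h1)/=.
exact: lt_le_trans h2 (dy_half _ i).
Qed.

Let inside' i t : dy i.+2 <= t <= dy i.+1 -> 0 < t <= 2^-1.
Proof.
move=> /andP[h1 h2]; rewrite (lt_le_trans (dy_gt0 _ _) h1)/=.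
exact: le_trans h2 (dy_half _ i).
Qed.

Let cE_dy i : {within `[dy i.+2, dy i.+1], continuous E}.
Proof.
apply: continuous_subspaceW cE; apply: subset_itvScc; rewrite bnd_simp.
  exact/ltW/dy_gt0.
exact: dy_half.
Qed.

Lemma incr_ge0 i : 0 <= incr i.+1.
Proof.
rewrite /incr -(normr0 R) -[X in `|X|](subrr 0).
apply: (@mean_value_le _ (fun=> 0) (fun=> 0) E E1 _ _ (ltW (dy_lt _ _))) => //.
- by move=> z; exact: cvg_cst.
- by move=> t ht; apply: hE; exact: inside ht.
- by move=> t ht; rewrite normr0; apply: le_trans (bA1 (inside ht)).
Qed.

Let sup_fun (f f1 : R -> R) : (forall t : R, 0 < t <= 2^-1 -> is_derive t 1 f (f1 t)) ->
  (forall t : R, 0 < t < 2^-1 -> `|f t| <= t * E1 t) ->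
  (forall t : R, 0 < t < 2^-1 -> `|f1 t| <= E1 t) ->
  forall i t, dy i.+2 <= t <= dy i.+1 -> `|f t| <= 3 * incr i.+1.
Proof.
move=> hf b0 b1 i t ht.
have E1ge0 u : 0 < u < 2^-1 -> 0 <= E1 u by move=> /bA1; exact: le_trans.
have := @sup_le_increment _ f f1 E E1 (dy i.+2) (dy i.+1) (dy i.+1) 1 (dy_lt _ _)
  (ltW (dy_gt0 _ _)) ler01 _ (@cE_dy i) _ _ _ _ t ht.
rewrite dy_diff [dy i.+2]dyS -/(incr _).
have -> : dy i.+1 / (dy i.+1 / 2) + 1 = 3.
  by have := dy_gt0 R i.+1 => h; field; exact: lt0r_neq0.
rewrite -dyS; apply.
- by apply: is_der_within => u hu; apply: hf; exact: inside' hu.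
- by move=> u /andP[/ltW h1 /ltW h2]; apply: hf; apply: (@inside' i); rewrite h1 h2.
- by move=> u hu; apply: hE; exact: inside hu.
- move=> u hu; apply: le_trans (b0 u (inside hu)) _.
  by apply: ler_wpM2r; [apply: E1ge0; exact: inside hu|have /andP[_ /ltW] := hu].
- by move=> u hu; rewrite mul1r; apply: b1; exact: inside hu.
Qed.

Let sup_der (f1 f2 : R -> R) : (forall t : R, 0 < t <= 2^-1 -> is_derive t 1 f1 (f2 t)) ->
  (forall t : R, 0 < t < 2^-1 -> `|f1 t| <= E1 t) ->
  (forall t : R, 0 < t < 2^-1 -> `|f2 t| <= E1 t / t) ->
  forall i t, dy i.+2 <= t <= dy i.+1 -> `|f1 t| <= 4 * incr i.+1 / dy i.+1.
Proof.
move=> hf b0 b1 i t ht.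
have E1ge0 u : 0 < u < 2^-1 -> 0 <= E1 u by move=> /bA1; exact: le_trans.
have := @sup_le_increment _ f1 f2 E E1 (dy i.+2) (dy i.+1) 1 (dy i.+2)^-1 (dy_lt _ _)
  ler01 _ _ (@cE_dy i) _ _ _ _ t ht.
have -> : 1 / (dy i.+1 - dy i.+2) + (dy i.+2)^-1 = 4 / dy i.+1.
  by rewrite dy_diff dyS; have := dy_gt0 R i.+1 => h; field; exact: lt0r_neq0.
rewrite [X in _ -> _ <= X]mulrAC; apply.
- by rewrite invr_ge0 ltW// dy_gt0.
- by apply: is_der_within => u hu; apply: hf; exact: inside' hu.
- by move=> u /andP[/ltW h1 /ltW h2]; apply: hf; apply: (@inside' i); rewrite h1 h2.
- by move=> u hu; apply: hE; exact: inside hu.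
- by move=> u hu; rewrite mul1r; apply: b0; exact: inside hu.
- move=> u hu; apply: le_trans (b1 u (inside hu)) _.
  rewrite mulrC; apply: ler_wpM2r; first by apply: E1ge0; exact: inside hu.
  by rewrite lef_pV2 ?posrE ?dy_gt0//; have /andP[/ltW h1 _] := hu => //;
    exact: lt_le_trans (dy_gt0 _ _) h1.
Qed.

(** S is a primitive of a trigonometric polynomial which approximates, up to eps,
    the real part of (A + iB) exp (i w t).  The bound K on its derivative depends
    on the polynomial; it is used only on an interval ]0, dy (L+1)[ that shrinks
    to a point. *)
Section Primitive.
Context (w eps K : R) (S S1 : R -> R).
Hypothesis eps0 : 0 <= eps.
Hypothesis hS : forall t : R, is_derive t 1 S (S1 t).
Hypothesis S1_near : forall t : R, 0 < t < 2^-1 ->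
  `|S1 t - (A t * cos (w * t) - B t * sin (w * t))| <= eps.
Hypothesis S1_le : forall t : R, `|S1 t| <= K.

Let S_within a b : {within `[a, b], continuous S}.
Proof. by apply: is_der_within => t _; exact: hS. Qed.

Let mul_id_within (c a b : R) : {within `[a, b], continuous (fun t : R => c * t)}.
Proof.
apply: derivable_within_continuous => t _; exact: ex_derive.
Qed.

Let is_der_linear (c t : R) : is_derive t 1 (fun t : R => c * t) c.
Proof. by apply: (is_der_eq (is_der_scale c (is_derive_id t 1))); rewrite mulr1. Qed.

Lemma low_frequency_piece i :
  `|S (dy i.+1) - S (dy i.+2)| <= dy i.+2 * (6 * incr i.+1 + eps).
Proof.
rewrite [leRHS](_ : _ = (6 * incr i.+1 + eps) * dy i.+1 - (6 * incr i.+1 + eps)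
  * dy i.+2); last first.
  by rewrite -mulrBr dy_diff mulrC.
apply: (@mean_value_le _ S S1 (fun t => (6 * incr i.+1 + eps) * t)
  (fun=> 6 * incr i.+1 + eps) _ _ (ltW (dy_lt _ _))) => //.
move=> t ht; have ht' : dy i.+2 <= t <= dy i.+1.
  by have /andP[/ltW -> /ltW ->] := ht.
have := S1_near (inside ht).
have a3 := sup_fun hA bA bA1 ht'; have b3 := sup_fun hB bB bB1 ht'.
set X := A t * _ - _ => h.
have hX : `|X| <= 6 * incr i.+1.
  apply: le_trans (ler_normB _ _) _.
  by have := mul_cos_le (w * t) a3; have := mul_sin_le (w * t) b3; lra.
have := ler_normD (S1 t - X) X; rewrite subrK; lra.
Qed.

Lemma low_frequency_le j L : (j <= L)%N ->
  `|S (dy j.+1) - S 0| <= K * dy L.+1 + eps * (dy j.+1 - dy L.+1) +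
     \sum_(j <= i < L) 6 * (incr i.+1 * dy i.+2).
Proof.
move=> jL; have base : `|S (dy L.+1) - S 0| <= K * dy L.+1.
  rewrite [leRHS](_ : _ = K * dy L.+1 - K * 0); last by rewrite mulr0 subr0.
  by apply: (@mean_value_le _ S S1 (fun t => K * t) (fun=> K) _ _ (ltW (dy_gt0 _ _))) => //.
rewrite -(subKn jL); elim: (L - j)%N (leq_subr j L) => [_|d IH dL].
  by rewrite subn0 subrr mulr0 addr0 big_geq// addr0.
have e : (L - d = (L - d.+1).+1)%N by rewrite subnS prednK// subn_gt0.
have h := IH (ltnW dL); rewrite e in h.
rewrite big_ltn ?ltn_subrL ?(leq_ltn_trans _ dL)//.
move: h; set l := (L - d.+1)%N => h.
have := low_frequency_piece l; have := dy_diff R l.+1 => hd h2.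
have := ler_normD (S (dy l.+1) - S (dy l.+2)) (S (dy l.+2) - S 0).
rewrite addrA subrK => h3; apply: (le_trans h3).
have -> : eps * (dy l.+1 - dy L.+1) = eps * dy l.+2 + eps * (dy l.+2 - dy L.+1).
  by rewrite -mulrDr; congr (_ * _); lra.
apply: (le_trans (lerD h2 h)); rewrite le_eqVlt; apply/orP; left; apply/eqP; ring.
Qed.

(** Two integrations by parts: W is a primitive of A cos - B sin up to an error
    of size |A''| + |B''| over w^2. *)
Let W t := (A t * sin (w * t) + B t * cos (w * t)) / w +
  (A1 t * cos (w * t) - B1 t * sin (w * t)) / w ^+ 2.

Hypothesis w0 : w != 0.

Lemma der_W (t : R) : 0 < t <= 2^-1 -> is_derive t 1 W
  (A t * cos (w * t) - B t * sin (w * t) +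
   (A2 t * cos (w * t) - B2 t * sin (w * t)) / w ^+ 2).
Proof.
move=> ht.
have dc := is_der_cos w t; have ds := is_der_sin w t.
have hh := is_der_add
  (is_der_scale w^-1 (is_der_add (is_der_mul (hA ht) ds) (is_der_mul (hB ht) dc)))
  (is_der_scale (w ^+ 2)^-1 (is_der_sub (is_der_mul (hA1 ht) dc) (is_der_mul (hB1 ht) ds))).
rewrite [W](_ : _ = fun x => w^-1 * (A x * sin (w * x) + B x * cos (w * x)) +
  (w ^+ 2)^-1 * (A1 x * cos (w * x) - B1 x * sin (w * x))); last first.
  by apply/funext => x; rewrite /W mulrC [X in _ + X = _]mulrC.
by apply: (is_der_eq hh); field.
Qed.

Lemma high_frequency_piece i : `|(S (dy i.+1) - W (dy i.+1))
  - (S (dy i.+2) - W (dy i.+2))| <=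
  eps * dy i.+2 + 2 * incr i.+1 / (dy i.+2 * w ^+ 2).
Proof.
set c := 2 / (dy i.+2 * w ^+ 2).
have w2 : 0 < w ^+ 2 by rewrite exprn_even_gt0.
have c0 : 0 <= c by rewrite divr_ge0// mulr_ge0 ?ltW// dy_gt0.
rewrite [leRHS](_ : _ = (eps * dy i.+1 + c * E (dy i.+1))
  - (eps * dy i.+2 + c * E (dy i.+2))); last first.
  by rewrite opprD addrACA -!mulrBr dy_diff -/(incr _) /c [in RHS]mulrAC.
apply: (@mean_value_le _ (fun t => S t - W t) (fun t => S1 t -
   (A t * cos (w * t) - B t * sin (w * t) +
   (A2 t * cos (w * t) - B2 t * sin (w * t)) / w ^+ 2))
   (fun t => eps * t + c * E t)
   (fun t => eps + c * E1 t) _ _ (ltW (dy_lt _ _))).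
- by apply: is_der_within => t ht; apply: is_der_sub => //; apply: der_W; exact: inside' ht.
- move=> t; apply: cvgD; first exact: mul_id_within.
  by apply: cvgM; [exact: cvg_cst|exact: cE_dy].
- by move=> t ht; apply: is_der_sub => //; apply: der_W; apply: (@inside' i);
    have /andP[/ltW -> /ltW ->] := ht.
- by move=> t ht; apply: is_der_add => //; apply: is_der_scale; apply: hE; exact: inside ht.
move=> t ht; have ti := inside ht.
rewrite opprD addrA; apply: le_trans (ler_normB _ _) _; apply: lerD; first exact: S1_near.
rewrite normrM normfV (ger0_norm (ltW w2)) ler_pdivrMr//.
have t0 : 0 < t by case/andP: ti.
have E10 : 0 <= E1 t by exact: le_trans (bA1 ti).
have E2 : E1 t / t <= E1 t / dy i.+2.
  rewrite ler_wpM2l// lef_pV2 ?posrE ?dy_gt0//; by have /andP[/ltW] := ht.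
apply: le_trans (ler_normB _ _) _.
have -> : c * E1 t * w ^+ 2 = E1 t / dy i.+2 + E1 t / dy i.+2.
  by rewrite /c; field; rewrite w0 gt_eqF// dy_gt0.
have a2 := le_trans (bA2 ti) E2; have b2 := le_trans (bB2 ti) E2.
by apply: lerD; [exact: mul_cos_le|exact: mul_sin_le].
Qed.

Lemma high_frequency_le j : `|(S 2^-1 - W 2^-1) - (S (dy j.+1) - W (dy j.+1))| <=
  eps * (2^-1 - dy j.+1) + \sum_(0 <= i < j) 2 * incr i.+1 / (dy i.+2 * w ^+ 2).
Proof.
have d1 : 2^-1 = dy 1 by rewrite /dy expr1.
rewrite d1; elim: j => [|j IH]; first by rewrite !subrr normr0 mulr0 big_geq// addr0.
rewrite big_nat_recr//=.
have := high_frequency_piece j; have := dy_diff R j.+1 => hd h2.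
have := ler_normD (S (dy 1) - W (dy 1) - (S (dy j.+1) - W (dy j.+1)))
  (S (dy j.+1) - W (dy j.+1) - (S (dy j.+2) - W (dy j.+2))).
rewrite addrA subrK => h3; apply: (le_trans h3).
have -> : eps * (dy 1 - dy j.+2) = eps * (dy 1 - dy j.+1) + eps * dy j.+2.
  by rewrite -mulrDr; congr (_ * _); lra.
apply: (le_trans (lerD IH h2)); rewrite le_eqVlt; apply/orP; left; apply/eqP; ring.
Qed.

Lemma W_le j : dy j.+1 * `|w| >= 1 -> `|W (dy j.+1)| <= 14 * (incr j.+1 * dy j.+1).
Proof.
move=> dw; have d0 := dy_gt0 R j.+1.
have aw : 0 < `|w| by rewrite normr_gt0.
have iw : `|w|^-1 <= dy j.+1.
  by rewrite -[X in X <= _]mul1r ler_pdivrMr.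
have hj : dy j.+2 <= dy j.+1 <= dy j.+1 by rewrite lexx ltW// dy_lt.
have a3 := sup_fun hA bA bA1 hj; have b3 := sup_fun hB bB bB1 hj.
have a4 := sup_der hA1 bA1 bA2 hj; have b4 := sup_der hB1 bB1 bB2 hj.
have e0 := incr_ge0 j.
rewrite /W; apply: le_trans (ler_normD _ _) _.
rewrite [X in X + _]normrM [X in _ + X]normrM !normfV normrX.
have s1 : `|A (dy j.+1) * sin (w * dy j.+1) + B (dy j.+1) * cos (w * dy j.+1)| <=
  6 * incr j.+1.
  apply: le_trans (ler_normD _ _) _.
  by have := mul_sin_le (w * dy j.+1) a3; have := mul_cos_le (w * dy j.+1) b3; lra.
have s2 : `|A1 (dy j.+1) * cos (w * dy j.+1) - B1 (dy j.+1) * sin (w * dy j.+1)| <=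
  8 * incr j.+1 / dy j.+1.
  apply: le_trans (ler_normB _ _) _.
  have -> : 8 * incr j.+1 / dy j.+1 = 4 * incr j.+1 / dy j.+1 + 4 * incr j.+1 / dy j.+1
    by ring.
  by apply: lerD; [exact: mul_cos_le|exact: mul_sin_le].
have -> : 14 * (incr j.+1 * dy j.+1) =
  6 * incr j.+1 * dy j.+1 + 8 * incr j.+1 / dy j.+1 * dy j.+1 ^+ 2.
  by field; rewrite gt_eqF.
by rewrite lerD ?ler_pM ?invr_ge0 ?exprn_ge0// -exprVn lerXn2r ?nnegrE ?invr_ge0// ltW.
Qed.

(** At the end point 1/2, the boundary terms of order 1/w vanish because both the
    sine and B do; the remaining one is of order 1/w^2. *)
Lemma W_half_le : sin (w * 2^-1) = 0 -> `|W 2^-1| <= 8 * incr 1 / w ^+ 2.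
Proof.
move=> s0; rewrite /W s0 B_half mulr0 mul0r addr0 mul0r add0r mulr0 subr0.
have w2 : 0 < w ^+ 2 by rewrite exprn_even_gt0.
rewrite [leLHS]normrM normfV (ger0_norm (ltW w2)).
apply: ler_wpM2r; first by rewrite invr_ge0 ltW.
have d1 : 2^-1 = dy 1 by rewrite /dy expr1.
have h1 : dy 2 <= 2^-1 <= dy 1 by rewrite d1 lexx ltW// dy_lt.
have := sup_der hA1 bA1 bA2 h1; rewrite -d1 invrK => h.
apply: mul_cos_le; lra.
Qed.

(** The interval is cut at dy (j+1), comparable with the wave length 1/w: the
    trivial bound is used below, the primitive W above. *)
Lemma primitive_le j L : (j <= L)%N -> 1 <= dy j.+1 * `|w| -> sin (w * 2^-1) = 0 ->
  `|S 2^-1 - S 0| <= K * dy L.+1 + eps + 8 * incr 1 * dy j.+1 ^+ 2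
    + 14 * (incr j.+1 * dy j.+1)
    + \sum_(0 <= i < j) 2 * incr i.+1 / dy i.+2 * dy j.+1 ^+ 2
    + \sum_(j <= i < L) 6 * (incr i.+1 * dy i.+2).
Proof.
move=> jL dw s0.
have aw : 0 < `|w| by rewrite normr_gt0.
have w2 : (w ^+ 2)^-1 <= dy j.+1 ^+ 2.
  have -> : w ^+ 2 = `|w| ^+ 2 by rewrite real_normK ?num_real.
  rewrite -exprVn; apply: lerXn2r; rewrite ?nnegrE ?invr_ge0//.
    exact/ltW/dy_gt0.
  by rewrite -[X in X <= _]mul1r ler_pdivrMr.
have h1 := low_frequency_le jL; have h2 := high_frequency_le j.
have h3 := W_le dw; have h4 := W_half_le s0.
have h5 : 8 * incr 1 / w ^+ 2 <= 8 * incr 1 * dy j.+1 ^+ 2.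
  by rewrite ler_wpM2l// mulr_ge0// incr_ge0.
have h6 : \sum_(0 <= i < j) 2 * incr i.+1 / (dy i.+2 * w ^+ 2) <=
   \sum_(0 <= i < j) 2 * incr i.+1 / dy i.+2 * dy j.+1 ^+ 2.
  apply: ler_sum => i _; rewrite invfM mulrA ler_wpM2l//.
  by apply: divr_ge0; [rewrite mulr_ge0 ?incr_ge0|exact/ltW/dy_gt0].
have h7 : eps * (dy j.+1 - dy L.+1) + eps * (2^-1 - dy j.+1) <= eps.
  rewrite -mulrDr ler_piMr//; have := dy_gt0 R L.+1; lra.
have h8 : `|S 2^-1 - S 0| <= `|(S 2^-1 - W 2^-1) - (S (dy j.+1) - W (dy j.+1))| +
   `|W 2^-1| + `|W (dy j.+1)| + `|S (dy j.+1) - S 0|.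
  have -> : S 2^-1 - S 0 = ((S 2^-1 - W 2^-1) - (S (dy j.+1) - W (dy j.+1))) +
     W 2^-1 - W (dy j.+1) + (S (dy j.+1) - S 0) by ring.
  by apply: le_trans (ler_normD _ _) _; rewrite lerD2r; apply: le_trans (ler_normB _ _) _;
     rewrite lerD2r; exact: ler_normD.
lra.
Qed.

End Primitive.

Lemma sum_incr L : \sum_(0 <= i < L) incr i.+1 <= E 2^-1 - E 0.
Proof.
have e : \sum_(0 <= i < L) incr i.+1 = E (dy 1) - E (dy L.+1).
  elim: L => [|L IH]; first by rewrite big_geq// subrr.
  by rewrite big_nat_recr//= IH /incr addrA subrK.
have d1 : 2^-1 = dy 1 by rewrite /dy expr1.
rewrite e d1 lerD2l lerN2 -subr_ge0.
have := @mean_value_le R (fun=> 0) (fun=> 0) E E1 0 (dy L.+1) (ltW (dy_gt0 _ _)).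
rewrite subrr normr0; apply.
- by move=> z; exact: cvg_cst.
- apply: continuous_subspaceW cE; apply: subset_itvScc; rewrite bnd_simp//.
  exact: dy_half.
- move=> t /andP[t0 ht]; apply: hE; rewrite t0/=.
  exact: lt_le_trans ht (dy_half _ L).
- move=> t /andP[t0 ht]; apply: le_trans (bA1 _) => //.
  by rewrite t0/=; exact: lt_le_trans ht (dy_half _ L).
Qed.

(** The frequencies with 2^j <= |k| < 2^(j+1) share the cut point dy (j+1).  Adding
    [primitive_le] over the 2^(j+1) frequencies of each block gives double sums
    over blocks and dyadic intervals, in which the weights decay geometrically
    away from the diagonal: they are bounded by the sum of the increments. *)
Lemma fourier_sum_le (eps K : R) (q : int -> R) (S S1 : int -> R -> R) (J : nat) :
  0 <= eps -> 0 <= K ->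
  (forall k (t : R), is_derive t 1 (S k) (S1 k t)) ->
  (forall k (t : R), 0 < t < 2^-1 -> `|S1 k t -
     (A t * cos (2 * pi * k%:~R * t) - B t * sin (2 * pi * k%:~R * t))| <= eps) ->
  (forall k (t : R), `|S1 k t| <= K) ->
  (forall k, S k 2^-1 - S k 0 = q k / 2) ->
  psumZ (fun k => `|q k|) (2 ^ J).-1 <= (4 * 2 ^+ J + 2) * eps + 67 * (E 2^-1 - E 0).
Proof.
move=> eps0 K0 hS S1n S1K Sq.
have dcvg : K * dy L.+1 @[L --> \oo] --> (0 : R).
  rewrite -[0](mulr0 K); apply: cvgM; first exact: cvg_cst.
  rewrite (_ : (fun L => dy L.+1) = geometric 2^-1 2^-1); last first.
    by apply/funext => L; rewrite /dy exprS.
  apply: cvg_geometric.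
  by rewrite ger0_norm ?invr_ge0// invf_lt1// ltr1n.
suff H L : (J <= L)%N -> psumZ (fun k => `|q k|) (2 ^ J).-1 <=
    (4 * 2 ^+ J + 2) * eps + 67 * (E 2^-1 - E 0) + (4 * 2 ^+ J + 2) * (K * dy L.+1).
  apply: (@le_of_le_add_cvg0 _ _ _ (fun L => (4 * 2 ^+ J + 2) * (K * dy L.+1))).
    by rewrite -[0](mulr0 (4 * 2 ^+ J + 2)); apply: cvgM => //; exact: cvg_cst.
  by exists J.
move=> JL; set De := E 2^-1 - E 0.
set kap := K * dy L.+1 + eps.
pose b j := kap + 8 * incr 1 * dy j.+1 ^+ 2 + 14 * (incr j.+1 * dy j.+1)
    + \sum_(0 <= i < j) 2 * incr i.+1 / dy i.+2 * dy j.+1 ^+ 2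
    + \sum_(j <= i < L) 6 * (incr i.+1 * dy i.+2).
have qk (k : int) j : (j <= L)%N -> (2 ^ j <= `|k|)%N -> `|q k| <= 2 * b j.
  move=> jL kj; have k0 : k != 0 by apply: contraTneq kj => ->; rewrite -ltnNge expn_gt0.
  have wE : `|2 * pi * k%:~R| = 2 * pi * `|k|%N%:R :> R.
    by rewrite !normrM (ger0_norm (pi_ge0 R)) ger0_norm// -intr_norm.
  have w0 : 2 * pi * k%:~R != 0 :> R.
    by rewrite !mulf_neq0 ?intr_eq0//; exact: lt0r_neq0 (pi_gt0 R).
  (* As pi >= 2, the frequency 2 pi k exceeds 2^(j+1). *)
  have dw : 1 <= dy j.+1 * `|2 * pi * k%:~R|.
    rewrite wE dyS.
    have -> : dy j / 2 * (2 * pi * `|k|%N%:R) = pi * (dy j * `|k|%N%:R) by field.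
    rewrite -[X in X <= _]mul1r ler_pM//.
      by apply: le_trans (pi_ge2 R); rewrite ler1n.
    rewrite /dy exprVn mulrC ler_pdivlMr ?exprn_gt0// mul1r -natrX ler_nat//.
  have s0 : sin (2 * pi * k%:~R * 2^-1) = 0 :> R.
    by rewrite (_ : _ * 2^-1 = pi * k%:~R) ?sin_pi_int//; field.
  have := primitive_le eps0 (hS k) (S1n k) (S1K k) w0 jL dw s0.
  by rewrite Sq normrM normfV normr_nat ler_pdivrMr// mulrC.
have e0 i : 0 <= incr i.+1 by exact: incr_ge0.
have kap0 : 0 <= kap by rewrite addr_ge0// mulr_ge0// ltW// dy_gt0.
have twoE j : 2 ^+ j = (dy j)^-1 by rewrite /dy exprVn invrK.
(* The coefficients of the increments are 4, 7, 2 and 3: the end point 1/2, the cut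
   point, the high and the low frequency part. *)
have b_sum : \sum_(0 <= j < J) 2 ^+ j * b j <= 2 ^+ J * kap + 16 * De.
  have bE j : 2 ^+ j * b j = 2 ^+ j * kap + 2 * incr 1 * dy j + 7 * incr j.+1
      + 2 * (dy j * \sum_(0 <= i < j) incr i.+1 / dy i)
      + 3 / 2 * ((dy j)^-1 * \sum_(j <= i < L) incr i.+1 * dy i).
    have d0 := lt0r_neq0 (dy_gt0 R j); rewrite /b 4![2 ^+ j * (_ + _)]mulrDr;
      congr (_ + _ + _ + _ + _).
    - by rewrite twoE [dy j.+1]dyS; field.
    - by rewrite twoE [dy j.+1]dyS; field.
    - rewrite !mulr_sumr; apply: eq_bigr => i _; have di := lt0r_neq0 (dy_gt0 R i).
      by rewrite twoE [dy i.+2]dyS [dy i.+1]dyS [dy j.+1]dyS; field; rewrite di d0.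
    - rewrite !mulr_sumr; apply: eq_bigr => i _.
      by rewrite twoE [dy i.+2]dyS [dy i.+1]dyS; field.
  under eq_bigr do rewrite bE.
  rewrite !big_split/= -!mulr_sumr -mulr_suml.
  have s1 : \sum_(0 <= j < J) 2 ^+ j = 2 ^+ J - 1 :> R.
    elim: (J) => [|j IH]; first by rewrite big_geq// subrr.
    by rewrite big_nat_recr//= IH exprS; ring.
  have s2 : \sum_(0 <= j < J) dy j = 2 - 2 * dy J.
    elim: (J) => [|j IH]; first by rewrite big_geq// /dy expr0 mulr1 subrr.
    by rewrite big_nat_recr//= IH dyS; field.
  have s3 := dyadic_sum_below e0 J; have s4 := dyadic_sum_above e0 JL.
  have s5 := sum_incr J; have s6 := sum_incr L; have s7 := sum_incr 1.
  rewrite big_nat1 -/De in s7; rewrite -/De in s5; rewrite -/De in s6.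
  rewrite s1 s2.
  have t1 : (2 ^+ J - 1) * kap <= 2 ^+ J * kap by rewrite ler_wpM2r// lerBlDr lerDl.
  have t2 : 2 * incr 1 * (2 - 2 * dy J) <= 4 * incr 1.
    have := mulr_ge0 (e0 0%N) (ltW (dy_gt0 R J)); lra.
  lra.
have blocks : \sum_(1 <= m < 2 ^ J) (`|q m%:Z| + `|q (- m%:Z)|) <=
  \sum_(0 <= j < J) 2 ^+ j * (4 * b j).
  elim: (J) JL => [_|j IH jL]; first by rewrite expn0 !big_geq.
  rewrite (big_cat_nat (n := 2 ^ j)) ?expn_gt0//=; last by rewrite leq_exp2l.
  rewrite big_nat_recr//=; apply: lerD; first exact: IH (ltnW jL).
  apply: (@le_trans _ _ (\sum_(2 ^ j <= m < 2 ^ j.+1) 4 * b j)).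
    rewrite big_nat_cond [leRHS]big_nat_cond; apply: ler_sum => m /andP[/andP[jm _] _].
    have -> : 4 * b j = 2 * b j + 2 * b j by ring.
    by apply: lerD; apply: (qk _ _ (ltnW jL)); rewrite ?abszN.
  by rewrite sumr_const_nat expnS mul2n -addnn addnK -[leLHS]mulr_natl natrX.
have q0 : `|q 0| <= 2 * (kap + 3 / 2 * De).
  have := low_frequency_le (hS 0) (S1n 0) (S1K 0) (leq0n L).
  have d1 : 2^-1 = dy 1 by rewrite /dy expr1.
  rewrite -d1 Sq normrM normfV normr_nat ler_pdivrMr// [_ * 2]mulrC => h.
  apply: (le_trans h); rewrite ler_pM2l// /kap; apply: lerD.
    rewrite lerD2l ler_piMr//; have := dy_gt0 R L.+1; lra.
  apply: (@le_trans _ _ (3 / 2 * \sum_(0 <= i < L) incr i.+1)); last first.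
    by rewrite ler_pM2l ?sum_incr// divr_gt0.
  rewrite mulr_sumr; apply: ler_sum => i _.
  rewrite dyS; have := dy_half R i; have := e0 i => h1 h2.
  have := ler_wpM2l h1 h2; lra.
have N1 : (0 < 2 ^ J)%N by rewrite expn_gt0.
rewrite psumZE prednK//; apply: le_trans (lerD q0 blocks) _.
have -> : \sum_(0 <= j < J) 2 ^+ j * (4 * b j) = 4 * \sum_(0 <= j < J) 2 ^+ j * b j.
  by rewrite mulr_sumr; apply: eq_bigr => j _; rewrite mulrCA.
(* The frequency 0 and the blocks contribute 3 De and 64 De. *)
apply: (@le_trans _ _ (2 * (kap + 3 / 2 * De) + 4 * (2 ^+ J * kap + 16 * De))).
  by rewrite lerD2l ler_pM2l.
by rewrite /kap le_eqVlt; apply/orP; left; apply/eqP; field.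
Qed.

End Dyadic.

(** * Trigonometric polynomials *)

Section ComplexModulus.
Context (R : realType).
Local Notation normc := (@Normc.normc R).
Implicit Types x y z : R[i].

Lemma normc_norm z : (`|z| : R[i]) = (normc z)%:C%C.
Proof. by case: z => a b; rewrite normc_def. Qed.

Lemma normc_ge0 z : 0 <= normc z.
Proof. by case: z => a b; exact: sqrtr_ge0. Qed.

Lemma normcD_le x y : normc (x + y) <= normc x + normc y.
Proof.
have := ler_normD x y; rewrite !normc_norm.
by rewrite -[(_%:C + _)%C](rmorphD (real_complex R)) lecR.
Qed.

Lemma normcN_eq z : normc (- z) = normc z.
Proof. by case: z => a b /=; rewrite !sqrrN. Qed.

Lemma normcB_le x y : normc (x - y) <= normc x + normc y.
Proof. by rewrite -[X in _ <= _ + X]normcN_eq; exact: normcD_le. Qed.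

Lemma normcX x n : normc (x ^+ n) = normc x ^+ n.
Proof.
elim: n => [|n IH]; first by rewrite !expr0 Normc.normc1.
by rewrite !exprS Normc.normcM IH.
Qed.

Lemma normc_real (a : R) : normc (a%:C)%C = `|a|.
Proof. by rewrite /= expr0n/= addr0 sqrtr_sqr. Qed.

Lemma normc_nat (k : nat) : normc k%:R = k%:R.
Proof.
rewrite (_ : k%:R = (k%:R : R)%:C%C); last by rewrite rmorph_nat.
by rewrite normc_real normr_nat.
Qed.

Lemma Re_le_normc z : `|complex.Re z| <= normc z.
Proof.
case: z => a b /=; rewrite -sqrtr_sqr ler_wsqrtr// lerDl sqr_ge0 //.
Qed.

Lemma Im_le_normc z : `|complex.Im z| <= normc z.
Proof.
case: z => a b /=; rewrite -sqrtr_sqr ler_wsqrtr// lerDr sqr_ge0 //.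
Qed.

Lemma normc_le_parts z : normc z <= `|complex.Re z| + `|complex.Im z|.
Proof.
case: z => a b /=; rewrite -[leRHS]ger0_norm ?addr_ge0// -sqrtr_sqr ler_wsqrtr//.
rewrite sqrrD !real_normK ?num_real// lerD2r lerDl.
by rewrite mulrn_wge0// mulr_ge0.
Qed.

Lemma normc_subX (x y : R[i]) n : normc x <= 1 -> normc y <= 1 ->
  normc (x ^+ n - y ^+ n) <= n%:R * normc (x - y).
Proof.
move=> x1 y1; elim: n => [|n IH].
  by rewrite !expr0 subrr Normc.normc0 mul0r.
have -> : x ^+ n.+1 - y ^+ n.+1 = x * (x ^+ n - y ^+ n) + (x - y) * y ^+ n.
  by rewrite !exprS; ring.
apply: le_trans (normcD_le _ _) _; rewrite !Normc.normcM -natr1 mulrDl mul1r.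
apply: lerD.
  by apply: le_trans IH; rewrite ler_piMl ?normc_ge0.
by rewrite ler_piMr ?normc_ge0// normcX exprn_ile1 ?normc_ge0.
Qed.

Lemma cReD x y : complex.Re (x + y) = complex.Re x + complex.Re y.
Proof. by case: x; case: y. Qed.

Lemma cImD x y : complex.Im (x + y) = complex.Im x + complex.Im y.
Proof. by case: x; case: y. Qed.

Lemma cReB x y : complex.Re (x - y) = complex.Re x - complex.Re y.
Proof. by case: x; case: y. Qed.

Lemma cImB x y : complex.Im (x - y) = complex.Im x - complex.Im y.
Proof. by case: x; case: y. Qed.

Lemma cReM x y : complex.Re (x * y) =
  complex.Re x * complex.Re y - complex.Im x * complex.Im y.
Proof. by case: x; case: y. Qed.

Lemma cImM x y : complex.Im (x * y) =
  complex.Re x * complex.Im y + complex.Im x * complex.Re y.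
Proof. by case: x; case: y. Qed.

Lemma cRe_sum (I : Type) (s : seq I) (F : I -> R[i]) :
  complex.Re (\sum_(i <- s) F i) = \sum_(i <- s) complex.Re (F i).
Proof. by elim: s => [|i s IH]; rewrite ?big_nil// !big_cons cReD IH. Qed.

Lemma cIm_sum (I : Type) (s : seq I) (F : I -> R[i]) :
  complex.Im (\sum_(i <- s) F i) = \sum_(i <- s) complex.Im (F i).
Proof. by elim: s => [|i s IH]; rewrite ?big_nil// !big_cons cImD IH. Qed.

End ComplexModulus.

Section LaurentMorphism.
Context (R : realType) (phi : int -> R[i]).
Hypothesis phiD : forall k l, phi (k + l) = phi k * phi l.
Let phi' : int -> Rcomplex R := phi.

Lemma laurent_morph D1 D2 (q1 q2 : {poly R}) :
  (laurent (D1 + D2) (q1 * q2)%R phi' : R[i]) =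
  (laurent D1 q1 phi' : R[i]) * (laurent D2 q2 phi' : R[i]).
Proof.
rewrite laurent_mul.
rewrite -[RHS]/((laurent D1 q1 phi' : Rcomplex R) * (laurent D2 q2 phi' : Rcomplex R)).
rewrite /laurent mulr_suml; apply: eq_bigr => i _.
rewrite -scalerAl; apply: (congr1 (fun z : Rcomplex R => q1`_i *: z)).
rewrite mulr_sumr; apply: eq_bigr => j _.
rewrite [RHS]mulrC -[RHS]scalerAl; apply: (congr1 (fun z : Rcomplex R => q2`_j *: z)).
by rewrite mulrC; exact: phiD.
Qed.

End LaurentMorphism.

Section FourierTransform.
Context (R : realType) (mu : int -> R).
Hypothesis mu_prob : is_probability mu.
Local Notation normc := (@Normc.normc R).

Let mu0 k : 0 <= mu k. Proof. exact: mu_prob.1. Qed.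

Definition wave (t : R) (k : int) : R[i] :=
  (cos (2 * pi * k%:~R * t) -i* sin (2 * pi * k%:~R * t))%C.

Lemma waveD t k l : wave t (k + l) = wave t k * wave t l.
Proof.
rewrite /wave intrD mulrDr mulrDl cosD sinD.
apply/eqP; rewrite eq_complex /=; apply/andP; split; apply/eqP; ring.
Qed.

Lemma normc_wave t k : normc (wave t k) = 1.
Proof. by rewrite /= sqrrN cos2Dsin2 sqrtr1. Qed.

Definition mass_poly (N : nat) : {poly R} := \poly_(i < N.*2.+1) mu (i%:Z - N%:Z).

Lemma laurent_mass_poly (W : lmodType R) (N : nat) (phi : int -> W) :
  laurent N%:Z (mass_poly N) phi = psumZ (fun k => mu k *: phi k) N.
Proof.
rewrite (laurent_wide _ _ (size_poly _ _)); apply: eq_bigr => i _.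
by rewrite coef_poly ltn_ord.
Qed.

Lemma norm1_mass_poly_le1 N : norm1 (mass_poly N) <= 1.
Proof.
rewrite (norm1_wide (size_poly _ _)); apply: le_trans (psumZ_le1 mu_prob N).
by apply: ler_sum => i _; rewrite coef_poly ltn_ord ger0_norm.
Qed.

Definition trig_poly (N : nat) (t : R) : R[i] :=
  laurent N%:Z (mass_poly N) (wave t : int -> Rcomplex R).

Lemma Re_trig_poly N t : complex.Re (trig_poly N t) =
  psumZ (fun k => mu k * cos (2 * pi * k%:~R * t)) N.
Proof. by rewrite /trig_poly laurent_mass_poly /psumZ cRe_sum. Qed.

Lemma Im_trig_poly N t : complex.Im (trig_poly N t) =
  - psumZ (fun k => mu k * sin (2 * pi * k%:~R * t)) N.
Proof.
rewrite /trig_poly laurent_mass_poly /psumZ cIm_sum -sumrN.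
by apply: eq_bigr => i _ /=; rewrite mulrN.
Qed.

Lemma normc_trig_poly N t : normc (trig_poly N t) <= 1.
Proof.
rewrite /trig_poly laurent_mass_poly; apply: le_trans (psumZ_le1 mu_prob N).
rewrite /psumZ; elim/big_rec2: _ => [|i x z _ IH]; first by rewrite Normc.normc0.
apply: le_trans (normcD_le _ _) _; apply: lerD => //.
set k := i%:Z - N%:Z.
have -> : mu k *: (wave t k : Rcomplex R) = ((mu k)%:C%C * wave t k : R[i]).
  by apply/eqP; rewrite eq_complex /= !mul0r subr0 addr0 !eqxx.
by rewrite Normc.normcM normc_wave mulr1 normc_real ger0_norm.
Qed.

Lemma fourier_dist N t : normc (fourier mu t - trig_poly N t) <= 2 * mass_tail mu N.
Proof.
apply: le_trans (normc_le_parts _) _; rewrite cReB cImB Re_trig_poly Im_trig_poly /=.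
have h1 : `|sumZ (fun k => mu k * cos (2 * pi * k%:~R * t)) -
    psumZ (fun k => mu k * cos (2 * pi * k%:~R * t)) N| <= mass_tail mu N.
  by apply: sumZ_dist => // k; apply: mul_cos_le; rewrite ger0_norm.
have h2 : `|sumZ (fun k => mu k * sin (2 * pi * k%:~R * t)) -
    psumZ (fun k => mu k * sin (2 * pi * k%:~R * t)) N| <= mass_tail mu N.
  by apply: sumZ_dist => // k; apply: mul_sin_le; rewrite ger0_norm.
by rewrite -opprD normrN; have := lerD h1 h2; lra.
Qed.

Lemma fourier_le1 t : normc (fourier mu t) <= 1.
Proof.
apply: (@le_of_le_add_cvg0 _ _ _ (fun N => 2 * mass_tail mu N)).
  rewrite -[0](mulr0 2); apply: cvgM; first exact: cvg_cst.
  exact: mass_tail_cvg0.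
near=> N; have -> : fourier mu t = trig_poly N t + (fourier mu t - trig_poly N t).
  by rewrite addrC subrK.
by apply: le_trans (normcD_le _ _) _; rewrite lerD ?fourier_dist ?normc_trig_poly.
Unshelve. all: by end_near. Qed.

Section Difference.
Context (n : nat).

(** With Q the polynomial [mass_poly N], the Laurent polynomial X^(-(n+1)N) times
    [diff_poly N] is (X^(-N) Q)^n - (X^(-N) Q)^(n+1).  Its coefficients are those
    of mu^n - mu^(n+1), for mu truncated to [-N, N]. *)
Definition diff_poly (N : nat) : {poly R} :=
  'X^N * mass_poly N ^+ n - mass_poly N ^+ n.+1.

Let shift (N : nat) : nat := (n.+1 * N)%N.

Lemma laurent_diff_poly N t :
  (laurent (shift N)%:Z (diff_poly N) (wave t : int -> Rcomplex R) : R[i]) =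
  trig_poly N t ^+ n - trig_poly N t ^+ n.+1.
Proof.
have powE j : (laurent (j * N)%:Z (mass_poly N ^+ j)%R (wave t : int -> Rcomplex R) : R[i])
    = trig_poly N t ^+ j.
  elim: j => [|j IH].
    rewrite !expr0 mul0n /laurent size_poly1 big_ord1 coefC eqxx scale1r /wave subr0.
    by rewrite mulr0 mul0r cos0 sin0 oppr0.
  rewrite !exprS mulSn PoszD; have -> := laurent_morph (waveD t) N%:Z (j * N)%:Z.
  by rewrite IH.
have -> : laurent (shift N)%:Z (diff_poly N) (wave t : int -> Rcomplex R) =
  laurent (n * N)%:Z (mass_poly N ^+ n)%R (wave t : int -> Rcomplex R) -
  laurent (n.+1 * N)%:Z (mass_poly N ^+ n.+1)%R (wave t : int -> Rcomplex R).
  rewrite /diff_poly laurentB laurent_mulXn; congr (_ - _).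
  by apply: eq_bigr => i _; congr (_ *: (wave t _ : Rcomplex R));
    rewrite /shift mulSn PoszD; ring.
by rewrite -!powE.
Qed.

Definition diff_coef (N : nat) (k : int) : R :=
  \sum_(i < size (diff_poly N)) (diff_poly N)`_i * ((i%:Z - (shift N)%:Z) == k)%:R.

Definition sin_prim (m : int) (t : R) : R :=
  if m == 0 then t else sin (2 * pi * m%:~R * t) / (2 * pi * m%:~R).

Lemma der_sin_prim m (t : R) : is_derive t 1 (sin_prim m) (cos (2 * pi * m%:~R * t)).
Proof.
rewrite /sin_prim; have [->|m0] := eqVneq m 0.
  by rewrite mulr0 mul0r cos0; exact: is_derive_id.
have w0 : 2 * pi * m%:~R != 0 :> R.
  by rewrite !mulf_neq0 ?intr_eq0//; exact: lt0r_neq0 (pi_gt0 R).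
set w := 2 * pi * m%:~R in w0 *.
have h := is_der_scale w^-1 (is_der_sin w t).
rewrite (_ : (fun u : R => sin (w * u) / w) = (fun u => w^-1 * sin (w * u))); last first.
  by apply/funext => u; rewrite mulrC.
by apply: (is_der_eq h); rewrite mulrA mulVf// mul1r.
Qed.

(** Only the frequency 0 contributes to the increment over half a period: this is
    how Fourier inversion enters. *)
Lemma sin_prim_half m : sin_prim m 2^-1 - sin_prim m 0 = (m == 0)%:R / 2.
Proof.
rewrite /sin_prim; have [_|m0] := eqVneq m 0; first by rewrite subr0 mul1r.
rewrite mulr0 sin0 mul0r subr0 mul0r.
by rewrite (_ : 2 * pi * m%:~R * 2^-1 = pi * m%:~R) ?sin_pi_int ?mul0r//; field.
Qed.

Definition primitive (N : nat) (k : int) (t : R) : R :=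
  \sum_(i < size (diff_poly N)) (diff_poly N)`_i * sin_prim (i%:Z - (shift N)%:Z - k) t.

Definition primitive' (N : nat) (k : int) (t : R) : R :=
  \sum_(i < size (diff_poly N)) (diff_poly N)`_i *
    cos (2 * pi * (i%:Z - (shift N)%:Z - k)%:~R * t).

Lemma der_primitive N k (t : R) : is_derive t 1 (primitive N k) (primitive' N k t).
Proof.
rewrite /primitive /primitive'.
elim: (index_enum _) => [|i s IH].
  rewrite big_nil (_ : (fun u => _) = (fun=> 0)); first exact: is_der_cst.
  by apply/funext => u; rewrite big_nil.
rewrite big_cons (_ : (fun u => _) = (fun u => (diff_poly N)`_i *
    sin_prim (i%:Z - (shift N)%:Z - k) u +
  \sum_(i <- s) (diff_poly N)`_i * sin_prim (i%:Z - (shift N)%:Z - k) u)); last first.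
  by apply/funext => u; rewrite big_cons.
exact: (is_der_add (is_der_scale _ (der_sin_prim _ t)) IH).
Qed.

Lemma primitive_half N k :
  primitive N k 2^-1 - primitive N k 0 = diff_coef N k / 2.
Proof.
rewrite /primitive /diff_coef -sumrB mulr_suml; apply: eq_bigr => i _.
by rewrite -mulrBr sin_prim_half mulrA subr_eq0.
Qed.

Lemma primitive'_le N k t : `|primitive' N k t| <= norm1 (diff_poly N).
Proof.
apply: le_trans (ler_norm_sum _ _ _) _; apply: ler_sum => i _.
by apply: mul_cos_le.
Qed.

Lemma primitive'E N k t (G := trig_poly N t ^+ n - trig_poly N t ^+ n.+1) :
  primitive' N k t = complex.Re G * cos (2 * pi * k%:~R * t) -
     complex.Im G * sin (2 * pi * k%:~R * t).
Proof.
rewrite /G -laurent_diff_poly /laurent cRe_sum cIm_sum !mulr_suml -sumrB.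
apply: eq_bigr => i _ /=; rewrite [(_ - k)%:~R]intrB mulrBr mulrBl cosB.
ring.
Qed.

Let Gt (t : R) : R[i] := fourier mu t ^+ n - fourier mu t ^+ n.+1.

Lemma primitive'_near N k t : `|primitive' N k t -
   (complex.Re (Gt t) * cos (2 * pi * k%:~R * t) -
    complex.Im (Gt t) * sin (2 * pi * k%:~R * t))| <= 8 * n.+1%:R * mass_tail mu N.
Proof.
rewrite primitive'E; set G := trig_poly N t ^+ n - trig_poly N t ^+ n.+1.
set c := cos (2 * pi * k%:~R * t); set s := sin (2 * pi * k%:~R * t).
have -> : complex.Re G * c - complex.Im G * s
  - (complex.Re (Gt t) * c - complex.Im (Gt t) * s)
  = complex.Re (G - Gt t) * c - complex.Im (G - Gt t) * s.
  by rewrite (cReB G) (cImB G); ring.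
have Gd : normc (G - Gt t) <= 4 * n.+1%:R * mass_tail mu N.
  rewrite /G /Gt; set x := trig_poly N t; set y := fourier mu t.
  have -> : x ^+ n - x ^+ n.+1 - (y ^+ n - y ^+ n.+1) =
     (x ^+ n - y ^+ n) - (x ^+ n.+1 - y ^+ n.+1) by ring.
  have x1 : normc x <= 1 by exact: normc_trig_poly.
  have y1 : normc y <= 1 by exact: fourier_le1.
  have xy : normc (x - y) <= 2 * mass_tail mu N by rewrite -normcN_eq opprB fourier_dist.
  apply: le_trans (normcB_le _ _) _.
  have h1 := normc_subX n x1 y1; have h2 := normc_subX n.+1 x1 y1.
  have h3 : n%:R * normc (x - y) <= n.+1%:R * (2 * mass_tail mu N).
    by apply: ler_pM => //; [exact: normc_ge0|rewrite ler_nat].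
  have h4 : n.+1%:R * normc (x - y) <= n.+1%:R * (2 * mass_tail mu N) by rewrite ler_pM2l.
  by lra.
apply: le_trans (ler_normB _ _) _.
have := mul_cos_le (2 * pi * k%:~R * t) (le_trans (Re_le_normc _) Gd).
have := mul_sin_le (2 * pi * k%:~R * t) (le_trans (Im_le_normc _) Gd).
by rewrite -/c -/s; lra.
Qed.

Lemma size_diff_poly N : (size (diff_poly N) <= (shift N).*2.+1)%N.
Proof.
have sp : (size (mass_poly N) <= N.*2.+1)%N by exact: size_poly.
have spX j : (size (mass_poly N ^+ j)%R <= (j * N).*2.+1)%N.
  apply: leq_trans (size_poly_exp_leq _ _) _.
  rewrite ltnS (@leq_trans (N.*2 * j))//; last by rewrite -!muln2; nia.
  by rewrite leq_mul2r; apply/orP; right; case: (size _) sp.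
apply: leq_trans (size_polyD _ _) _; rewrite size_polyN geq_max spX andbT.
apply: leq_trans (size_polyMleq _ _) _; rewrite size_polyXn addSn /=.
apply: leq_trans (leq_add (leqnn _) (spX n)) _; rewrite /shift mulSn -!addnn; lia.
Qed.

Lemma diff_coefE N (i : nat) : diff_coef N (i%:Z - (shift N)%:Z) = (diff_poly N)`_i.
Proof.
rewrite /diff_coef; have [isz|isz] := ltnP i (size (diff_poly N)).
  rewrite (bigD1 (Ordinal isz))//= eqxx mulr1 big1 ?addr0// => j ji.
  case: eqP => [e|_]; last by rewrite mulr0.
  by case/eqP: ji; apply/val_inj => /=; lia.
rewrite nth_default// big1// => j _; case: eqP => [e|_]; last by rewrite mulr0.
by have := ltn_ord j; lia.
Qed.

Lemma norm1_diff_poly_window N :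
  norm1 (diff_poly N) = psumZ (fun k => `|diff_coef N k|) (shift N).
Proof.
rewrite (norm1_wide (size_diff_poly N)); apply: eq_bigr => i _.
by rewrite diff_coefE.
Qed.

Lemma norm1_mass_polyE N : norm1 (mass_poly N) = psumZ mu N.
Proof.
rewrite (norm1_wide (size_poly _ _)); apply: eq_bigr => i _.
by rewrite coef_poly ltn_ord ger0_norm.
Qed.

Lemma norm1_mass_poly_dist N0 N : (N0 <= N)%N ->
  norm1 ('X^(N - N0) * mass_poly N0 - mass_poly N) <= mass_tail mu N0.
Proof.
move=> NN; set r := 'X^_ * _.
have sr : (size r <= N.*2.+1)%N.
  apply: leq_trans (size_polyMleq _ _) _; rewrite size_polyXn addSn /=.
  by apply: leq_trans (leq_add (leqnn _) (size_poly _ _)) _; rewrite -!addnn; lia.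
have sd : (size (r - mass_poly N)%R <= N.*2.+1)%N.
  by apply: leq_trans (size_polyD _ _) _; rewrite size_polyN geq_max sr size_poly.
have -> : norm1 (r - mass_poly N) = norm1 (mass_poly N) - norm1 r.
  rewrite (norm1_wide sd) (norm1_wide sr) (norm1_wide (size_poly N.*2.+1 _)) -sumrB.
  apply: eq_bigr => i _; rewrite coefB /r coefXnM coef_poly ltn_ord [`|mu _|]ger0_norm//.
  case: ltnP => [_|h]; first by rewrite sub0r normrN normr0 subr0 ger0_norm.
  rewrite coef_poly; case: ltnP => [_|_];
    last by rewrite sub0r normrN normr0 subr0 ger0_norm.
  rewrite (_ : (i - (N - N0))%:Z - N0%:Z = i%:Z - N%:Z); last by lia.
  by rewrite subrr normr0 ger0_norm// subrr.
rewrite /r norm1_mulXn !norm1_mass_polyE /mass_tail lerD2r.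
exact: psumZ_le1.
Qed.

Lemma norm1_diff_poly_dist N0 N : (N0 <= N)%N ->
  norm1 ('X^(n.+1 * (N - N0)) * diff_poly N0 - diff_poly N) <=
  (n + n.+1)%:R * mass_tail mu N0.
Proof.
move=> NN; set p := 'X^(N - N0) * mass_poly N0; set q := mass_poly N.
have -> : 'X^(n.+1 * (N - N0)) * diff_poly N0 - diff_poly N =
   'X^N * (p ^+ n - q ^+ n) - (p ^+ n.+1 - q ^+ n.+1).
  have -> : 'X^(n.+1 * (N - N0)) * diff_poly N0 = 'X^N * p ^+ n - p ^+ n.+1.
    rewrite /diff_poly /p mulrBr !exprMn -!exprM !mulrA -!exprD.
    by congr ('X^_ * _ - 'X^_ * _); nia.
  by rewrite /diff_poly -/q; ring.
have p1 : norm1 p <= 1 by rewrite /p norm1_mulXn norm1_mass_poly_le1.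
have q1 : norm1 q <= 1 by exact: norm1_mass_poly_le1.
apply: le_trans (norm1B _ _) _; rewrite norm1_mulXn natrD mulrDl.
have h := norm1_mass_poly_dist NN.
by apply: lerD; apply: le_trans (norm1_subX _ p1 q1) _; rewrite ler_wpM2l.
Qed.

Lemma coef_mulXn_shift (d i : nat) (p : {poly R}) : ('X^d * p)`_(d + i)%N = p`_i.
Proof. by rewrite coefXnM ltnNge leq_addr addKn. Qed.

Lemma window_le_norm1 (m d : nat) (p : {poly R}) :
  \sum_(i < m) `|p`_(d + i)| <= norm1 p.
Proof.
rewrite (@norm1_wide _ (d + m + size p)) ?leq_addl//.
rewrite 2!big_split_ord/= -addrA [leRHS]addrCA lerDl addr_ge0 ?sumr_ge0//.
Qed.

(** The assumption on [De] is the conclusion of [fourier_sum_le].  Its error term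
    grows with the number of frequencies, and the degree of [diff_poly N]
    grows with N; so it cannot be applied to all the coefficients of
    [diff_poly N] with a small eps.  As the polynomials [diff_poly N] form a Cauchy
    sequence in l^1, it is enough to sum over the fixed window of the frequencies
    of [diff_poly N0], in which N tends to infinity. *)
Lemma norm1_diff_poly_le (De : R) :
  (forall (eps K : R) (q : int -> R) (S S1 : int -> R -> R) (J : nat),
    0 <= eps -> 0 <= K ->
    (forall k (t : R), is_derive t 1 (S k) (S1 k t)) ->
    (forall k (t : R), 0 < t < 2^-1 -> `|S1 k t -
       (complex.Re (Gt t) * cos (2 * pi * k%:~R * t)
        - complex.Im (Gt t) * sin (2 * pi * k%:~R * t))| <= eps) ->
    (forall k (t : R), `|S1 k t| <= K) ->
    (forall k, S k 2^-1 - S k 0 = q k / 2) ->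
    psumZ (fun k => `|q k|) (2 ^ J).-1 <= (4 * 2 ^+ J + 2) * eps + De) ->
  forall N0, norm1 (diff_poly N0) <= De + (n + n.+1)%:R * mass_tail mu N0.
Proof.
move=> H N0.
set D0 := shift N0; pose c : R := (4 * 2 ^+ D0 + 2) * (8 * n.+1%:R).
apply: (@le_of_le_add_cvg0 _ _ _ (fun N => c * mass_tail mu N)).
  by rewrite -[0](mulr0 c); apply: cvgM; [exact: cvg_cst|exact: mass_tail_cvg0].
exists N0 => // N /= NN.
have win : psumZ (fun k => `|diff_coef N k|) D0 <= c * mass_tail mu N + De.
  apply: le_trans (_ : psumZ (fun k => `|diff_coef N k|) (2 ^ D0).-1 <= _).
    apply: psumZ_nondecreasing => //; by rewrite -ltnS prednK ?expn_gt0// ltn_expl.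
  rewrite /c -mulrA; apply: (H _ (norm1 (diff_poly N)) _ (primitive N) (primitive' N)).
  - by rewrite !mulr_ge0// mass_tail_ge0.
  - exact: norm1_ge0.
  - by move=> k t; exact: der_primitive.
  - by move=> k t _; exact: primitive'_near.
  - by move=> k t; exact: primitive'_le.
  - by move=> k; exact: primitive_half.
rewrite norm1_diff_poly_window -/D0.
have comp : psumZ (fun k => `|diff_coef N0 k - diff_coef N k|) D0 <=
  (n + n.+1)%:R * mass_tail mu N0.
  apply: le_trans (norm1_diff_poly_dist NN);
    apply: le_trans (window_le_norm1 D0.*2.+1 (n.+1 * (N - N0)) _).
  apply: ler_sum => i _; rewrite diff_coefE [X in _ <= `|X|]coefB.
  rewrite coef_mulXn_shift.
  rewrite (_ : i%:Z - D0%:Z = (n.+1 * (N - N0) + i)%:Z - (shift N)%:Z) ?diff_coefE//.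
  have le1 : (n.+1 * N0 <= n.+1 * N)%N by rewrite leq_mul2l NN orbT.
  by rewrite /D0 /shift mulnBr; lia.
have tri : psumZ (fun k => `|diff_coef N0 k|) D0 <=
   psumZ (fun k => `|diff_coef N0 k - diff_coef N k|) D0
     + psumZ (fun k => `|diff_coef N k|) D0.
  rewrite /psumZ -big_split/=; apply: ler_sum => i _.
  by rewrite -{1}(subrK (diff_coef N (i%:Z - D0%:Z)) (diff_coef N0 (i%:Z - D0%:Z)))
    ler_normD.
lra.
Qed.

End Difference.

End FourierTransform.

(** * Powers of an M-measure *)

Section ComplexDerivative.
Context (R : realType).
Implicit Types (F G : R -> R[i]) (t : R) (dF dG : R[i]).

Definition is_cderive F t dF : Prop :=
  is_derive t 1 (fun u => complex.Re (F u)) (complex.Re dF) /\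
  is_derive t 1 (fun u => complex.Im (F u)) (complex.Im dF).

Lemma cder_eq F t dF dG : is_cderive F t dF -> dF = dG -> is_cderive F t dG.
Proof. by move=> h <-. Qed.

Lemma cder_sub F G t dF dG : is_cderive F t dF -> is_cderive G t dG ->
  is_cderive (fun u => F u - G u) t (dF - dG).
Proof.
move=> [F1 F2] [G1 G2]; split; rewrite ?cReB ?cImB.
  rewrite (_ : (fun u => _) = (fun u => complex.Re (F u) - complex.Re (G u))).
    exact: is_der_sub.
  by apply/funext => u; rewrite cReB.
rewrite (_ : (fun u => _) = (fun u => complex.Im (F u) - complex.Im (G u))).
  exact: is_der_sub.
by apply/funext => u; rewrite cImB.
Qed.

Lemma cder_mul F G t dF dG : is_cderive F t dF -> is_cderive G t dG ->
  is_cderive (fun u => F u * G u) t (dF * G t + F t * dG).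
Proof.
move=> [F1 F2] [G1 G2]; split.
  rewrite (_ : (fun u => _) = (fun u => complex.Re (F u) * complex.Re (G u) -
    complex.Im (F u) * complex.Im (G u))); last by apply/funext => u; rewrite cReM.
  apply: (is_der_eq (is_der_sub (is_der_mul F1 G1) (is_der_mul F2 G2))).
  by rewrite cReD !cReM; ring.
rewrite (_ : (fun u => _) = (fun u => complex.Re (F u) * complex.Im (G u) +
  complex.Im (F u) * complex.Re (G u))); last by apply/funext => u; rewrite cImM.
apply: (is_der_eq (is_der_add (is_der_mul F1 G2) (is_der_mul F2 G1))).
by rewrite cImD !cImM; ring.
Qed.

Lemma cder_cst (c : R[i]) t : is_cderive (fun=> c) t 0.
Proof. by split; exact: is_der_cst. Qed.

Lemma cder_scale (c : R[i]) F t dF : is_cderive F t dF ->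
  is_cderive (fun u => c * F u) t (c * dF).
Proof.
by move=> h; apply: (cder_eq (cder_mul (cder_cst c t) h)); rewrite mul0r add0r.
Qed.

Lemma cder_exp F t dF n : is_cderive F t dF ->
  is_cderive (fun u => F u ^+ n.+1) t (n.+1%:R * F t ^+ n * dF).
Proof.
move=> h; elim: n => [|n IH]; first by rewrite expr0 !mul1r.
rewrite (_ : (fun u => _) = (fun u => F u * F u ^+ n.+1)); last first.
  by apply/funext => u; rewrite exprS.
by apply: (cder_eq (cder_mul h IH)); rewrite [n.+2%:R]mulrS exprS; ring.
Qed.

End ComplexDerivative.

Section PowerDifference.
Context (R : realType) (m : nat) (F F1 F2 : R -> R[i]).
Local Notation normc := (@Normc.normc R).

(** The function F^(m+2) (1 - F) and its first two formal derivatives.  The exponent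
    keeps a factor F^m in all of them. *)
Definition power_diff t := F t ^+ m.+2 - F t ^+ m.+3.
Definition power_diff1 t := m.+2%:R * F t ^+ m.+1 * F1 t - m.+3%:R * F t ^+ m.+2 * F1 t.
Definition power_diff2 t :=
  (m.+2%:R * (m.+1%:R * F t ^+ m * F1 t) * F1 t + m.+2%:R * F t ^+ m.+1 * F2 t) -
  (m.+3%:R * (m.+2%:R * F t ^+ m.+1 * F1 t) * F1 t + m.+3%:R * F t ^+ m.+2 * F2 t).

Lemma cder_power_diff t : is_cderive F t (F1 t) -> is_cderive power_diff t (power_diff1 t).
Proof. by move=> h; apply: cder_sub; exact: cder_exp. Qed.

Lemma cder_power_diff1 t : is_cderive F t (F1 t) -> is_cderive F1 t (F2 t) ->
  is_cderive power_diff1 t (power_diff2 t).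
Proof.
move=> h h1; apply: cder_sub; apply: cder_mul => //;
  by apply: cder_scale; exact: cder_exp.
Qed.

Section Bounds.
Context (t : R).
Hypothesis F_le1 : normc (F t) <= 1.
Hypothesis m_gt0 : (0 < m)%N.
Let f := normc (F t).
Let D := normc (1 - F t).
Let x := normc (F1 t).
Let y := normc (F2 t).

Let f0 : 0 <= f := normc_ge0 _.
Let D0 : 0 <= D := normc_ge0 _.
Let x0 : 0 <= x := normc_ge0 _.
Let y0 : 0 <= y := normc_ge0 _.

Let fX k : normc (F t ^+ (k + m)) <= f ^+ m.
Proof.
rewrite normcX exprD -/f ler_piMl ?exprn_ge0// exprn_ile1//.
Qed.

Let factor (a b : nat) : (a <= 3 * m)%N ->
  normc (a%:R * (1 - F t) - b%:R * F t) <= (3 * m)%:R * D + b%:R.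
Proof.
move=> am; apply: le_trans (normcB_le _ _) _; rewrite !Normc.normcM !normc_nat.
apply: lerD; first by apply: ler_wpM2r => //; rewrite ler_nat.
by rewrite ler_piMr.
Qed.

Lemma power_diff_le : normc (power_diff t) <= f ^+ m * D.
Proof.
have -> : power_diff t = F t ^+ m.+2 * (1 - F t)
  by rewrite /power_diff mulrBr mulr1 -exprSr.
by rewrite Normc.normcM; apply: ler_wpM2r => //; exact: (fX 2).
Qed.

Lemma power_diff1_le : normc (power_diff1 t) <= f ^+ m * x * ((3 * m)%:R * D + 1).
Proof.
have -> : power_diff1 t = F t ^+ m.+1 * F1 t * (m.+2%:R * (1 - F t) - 1%:R * F t).
  by rewrite /power_diff1 -[m.+3%:R]natr1 !exprS; ring.
rewrite !Normc.normcM; apply: ler_pM; rewrite ?mulr_ge0 ?normc_ge0//.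
  by apply: ler_wpM2r => //; exact: (fX 1).
by apply: factor; lia.
Qed.

(** Every factor m is accompanied by 1 - F or by an additional F'; both are bounded
    by h, up to powers of t, for the transform of an M-measure. *)
Lemma power_diff2_le : normc (power_diff2 t) <=
  f ^+ m * (x * x) * (3 * m)%:R * ((3 * m)%:R * D + 2)
  + f ^+ m * y * ((3 * m)%:R * D + 1).
Proof.
have -> : power_diff2 t =
  F t ^+ m * (F1 t * F1 t) * m.+2%:R * (m.+1%:R * (1 - F t) - 2%:R * F t)
  + F t ^+ m.+1 * F2 t * (m.+2%:R * (1 - F t) - 1%:R * F t).
  by rewrite /power_diff2 -[m.+3%:R]natr1 -[m.+2%:R]natr1 -[m.+1%:R]natr1 !exprS; ring.
apply: le_trans (normcD_le _ _) _; rewrite !Normc.normcM normc_nat; apply: lerD.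
  apply: ler_pM; rewrite ?mulr_ge0 ?normc_ge0//; last by apply: factor; lia.
  apply: ler_pM; rewrite ?mulr_ge0 ?normc_ge0 ?ler_nat//; last by lia.
  by apply: ler_wpM2r; [rewrite mulr_ge0|exact: (fX 0)].
apply: ler_pM; rewrite ?mulr_ge0 ?normc_ge0//; last by apply: factor; lia.
by apply: ler_wpM2r => //; exact: (fX 1).
Qed.

End Bounds.
End PowerDifference.

Ltac nonneg := repeat first
  [ done | by apply: ltW | apply: addr_ge0 | apply: mulr_ge0
  | apply: exprn_ge0 | rewrite invr_ge0 ].

Section ScalarBounds.
Context (R : realType).

Lemma expN_mul_le (v : R) : 0 <= v -> expR (- v) * v <= 2 * expR (- (v / 2)).
Proof.
move=> v0; have -> : - v = - (v / 2) + - (v / 2) by field.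
rewrite expRD -mulrA mulrC ler_wpM2r ?expR_ge0//.
rewrite expRN mulrC ler_pdivrMr ?expR_gt0//.
have := expR_ge1Dx (v / 2); lra.
Qed.

Lemma expN_mul2_le (v : R) : 0 <= v -> expR (- v) * v ^+ 2 <= 16 * expR (- (v / 2)).
Proof.
move=> v0; have -> : - v = - (v / 2) + - (v / 2) by field.
rewrite expRD -mulrA mulrC ler_wpM2r ?expR_ge0//.
rewrite expRN mulrC ler_pdivrMr ?expR_gt0//.
have -> : v / 2 = v / 4 + v / 4 by field.
rewrite expRD.
have h : v / 4 <= expR (v / 4) by have := expR_ge1Dx (v / 4); lra.
have h0 : 0 <= v / 4 by rewrite divr_ge0.
have := ler_pM h0 h0 h h.
have -> : v ^+ 2 = 16 * (v / 4 * (v / 4)) by field.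
lra.
Qed.

Context (c1 c2 c3 c4 c5 c6 : R).
Hypotheses (c1_gt0 : 0 < c1) (c2_gt0 : 0 < c2) (c3_gt0 : 0 < c3)
  (c4_gt0 : 0 < c4) (c5_gt0 : 0 < c5) (c6_gt0 : 0 < c6).

Definition bound_const : R := c6 * c5 + c3 * (6 * c6 / c1 + 1) +
  (3 * (c2 * c3) * (48 * c6 / c1 ^+ 2 + 4 / c1) + c4 * (6 * c6 / c1 + 1)).

Let k1 : 0 <= c6 * c5. Proof. nonneg. Qed.
Let k2 : 0 <= c3 * (6 * c6 / c1 + 1). Proof. nonneg. Qed.
Let k3 : 0 <= 3 * (c2 * c3) * (48 * c6 / c1 ^+ 2 + 4 / c1) + c4 * (6 * c6 / c1 + 1).
Proof. nonneg. Qed.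

Lemma bound_const_ge0 : 0 <= bound_const.
Proof. nonneg. Qed.

(** The values at t of |F|, |1 - F|, |F'|, |F''|, h and h'.  By [H1],
    f^m <= exp (- c1 m h), and half of this exponential absorbs every factor m h;
    the other half is kept, to be multiplied with h' and integrated. *)
Context (m : nat) (f D x y h h' t : R).
Hypotheses (f_ge0 : 0 <= f) (D_ge0 : 0 <= D) (x_ge0 : 0 <= x) (y_ge0 : 0 <= y)
  (h_ge0 : 0 <= h) (h'_ge0 : 0 <= h') (t_gt0 : 0 < t).
Hypotheses (H1 : f <= 1 - c1 * h) (H2 : t * x <= c2 * h) (H3 : x <= c3 * h')
  (H4 : t * y <= c4 * h') (H5 : h <= c5 * (t * h')) (H6 : D <= c6 * h).

Let v := c1 * m%:R * h.
Let E := expR (- v).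
Let u := expR (- (v / 2)).

Let v0 : 0 <= v. Proof. rewrite /v; nonneg. Qed.
Let E0 : 0 <= E. Proof. exact: expR_ge0. Qed.
Let u0 : 0 <= u. Proof. exact: expR_ge0. Qed.
Let mh0 : 0 <= m%:R * h. Proof. exact: mulr_ge0. Qed.

Let fE : f ^+ m <= E.
Proof.
apply: (@le_trans _ _ (expR (- (c1 * h)) ^+ m)).
  by apply: lerXn2r; rewrite ?nnegrE ?expR_ge0//; apply: le_trans H1 (expR_ge1Dx _).
by rewrite -expRM_natl (_ : m%:R * - (c1 * h) = - v)// /v; ring.
Qed.

Let Eu : E <= u.
Proof. by rewrite /E /u ler_expR lerN2; have := v0; lra. Qed.

Let Emh : E * (m%:R * h) <= 2 / c1 * u.
Proof.
have := expN_mul_le v0; rewrite -/E -/u => hv.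
have -> : E * (m%:R * h) = E * v / c1 by rewrite /v; field; exact: lt0r_neq0.
rewrite ler_pdivrMr//; apply: (le_trans hv).
by rewrite le_eqVlt; apply/orP; left; apply/eqP; field; exact: lt0r_neq0.
Qed.

Let Emh2 : E * (m%:R * h) ^+ 2 <= 16 / c1 ^+ 2 * u.
Proof.
have := expN_mul2_le v0; rewrite -/E -/u => hv.
have -> : E * (m%:R * h) ^+ 2 = E * v ^+ 2 / c1 ^+ 2 by rewrite /v; field; exact: lt0r_neq0.
rewrite ler_pdivrMr ?exprn_gt0//; apply: (le_trans hv).
by rewrite le_eqVlt; apply/orP; left; apply/eqP; field; exact: lt0r_neq0.
Qed.

Let mD : (3 * m)%:R * D <= 3 * c6 * (m%:R * h).
Proof.
rewrite natrM; have := ler_wpM2l (ler0n R m) H6; lra.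
Qed.

Let Elin : E * (3 * c6 * (m%:R * h) + 1) <= (6 * c6 / c1 + 1) * u.
Proof.
have := ler_wpM2l (ltW c6_gt0) Emh => h1.
have -> : (6 * c6 / c1 + 1) * u = 3 * (c6 * (2 / c1 * u)) + u by ring.
have := Eu; lra.
Qed.

Lemma scalar_bound0 : f ^+ m * D <= bound_const * (t * h' * u).
Proof.
have th : 0 <= t * h' * u by nonneg.
apply: (@le_trans _ _ (c6 * c5 * (t * h' * u))); last first.
  by apply: ler_wpM2r => //; rewrite /bound_const; have := k2; have := k3; lra.
apply: (@le_trans _ _ (u * (c6 * (c5 * (t * h'))))); last first.
  by rewrite le_eqVlt; apply/orP; left; apply/eqP; ring.
apply: ler_pM => //; first exact: exprn_ge0.
  exact: le_trans fE Eu.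
by apply: (le_trans H6); rewrite ler_pM2l.
Qed.

Lemma scalar_bound1 : f ^+ m * x * ((3 * m)%:R * D + 1) <= bound_const * (h' * u).
Proof.
have th : 0 <= h' * u by nonneg.
apply: (@le_trans _ _ (c3 * (6 * c6 / c1 + 1) * (h' * u))); last first.
  by apply: ler_wpM2r => //; rewrite /bound_const; have := k1; have := k3; lra.
apply: (@le_trans _ _ (E * (c3 * h') * (3 * c6 * (m%:R * h) + 1))).
  apply: ler_pM; [by nonneg|by nonneg| |].
    by apply: ler_pM => //; exact: exprn_ge0.
  by rewrite lerD2r.
have -> : E * (c3 * h') * (3 * c6 * (m%:R * h) + 1) =
  c3 * h' * (E * (3 * c6 * (m%:R * h) + 1)) by ring.
have -> : c3 * (6 * c6 / c1 + 1) * (h' * u) = c3 * h' * ((6 * c6 / c1 + 1) * u) by ring.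
by apply: ler_wpM2l => //; nonneg.
Qed.

Lemma scalar_bound2 : f ^+ m * (x * x) * (3 * m)%:R * ((3 * m)%:R * D + 2)
  + f ^+ m * y * ((3 * m)%:R * D + 1) <= bound_const * (h' / t * u).
Proof.
have ht0 : 0 <= h' / t by nonneg.
have th : 0 <= h' / t * u by nonneg.
apply: (@le_trans _ _ ((3 * (c2 * c3) * (48 * c6 / c1 ^+ 2 + 4 / c1) +
   c4 * (6 * c6 / c1 + 1)) * (h' / t * u))); last first.
  by apply: ler_wpM2r => //; rewrite /bound_const; have := k1; have := k2; lra.
rewrite [leRHS]mulrDl; apply: lerD.
  have xx : x * x <= c2 * c3 * h * (h' / t).
    have -> : c2 * c3 * h * (h' / t) = (c2 * h / t) * (c3 * h') by ring.
    by apply: ler_pM => //; rewrite ler_pdivlMr// mulrC.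
  apply: (@le_trans _ _ (E * (c2 * c3 * h * (h' / t)) * (3 * m)%:R
    * (3 * c6 * (m%:R * h) + 2))).
    apply: ler_pM; [by nonneg|by nonneg| |]; last by rewrite lerD2r.
    apply: ler_wpM2r => //; by apply: ler_pM => //; nonneg.
  have -> : E * (c2 * c3 * h * (h' / t)) * (3 * m)%:R * (3 * c6 * (m%:R * h) + 2) =
    3 * (c2 * c3) * (h' / t) * (3 * (c6 * (E * (m%:R * h) ^+ 2)) + 2 * (E * (m%:R * h))).
    by rewrite natrM; ring.
  have -> : 3 * (c2 * c3) * (48 * c6 / c1 ^+ 2 + 4 / c1) * (h' / t * u) =
    3 * (c2 * c3) * (h' / t) * (3 * (c6 * (16 / c1 ^+ 2 * u)) + 2 * (2 / c1 * u)) by ring.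
  apply: ler_wpM2l; first by nonneg.
  by have := ler_wpM2l (ltW c6_gt0) Emh2; have := Emh; lra.
apply: (@le_trans _ _ (E * (c4 * (h' / t)) * (3 * c6 * (m%:R * h) + 1))).
  apply: ler_pM; [by nonneg|by nonneg| |]; last by rewrite lerD2r.
  apply: ler_pM => //; first exact: exprn_ge0.
  by rewrite mulrA ler_pdivlMr// mulrC.
have -> : E * (c4 * (h' / t)) * (3 * c6 * (m%:R * h) + 1) =
  c4 * (h' / t) * (E * (3 * c6 * (m%:R * h) + 1)) by ring.
have -> : c4 * (6 * c6 / c1 + 1) * (h' / t * u) = c4 * (h' / t) * ((6 * c6 / c1 + 1) * u)
  by ring.
by apply: ler_wpM2l => //; nonneg.
Qed.

End ScalarBounds.

Section FourierContinuity.
Context (R : realType).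

Lemma continuous_uniform_lim (f : R -> R) (P : nat -> R -> R) (tau : nat -> R) :
  (forall N, continuous (P N)) -> tau @ \oo --> 0 ->
  (forall N t, `|f t - P N t| <= tau N) -> continuous f.
Proof.
move=> cP tau0 fP x; apply/cvgrPdist_lt => e e0.
have e3 : 0 < e / 3 by rewrite divr_gt0.
have /cvgr0Pnorm_lt/(_ _ e3)[N _ hN] := tau0.
have tN : tau N < e / 3 by apply: le_lt_trans (ler_norm _) _; apply: hN => /=.
have /cvgrPdist_lt/(_ _ e3) := cP N x; apply: filterS => y hy.
have -> : f x - f y = (f x - P N x) + (P N x - P N y) - (f y - P N y) by ring.
apply: le_lt_trans (ler_normB _ _) _.
have := ler_normD (f x - P N x) (P N x - P N y).
have := fP N x; have := fP N y; lra.
Qed.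

Context (mu : int -> R).
Hypothesis mu_prob : is_probability mu.

Let psum_continuous (F : int -> R -> R) N : (forall k, continuous (F k)) ->
  continuous (fun t => psumZ (fun k => F k t) N).
Proof.
move=> cF x; rewrite /psumZ.
elim: (index_enum _) => [|i s IH].
  rewrite (_ : (fun t => _) = (fun=> 0)); first exact: cvg_cst.
  by apply/funext => t; rewrite big_nil.
rewrite (_ : (fun t => _) = (fun t => F (i%:Z - N%:Z) t +
   \sum_(j <- s) F (j%:Z - N%:Z) t)); last by apply/funext => t; rewrite big_cons.
by apply: cvgD => //; exact: cF.
Qed.

Let der_continuous (f df : R -> R) : (forall t : R, is_derive t 1 f (df t)) -> continuous f.
Proof.
move=> h t; apply/differentiable_continuous/derivable1_diffP; exact: ex_derive.
Qed.

Lemma Re_fourier_continuous : continuous (fun t => complex.Re (fourier mu t)).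
Proof.
apply: (@continuous_uniform_lim _
  (fun N t => psumZ (fun k => mu k * cos (2 * pi * k%:~R * t)) N) (mass_tail mu)).
- move=> N; apply: (@psum_continuous (fun k t => mu k * cos (2 * pi * k%:~R * t))) => k.
  by apply: der_continuous => t; apply: is_der_scale; exact: is_der_cos.
- exact: mass_tail_cvg0.
move=> N t; apply: sumZ_dist => // k; apply: mul_cos_le.
by rewrite ger0_norm// mu_prob.1.
Qed.

Lemma Im_fourier_continuous : continuous (fun t => complex.Im (fourier mu t)).
Proof.
apply: (@continuous_uniform_lim _
  (fun N t => - psumZ (fun k => mu k * sin (2 * pi * k%:~R * t)) N) (mass_tail mu)).
- move=> N t; apply: cvgN.
  apply: (@psum_continuous (fun k t => mu k * sin (2 * pi * k%:~R * t))) => k.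
  by apply: der_continuous => u; apply: is_der_scale; exact: is_der_sin.
- exact: mass_tail_cvg0.
move=> N t; rewrite /= -opprD normrN; apply: sumZ_dist => // k; apply: mul_sin_le.
by rewrite ger0_norm// mu_prob.1.
Qed.

Lemma fourier0 : fourier mu 0 = 1.
Proof.
apply/eqP; rewrite eq_complex /=; apply/andP; split; apply/eqP.
  rewrite /sumZ (_ : (fun k => _) = mu); first exact/cvg_lim/psumZ_mu_cvg.
  by apply/funext => k; rewrite mulr0 cos0 mulr1.
rewrite /sumZ (_ : psumZ _ = fun=> 0); first by rewrite lim_cst ?oppr0.
by apply/funext => N; rewrite /psumZ big1// => i _; rewrite mulr0 sin0 mulr0.
Qed.

Lemma Im_fourier_half : complex.Im (fourier mu 2^-1) = 0.
Proof.
rewrite /= /sumZ (_ : psumZ _ = fun=> 0); first by rewrite lim_cst ?oppr0.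
apply/funext => N; rewrite /psumZ big1// => i _.
set k := i%:Z - N%:Z.
by rewrite (_ : 2 * pi * k%:~R * 2^-1 = pi * k%:~R) ?sin_pi_int ?mulr0//; field.
Qed.

End FourierContinuity.

Section Mmeasure.
Context (R : realType) (mu : int -> R).
Hypothesis hmu : is_Mmeasure mu.
Local Notation normc := (@Normc.normc R).
Local Notation F := (fourier mu).

Lemma C2_is_cderive (t : R) : 0 < t < 1 ->
  is_cderive F t (cderive F t) /\ is_cderive (cderive F) t (cderive (cderive F) t).
Proof.
case: hmu => _ [dR cR] [dI cI] _ ht.
have pt : 0 < `|t| < 1 by have /andP[t0 _] := ht; rewrite gtr0_norm.
have dE (f : R -> R) : derivable f t 1 -> is_derive t 1 f (derive1 f t).
  by move=> h; rewrite derive1E; exact/derivableP.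
split; split; rewrite /cderive /=; apply: dE.
- exact: dR.
- exact: dI.
- exact: (cR t pt).1.
- exact: (cI t pt).1.
Qed.

(** For E = - (K / c) exp (- c h) with c of order n, the derivative is
    K h' exp (- c h), the common factor of the three scalar bounds; its increase
    over [0, 1/2] is at most K / c. *)
Theorem Mmeasure_ritt : exists2 C : R, 0 <= C & forall n N,
  norm1 (diff_poly mu n N) <= C / n.+1%:R + (n + n.+1)%:R * mass_tail mu N.
Proof.
have [mu_prob _ _ [h [ch h0 _ dh [[c1 c1_gt0 H1] [c2 c2_gt0 H2] [c3 c3_gt0 H3]
   [c4 c4_gt0 H4] [c5 c5_gt0 H5]]]]] := hmu.
pose h' : R -> R := derive1 h.
have hder (t : R) : 0 < t < 2^-1 -> is_derive t 1 h (h' t).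
  move=> /[dup] ht /andP[t0 _]; rewrite /h' derive1E; apply/derivableP.
  by apply: (dh t _).1; rewrite /= gtr0_norm.
have ch0 : {within `[0, 2^-1], continuous h}.
  by apply: continuous_subspaceW ch; apply: subset_itvScc;
    rewrite bnd_simp// oppr_le0 invr_ge0.
have in1 (t : R) : 0 < t <= 2^-1 -> 0 < t < 1.
  move=> /andP[-> /le_lt_trans]; apply; by rewrite invf_lt1// ltr1n.
have inW (t : R) : 0 < t < 2^-1 -> 0 < t <= 2^-1 by move=> /andP[-> /ltW ->].
have tnorm (t : R) (z : R[i]) : 0 < t -> normc (t%:C%C * z) = t * normc z.
  by move=> t0; rewrite Normc.normcM normc_real gtr0_norm.
have h_ge0 (t : R) : 0 < t < 2^-1 -> 0 <= h t.
  by move=> /H2; rewrite -(pmulr_rge0 _ c2_gt0); exact: le_trans (normc_ge0 _).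
have h'_ge0 (t : R) : 0 < t < 2^-1 -> 0 <= h' t.
  by move=> /H3; rewrite -(pmulr_rge0 _ c3_gt0); exact: le_trans (normc_ge0 _).
(* The bound on the derivative of F is integrated from 0, where F is 1 and h is 0. *)
have oneF (t : R) : 0 < t < 2^-1 -> normc (1 - F t) <= 2 * c3 * h t.
  move=> ht; have /andP[t0 t2] := ht.
  have sub : `[0, t] `<=` `[0, 2^-1] by apply: subset_itvScc; rewrite bnd_simp// ltW.
  have cg : {within `[0, t], continuous (fun u => c3 * h u)}.
    move=> u; apply: cvgM; first exact: cvg_cst.
    exact: continuous_subspaceW sub ch0 u.
  have dg (u : R) : 0 < u < t -> is_derive u 1 (fun v => c3 * h v) (c3 * h' u).
    move=> /andP[u0 ut]; apply: is_der_scale; apply: hder.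
    by rewrite u0 (lt_trans ut).
  have du (u : R) : 0 < u < t -> 0 < u < 2^-1 by move=> /andP[-> ut]; exact: lt_trans ut t2.
  have rb : `|complex.Re (F t) - complex.Re (F 0)| <= c3 * h t - c3 * h 0.
    apply: (@mean_value_le _ (fun u => complex.Re (F u)) (fun u => complex.Re (cderive F u))
      (fun u => c3 * h u) (fun u => c3 * h' u) _ _ (ltW t0)) => //.
    - exact/continuous_subspaceT/Re_fourier_continuous.
    - by move=> u hu; exact: (C2_is_cderive (in1 _ (inW _ (du _ hu)))).1.1.
    - by move=> u hu; apply: le_trans (Re_le_normc _) _; exact: H3 (du _ hu).
  have ib : `|complex.Im (F t) - complex.Im (F 0)| <= c3 * h t - c3 * h 0.
    apply: (@mean_value_le _ (fun u => complex.Im (F u)) (fun u => complex.Im (cderive F u))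
      (fun u => c3 * h u) (fun u => c3 * h' u) _ _ (ltW t0)) => //.
    - exact/continuous_subspaceT/Im_fourier_continuous.
    - by move=> u hu; exact: (C2_is_cderive (in1 _ (inW _ (du _ hu)))).1.2.
    - by move=> u hu; apply: le_trans (Im_le_normc _) _; exact: H3 (du _ hu).
  rewrite h0 mulr0 subr0 in rb ib.
  rewrite -normcN_eq opprB -(fourier0 mu_prob); apply: le_trans (normc_le_parts _) _.
  rewrite cReB cImB; lra.
have c6_gt0 : 0 < 2 * c3 by rewrite mulr_gt0.
pose K := bound_const c1 c2 c3 c4 c5 (2 * c3).
have K0 : 0 <= K by exact: bound_const_ge0.
(* The 6 covers n < 3, where no power of F is left to compare with an exponential. *)
exists (6 + 67 * (8 * K / c1)) => [|n N].
  by rewrite addr_ge0// mulr_ge0// divr_ge0 ?mulr_ge0// ltW.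
have [n3|n3] := ltnP n 3.
  have h1 : norm1 (diff_poly mu n N) <= 2.
    apply: le_trans (norm1B _ _) _; rewrite norm1_mulXn [leRHS]mulr2n.
    by apply: lerD; apply: norm1X; exact: norm1_mass_poly_le1.
  apply: (le_trans h1); rewrite -[leLHS]addr0; apply: lerD; last first.
    by rewrite mulr_ge0// mass_tail_ge0.
  rewrite ler_pdivlMr ?ltr0n//; apply: (@le_trans _ _ 6).
    by rewrite -natrM ler_nat; move: n3; clear; lia.
  by rewrite lerDl mulr_ge0// divr_ge0 ?mulr_ge0// ltW.
have nE : n = (n - 2).+2 by lia.
set m := (n - 2)%N in nE; have m0 : (0 < m)%N by lia.
have nm : (n.+1 <= m * 4)%N by move: n3; rewrite /m; clear; lia.
have mR : 0 < m%:R :> R by rewrite ltr0n.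
pose c := c1 * m%:R / 2; have c_gt0 : 0 < c by rewrite divr_gt0// mulr_gt0.
pose F1 := cderive F; pose F2 := cderive F1.
pose G0 := power_diff m F; pose G1 := power_diff1 m F F1; pose G2 := power_diff2 m F F1 F2.
pose E (t : R) : R := - (K / c) * expR (- (c * h t)).
pose E1 (t : R) : R := K * (h' t * expR (- (c * h t))).
have dG (t : R) : 0 < t <= 2^-1 -> is_cderive G0 t (G1 t) /\ is_cderive G1 t (G2 t).
  move=> /in1 /C2_is_cderive[d1 d2]; split; first exact: cder_power_diff.
  exact: cder_power_diff1.
have dE (t : R) : 0 < t < 2^-1 -> is_derive t 1 E (E1 t).
  move=> ht; have e1 := is_der_scale (- c) (hder t ht).
  have e2 := @is_derive1_comp R expR (fun u => - c * h u) t _ _ (is_derive_expR _) e1.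
  rewrite (_ : E = fun u => - (K / c) * expR (- c * h u)); last first.
    by apply/funext => u; rewrite /E [- c * _]mulNr.
  apply: (is_der_eq (is_der_scale (- (K / c)) e2)).
  by rewrite /E1 [- c * h t]mulNr; field; exact: lt0r_neq0.
have cE : {within `[0, 2^-1], continuous E}.
  move=> t; apply: cvgM; first exact: cvg_cst.
  apply: (cvg_comp _ expR); last exact: continuous_expR.
  by apply: cvgN; apply: cvgM; [exact: cvg_cst|exact: ch0].
have bounds (t : R) : 0 < t < 2^-1 -> [/\ normc (G0 t) <= t * E1 t,
    normc (G1 t) <= E1 t & normc (G2 t) <= E1 t / t].
  move=> ht; have /andP[t0 _] := ht.
  have F_le := fourier_le1 mu_prob t.
  have uE : expR (- (c * h t)) = expR (- (c1 * m%:R * h t / 2)).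
    by congr (expR (- _)); rewrite /c; field.
  have S2 : t * normc (F1 t) <= c2 * h t by have := H2 t ht; rewrite tnorm.
  have S4 : t * normc (F2 t) <= c4 * h' t by have := H4 t ht; rewrite tnorm.
  split.
  - have b0 := @power_diff_le R m F t F_le; apply: (le_trans b0).
    have -> : t * E1 t = K * (t * h' t * expR (- (c1 * m%:R * h t / 2))).
      by rewrite /E1 uE; ring.
    by apply: scalar_bound0 => //; rewrite ?normc_ge0 ?h_ge0 ?h'_ge0 ?H1 ?H3 ?H5 ?oneF.
  - have b1 := @power_diff1_le R m F F1 F2 t F_le m0; apply: (le_trans b1); rewrite /E1 uE.
    by apply: (@scalar_bound1 _ c1 c2 c3 c4 c5 (2 * c3)) => //;
      rewrite ?normc_ge0 ?h_ge0 ?h'_ge0 ?H1 ?H3 ?H5 ?oneF.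
  - have b2 := @power_diff2_le R m F F1 F2 t F_le m0; apply: (le_trans b2).
    have -> : E1 t / t = K * (h' t / t * expR (- (c1 * m%:R * h t / 2))).
      by rewrite /E1 uE; ring.
    by apply: scalar_bound2 => //; rewrite ?normc_ge0 ?h_ge0 ?h'_ge0 ?H1 ?H3 ?H5 ?oneF.
have Ediff : 67 * (E 2^-1 - E 0) <= (67 * (8 * K / c1)) / n.+1%:R.
  have e1 : E 2^-1 - E 0 <= K / c.
    rewrite /E h0 mulr0 oppr0 expR0 mulr1 opprK -[leRHS]add0r lerD2r mulNr oppr_le0.
    by rewrite mulr_ge0 ?expR_ge0// divr_ge0// ltW.
  rewrite -[leRHS]mulrA ler_pM2l//; apply: (le_trans e1).
  have -> : K / c = 2 * K / c1 / m%:R by rewrite /c; field; rewrite !lt0r_neq0.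
  have -> : 8 * K / c1 / n.+1%:R = 2 * K / c1 * (4 / n.+1%:R) by ring.
  apply: ler_wpM2l; first by rewrite divr_ge0 ?mulr_ge0// ltW.
  by rewrite ler_pdivlMr ?ltr0n// mulrC ler_pdivrMr// [_ * m%:R]mulrC -natrM ler_nat.
have key := @norm1_diff_poly_le R mu mu_prob n (67 * (E 2^-1 - E 0)) _ N.
apply: le_trans (key _) _ => [eps Kb q S S1 J eps0 Kb0 hS hS1 hS1K hSq|]; last first.
  rewrite lerD2r; apply: (le_trans Ediff).
  by rewrite ler_pM2r ?invr_gt0 ?ltr0n// lerDr.
apply: (@fourier_sum_le R (fun t => complex.Re (G0 t)) (fun t => complex.Re (G1 t))
  (fun t => complex.Re (G2 t)) (fun t => complex.Im (G0 t)) (fun t => complex.Im (G1 t))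
  (fun t => complex.Im (G2 t)) E E1 _ _ _ _ _ _ _ _ _ _ _ _ _ eps Kb q S S1 J) => //.
- by move=> t /dG[[]].
- by move=> t /dG[_ []].
- by move=> t /dG[[]].
- by move=> t /dG[_ []].
- by move=> t /bounds[b _ _]; exact: le_trans (Re_le_normc _) b.
- by move=> t /bounds[b _ _]; exact: le_trans (Im_le_normc _) b.
- by move=> t /bounds[_ b _]; exact: le_trans (Re_le_normc _) b.
- by move=> t /bounds[_ b _]; exact: le_trans (Im_le_normc _) b.
- by move=> t /bounds[_ _ b]; exact: le_trans (Re_le_normc _) b.
- by move=> t /bounds[_ _ b]; exact: le_trans (Im_le_normc _) b.
- rewrite /G0 /power_diff; move: (Im_fourier_half mu); case: (F 2^-1) => a b /= ->.
  rewrite -[(a +i* 0)%C]/(a%:C)%C -!(rmorphXn (real_complex R)).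
  by rewrite -(rmorphB (real_complex R)).
- by move=> k t ht; rewrite /G0 /power_diff -nE; exact: hS1.
Qed.

End Mmeasure.

(** * The seminormed space of integrable functions *)

Section IntegrableFunctions.
Context (d : measure_display) (X : measurableType d) (R : realType).
Context (K : set R[i]) (m : {measure set X -> \bar R}).
Hypothesis hK : scalar_field K.
Local Notation normc := (@Normc.normc R).
Local Notation V := (X -> Rcomplex R).
Local Notation L := (L1 K m : set V).

Definition L1p (f : V) : R := fine (L1norm m f).

Let K_real (a : R) : K (a%:C)%C.
Proof. by case: hK => ->//; exists a. Qed.

Let K_add x y : K x -> K y -> K (x + y).
Proof.
by case: hK => ->//= -[a _ <-] [b _ <-]; exists (a + b) => //; rewrite rmorphD.
Qed.

Let K_mul x y : K x -> K y -> K (x * y).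
Proof.
by case: hK => ->//= -[a _ <-] [b _ <-]; exists (a * b) => //; rewrite rmorphM.
Qed.

Let K_cases : (forall z, K z -> complex.Im z = 0) \/ (forall z, K z).
Proof. by case: hK => ->; [left => _ [a _ <-]|right]. Qed.

Lemma measurable_normc (f : X -> R[i]) :
  measurable_fun setT (fun x => complex.Re (f x)) ->
  measurable_fun setT (fun x => complex.Im (f x)) ->
  measurable_fun setT (fun x => normc (f x)).
Proof.
move=> mr mi; rewrite (_ : (fun x => normc (f x)) =
  (fun x => (complex.Re (f x) ^+ 2 + complex.Im (f x) ^+ 2) `^ 2^-1)).
  apply: (measurableT_comp (measurable_powR _)) => //.
  by apply: measurable_funD; exact: measurable_funX.
apply/funext => x; rewrite powR12_sqrt ?addr_ge0 ?sqr_ge0//.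
by case: (f x).
Qed.

Lemma L1_measurable (f : V) : L f ->
  measurable_fun setT (fun x => complex.Re (f x)) /\
  measurable_fun setT (fun x => complex.Im (f x)).
Proof.
move=> [_ /Lfun1_integrable/integrableP[mr _] /Lfun1_integrable/integrableP[mi _]].
by split; apply/measurable_EFinP.
Qed.

Lemma L1_measurable_normc (f : V) : L f -> measurable_fun setT (fun x => normc (f x)).
Proof. by move=> /L1_measurable[]; exact: measurable_normc. Qed.

Lemma L1P (f : V) : L f <->
  [/\ forall x, K (f x), measurable_fun setT (fun x => complex.Re (f x)),
      measurable_fun setT (fun x => complex.Im (f x)) & (L1norm m f < +oo)%E].
Proof.
split=> [Lf|[Kf mr mi fin]].
  have [mr mi] := L1_measurable Lf; have mn := L1_measurable_normc Lf.
  case: Lf => Kf /Lfun1_integrable/integrableP[_ ir] /Lfun1_integrable/integrableP[_ ii].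
  split => //; apply: (@le_lt_trans _ _
    (\int[m]_x (`|(complex.Re (f x))%:E| + `|(complex.Im (f x))%:E|))%E); last first.
    rewrite ge0_integralD//.
    - exact: lte_add_pinfty.
    - by apply/measurable_EFinP; exact: measurableT_comp.
    - by apply/measurable_EFinP; exact: measurableT_comp.
  apply: ge0_le_integral => //.
  - by move=> x _; rewrite lee_fin normc_ge0.
  - exact/measurable_EFinP.
  - by apply: emeasurable_funD; apply/measurable_EFinP; exact: measurableT_comp.
  - by move=> x _; rewrite /= -EFinD lee_fin normc_le_parts.
have mn := measurable_normc mr mi.
split => //; apply/Lfun1_integrable/integrableP; split; first exact/measurable_EFinP.
  apply: le_lt_trans fin; apply: ge0_le_integral => //.
  - by apply/measurable_EFinP; exact: measurableT_comp.
  - exact/measurable_EFinP.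
  - by move=> x _; rewrite lee_fin Re_le_normc.
  exact/measurable_EFinP.
apply: le_lt_trans fin; apply: ge0_le_integral => //.
- by apply/measurable_EFinP; exact: measurableT_comp.
- exact/measurable_EFinP.
- by move=> x _; rewrite lee_fin Im_le_normc.
Qed.

Lemma L1norm_ge0 (f : V) : (0 <= L1norm m f)%E.
Proof. by apply: integral_ge0 => x _; rewrite lee_fin normc_ge0. Qed.

Lemma L1normE (f : V) : L f -> L1norm m f = (L1p f)%:E.
Proof.
by move=> /L1P[_ _ _ fin]; rewrite /L1p fineK// ge0_fin_numE// L1norm_ge0.
Qed.

Lemma L1normD (f g : V) : L f -> L g ->
  (L1norm m (f + g)%R <= L1norm m f + L1norm m g)%E.
Proof.
move=> Lf Lg; have mf := L1_measurable_normc Lf; have mg := L1_measurable_normc Lg.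
have [mfr mfi] := L1_measurable Lf; have [mgr mgi] := L1_measurable Lg.
rewrite /L1norm -ge0_integralD//; [|by move=> x _; rewrite lee_fin normc_ge0|
  exact/measurable_EFinP|by move=> x _; rewrite lee_fin normc_ge0|exact/measurable_EFinP].
apply: ge0_le_integral => //.
- by move=> x _; rewrite lee_fin normc_ge0.
- apply/measurable_EFinP; apply: measurable_normc.
    by under eq_fun do rewrite cReD; exact: measurable_funD.
  by under eq_fun do rewrite cImD; exact: measurable_funD.
- by apply: emeasurable_funD; exact/measurable_EFinP.
- by move=> x _; rewrite -EFinD lee_fin normcD_le.
Qed.

Lemma scaleRcE (a : R) (z : R[i]) : a *: (z : Rcomplex R) = (a%:C)%C * z :> R[i].
Proof.
by apply/eqP; case: z => x y; rewrite eq_complex /= !mul0r subr0 addr0 !eqxx.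
Qed.

Lemma L1normZ (a : R) (f : V) : L f -> L1norm m (a *: f) = (`|a|%:E * L1norm m f)%E.
Proof.
move=> Lf; have mf := L1_measurable_normc Lf.
rewrite /L1norm -ge0_integralZl//; last 2 first.
- exact/measurable_EFinP.
- by move=> x _; rewrite lee_fin normc_ge0.
apply: eq_integral => x _.
by rewrite -EFinM (_ : (a *: f) x = (a%:C)%C * (f x : R[i])) ?Normc.normcM ?normc_real//
  -scaleRcE.
Qed.

Lemma L1_seminorm : seminorm L L1p.
Proof.
have L0 : L 0.
  apply/L1P; split => [x|||];
    [exact: (K_real 0)|exact: measurable_cst|exact: measurable_cst|].
  rewrite /L1norm (eq_integral (fun=> 0%E)) ?integral0// => x _.
  by rewrite -[(0 : V) x]/(0 : R[i]) Normc.normc0.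
have LZ a f : L f -> L (a *: f).
  move=> Lf; have [mr mi] := L1_measurable Lf; apply/L1P; split.
  - by move=> x; rewrite [X in K X]scaleRcE; apply: K_mul => //; case: Lf.
  - rewrite (_ : (fun x => complex.Re _) = (fun x => a * complex.Re (f x))).
      exact: measurable_funM.
    by apply/funext => x; rewrite -[(a *: f) x]/(a *: f x); case: (f x).
  - rewrite (_ : (fun x => complex.Im _) = (fun x => a * complex.Im (f x))).
      exact: measurable_funM.
    by apply/funext => x; rewrite -[(a *: f) x]/(a *: f x); case: (f x).
  - by rewrite L1normZ// L1normE// -EFinM ltry.
have LD f g : L f -> L g -> L (f + g).
  move=> Lf Lg; have [mfr mfi] := L1_measurable Lf; have [mgr mgi] := L1_measurable Lg.
  apply/L1P; split.
  - by move=> x; apply: K_add; [case: Lf|case: Lg].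
  - by under eq_fun do rewrite cReD; exact: measurable_funD.
  - by under eq_fun do rewrite cImD; exact: measurable_funD.
  - by apply: le_lt_trans (L1normD Lf Lg) _; rewrite !L1normE// -EFinD ltry.
split => //.
- by move=> f; rewrite /L1p fine_ge0// L1norm_ge0.
- by move=> f g Lf Lg; rewrite -lee_fin EFinD -!L1normE//; [exact: L1normD|exact: LD].
- by move=> a f Lf; apply: EFin_inj; rewrite EFinM -!L1normE//; [exact: L1normZ|exact: LZ].
Qed.

Let S := L1_seminorm.

Lemma aeeq_L1p (f g : V) : L f -> L g -> aeeq m f g -> L1p (f - g) = 0.
Proof.
move=> Lf Lg fg; have Lfg := snB S Lf Lg.
apply: EFin_inj; rewrite -L1normE// /L1norm.
rewrite (ge0_ae_eq_integral (g := fun=> 0%E)) ?integral0//.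
- exact/measurable_EFinP/L1_measurable_normc.
- by move=> x _; rewrite lee_fin normc_ge0.
move: fg; apply: filterS => x fgx _; congr EFin.
by rewrite -[(f - g) x]/((f x : R[i]) - g x) fgx subrr Normc.normc0.
Qed.

(** ** Completeness *)

Lemma bounded_variation_cvg (a : nat -> R) (v : nat -> R) (B : R) :
  (forall n, `|a n.+1 - a n| <= v n) -> (forall n, \sum_(0 <= i < n) v i <= B) ->
  cvgn a /\ forall n, `|a n - limn a| <= B.
Proof.
move=> av vB.
pose s n := \sum_(0 <= i < n) v i.
have v0 n : 0 <= v n by exact: le_trans (av n).
have sn : nondecreasing_seq s.
  apply/nondecreasing_seqP => n; by rewrite /s big_nat_recr//= lerDl.
have cs : cvgn s.
  by apply: nondecreasing_is_cvgn => //; exists B => _ [n _ <-]; exact: vB.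
have dist n k : `|a (n + k)%N - a n| <= s (n + k)%N - s n.
  elim: k => [|k IH]; first by rewrite addn0 !subrr normr0.
  rewrite addnS /s big_nat_recr//= -/(s _).
  have := ler_normD (a (n + k).+1 - a (n + k)%N) (a (n + k)%N - a n).
  rewrite addrA subrK => h; apply: (le_trans h).
  have := av (n + k)%N; rewrite -/(s (n + k)%N) -/(s n); move: IH; lra.
have cas : cvgn (fun n => a n + s n).
  apply: nondecreasing_is_cvgn.
    apply/nondecreasing_seqP => n; have := av n; rewrite ler_norml => /andP[h _].
    by rewrite /s big_nat_recr//=; move: h; lra.
  exists (`|a 0%N| + B + B) => _ [n _ <-].
  have := dist 0%N n; rewrite add0n {2}/s big_geq// subr0 => h.
  have := ler_normD (a n - a 0%N) (a 0%N); rewrite subrK.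
  by have := ler_norm (a n); have := vB n; rewrite -/(s n); move: h; lra.
have ca : cvgn a.
  rewrite (_ : a = (fun n => a n + s n) - s); first exact: is_cvgB.
  by apply/funext => n; rewrite -[RHS]/(a n + s n - s n) addrK.
split => // n.
have c : `|a n - a k| @[k --> \oo] --> `|a n - limn a|.
  by apply: cvg_norm; apply: cvgB; [exact: cvg_cst|exact: ca].
rewrite -(cvg_lim _ c)//; apply: limr_le; first by apply/cvg_ex; eexists; exact: c.
exists n => // k /= nk; rewrite distrC -(subnKC nk); apply: le_trans (dist _ _) _.
have := vB (n + (k - n))%N; have : 0 <= s n by rewrite /s sumr_ge0.
by rewrite -/(s _); lra.
Qed.

(** Riesz and Fischer: a sequence of bounded variation in L^1 has pointwise bounded
    variation almost everywhere, with an integrable bound, and dominated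
    convergence applies.  The limit is set to 0 on the exceptional set, so that it
    takes its values in the field of scalars everywhere. *)
Lemma L1_complete (u : nat -> V) (B : R) : (forall N, L (u N)) ->
  (forall N, \sum_(0 <= i < N) L1p (u i.+1 - u i) <= B) ->
  exists2 g : V, L g & L1p (u N - g) @[N --> \oo] --> 0.
Proof.
move=> Lu uB.
pose v i x := normc (u i.+1 x - u i x).
have v0 i x : 0 <= v i x by exact: normc_ge0.
have Lv i : L (u i.+1 - u i) by exact: (snB S).
have mv i : measurable_fun setT (v i) by have := L1_measurable_normc (Lv i).
pose G x := (\sum_(0 <= i <oo) (v i x)%:E)%E.
have mG : measurable_fun setT G.
  apply: (ge0_emeasurable_sum (P := xpredT)) => [i x _ _|i _]; last exact/measurable_EFinP.
  by rewrite lee_fin.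
have intG : (\int[m]_x G x <= B%:E)%E.
  rewrite integral_nneseries//; last 2 first.
  - by move=> i; exact/measurable_EFinP.
  - by move=> i x _; rewrite lee_fin.
  apply: lime_le.
    by apply: is_cvg_nneseries => i _ _; apply: integral_ge0 => x _; rewrite lee_fin.
  near=> N; have -> : (\sum_(0 <= i < N) \int[m]_x (v i x)%:E =
      (\sum_(0 <= i < N) L1p (u i.+1 - u i))%:E)%E.
    by rewrite -sumEFin; apply: eq_bigr => i _; rewrite -L1normE.
  by rewrite lee_fin.
have G0 x : (0 <= G x)%E by apply: nneseries_ge0 => i _ _; rewrite lee_fin.
have iG : m.-integrable setT G.
  apply/integrableP; split => //.
  under eq_integral => x _ do rewrite gee0_abs//.
  exact: le_lt_trans intG (ltry _).
have finG : {ae m, forall x, G x \is a fin_num}.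
  by have := integrable_ae measurableT iG; apply: filterS => x; exact.
have conv x : G x \is a fin_num -> forall part : R[i] -> R,
    (forall z w, `|part z - part w| <= normc (z - w)) ->
    cvgn (fun N => part (u N x)) /\
    forall N, `|part (u N x) - limn (fun N => part (u N x))| <= fine (G x).
  move=> fG part hpart; apply: (@bounded_variation_cvg _ (fun i => v i x)).
    by move=> n; exact: hpart.
  move=> n; rewrite -lee_fin fineK// -sumEFin; apply: nneseries_lim_ge => i _ _.
  by rewrite lee_fin.
have hRe z w : `|complex.Re z - complex.Re w| <= normc (z - w).
  by rewrite -cReB Re_le_normc.
have hIm z w : `|complex.Im z - complex.Im w| <= normc (z - w).
  by rewrite -cImB Im_le_normc.
pose good x := G x \is a fin_num.
have mgood : measurable [set x | good x].
  have := emeasurable_fin_num measurableT mG; by rewrite setTI.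
pose cut (part : R[i] -> R) N x := part (u N x) * \1_[set x | good x] x.
have cutE part N x : good x -> cut part N x = part (u N x).
  by move=> gx; rewrite /cut indicE mem_set// mulr1.
have cut0 part N x : ~ good x -> cut part N x = 0.
  by move=> gx; rewrite /cut indicE memNset// mulr0.
have ccut part x : (forall z w, `|part z - part w| <= normc (z - w)) ->
    cut part N x @[N --> \oo] --> limn (fun N => cut part N x).
  move=> hp; have [gx|ngx] := pselect (good x).
    rewrite (_ : (fun N => cut part N x) = (fun N => part (u N x))).
      exact: (conv x gx part hp).1.
    by apply/funext => N; exact: cutE.
  rewrite (_ : (fun N => cut part N x) = (fun N => 0)); last by apply/funext => N;
    exact: cut0.
  exact: is_cvg_cst.
pose w x : R[i] := (limn (fun N => cut (@complex.Re R) N x) +i*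
                    limn (fun N => cut (@complex.Im R) N x))%C.
have mcut part N : measurable_fun setT (fun x => part (u N x)) ->
   measurable_fun setT (cut part N).
  by move=> mp; apply: measurable_funM => //; exact: measurable_indic.
have mwr : measurable_fun setT (fun x => complex.Re (w x)).
  apply: (@measurable_fun_cvg _ _ _ _ (cut (@complex.Re R))) => [N|x _].
    by apply: mcut; exact: (L1_measurable (Lu N)).1.
  exact: ccut.
have mwi : measurable_fun setT (fun x => complex.Im (w x)).
  apply: (@measurable_fun_cvg _ _ _ _ (cut (@complex.Im R))) => [N|x _].
    by apply: mcut; exact: (L1_measurable (Lu N)).2.
  exact: ccut.
have Kw x : K (w x).
  case: K_cases => [KIm|]; last by apply.
  rewrite /w (_ : (fun N => cut (@complex.Im R) N x) = fun=> 0).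
    by rewrite lim_cst//; exact: K_real.
  by apply/funext => N; rewrite /cut KIm ?mul0r//; case: (Lu N).
have wlim part x : (forall z w, `|part z - part w| <= normc (z - w)) -> good x ->
    part (u N x) @[N --> \oo] --> limn (fun N => cut part N x) /\
    forall N, `|part (u N x) - limn (fun N => cut part N x)| <= fine (G x).
  move=> hp gx; rewrite (_ : (fun N => cut part N x) = (fun N => part (u N x))).
    exact: (conv x gx part hp).
  by apply/funext => N; exact: cutE.
have dom x N : good x -> normc (u N x - w x) <= 2 * fine (G x).
  move=> gx; apply: le_trans (normc_le_parts _) _; rewrite cReB cImB mulr2n mulrDl mul1r.
  by apply: lerD; [exact: (wlim _ x hRe gx).2|exact: (wlim _ x hIm gx).2].
have ptw x : good x -> normc (u N x - w x) @[N --> \oo] --> (0 : R).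
  move=> gx; have [cr _] := wlim _ x hRe gx; have [ci _] := wlim _ x hIm gx.
  apply: (@squeeze_cvgr _ _ _ _ (fun=> 0) (fun N =>
     `|complex.Re (u N x) - complex.Re (w x)| + `|complex.Im (u N x) - complex.Im (w x)|)).
  - near=> N; apply/andP; split; first exact: normc_ge0.
    by rewrite -cReB -cImB; exact: normc_le_parts.
  - exact: cvg_cst.
  rewrite [X in _ --> X](_ : 0 = `|complex.Re (w x) - complex.Re (w x)| +
      `|complex.Im (w x) - complex.Im (w x)|); last by rewrite !subrr normr0 addr0.
  by apply: cvgD; apply: cvg_norm; apply: cvgB => //; exact: cvg_cst.
have mdiff N : measurable_fun setT (fun x => normc (u N x - w x)).
  have [mr mi] := L1_measurable (Lu N); apply: measurable_normc.
    by under eq_fun do rewrite cReB; exact: measurable_funB.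
  by under eq_fun do rewrite cImB; exact: measurable_funB.
have domE N : {ae m, forall x, setT x -> ((normc (u N x - w x))%:E <= 2%:E * G x)%E}.
  apply: filterS finG => x gx _; rewrite -(fineK gx) -EFinM lee_fin; exact: dom.
have fin0 : (\int[m]_x (normc (u 0%N x - w x))%:E < +oo)%E.
  apply: (@le_lt_trans _ _ (\int[m]_x (2%:E * G x))%E).
    apply: ae_ge0_le_integral => //.
    - by move=> x _; rewrite lee_fin normc_ge0.
    - exact/measurable_EFinP.
    - by move=> x _; rewrite mule_ge0.
    - exact: measurable_funeM.
  rewrite ge0_integralZl// ?lee_fin//; apply: (le_lt_trans (lee_wpmul2l _ intG)) => //.
  by rewrite -EFinM ltry.
have Lw : L w.
  apply/L1P; split => //; apply: (@le_lt_trans _ _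
    (\int[m]_x ((normc (u 0%N x))%:E + (normc (u 0%N x - w x))%:E))%E).
    apply: ge0_le_integral => //.
    - by move=> x _; rewrite lee_fin normc_ge0.
    - exact/measurable_EFinP/measurable_normc.
    - apply: emeasurable_funD; apply/measurable_EFinP => //.
      exact: L1_measurable_normc.
    - move=> x _; rewrite -EFinD lee_fin.
      rewrite -{1}(subKr (u 0%N x) (w x)); exact: normcB_le.
  rewrite ge0_integralD//.
  - by apply: lte_add_pinfty => //; have /L1P[] := Lu 0%N.
  - by move=> x _; rewrite lee_fin normc_ge0.
  - exact/measurable_EFinP/L1_measurable_normc.
  - by move=> x _; rewrite lee_fin normc_ge0.
  - exact/measurable_EFinP.
exists w => //.
have [] := @dominated_convergence _ _ _ m setT measurableT
  (fun N x => (normc (u N x - w x))%:E) (fun=> 0%E) (fun x => 2%:E * G x)%E.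
- by move=> N; exact/measurable_EFinP.
- exact: measurable_cst.
- apply: filterS finG => x gx _; apply: cvg_EFin; last exact: ptw.
  by near=> N.
- exact: integrableZl.
- apply: filterS finG => x gx N _; rewrite gee0_abs ?lee_fin ?normc_ge0//.
  by rewrite -(fineK gx) -EFinM lee_fin; exact: dom.
move=> _ _; rewrite integral0 => /fine_cvg; rewrite /L1p /L1norm.
exact.
Unshelve. all: by end_near. Qed.

End IntegrableFunctions.

Section Operators.
Context (d : measure_display) (X : measurableType d) (R : realType).
Context (K : set R[i]) (m : {measure set X -> \bar R}).
Hypothesis hK : scalar_field K.
Local Notation V := (X -> Rcomplex R).
Local Notation L := (L1 K m : set V).
Local Notation p := (@L1p d X R m).
Let S := L1_seminorm m hK.

Lemma scale_fctE (a : R) (f : V) x : (a *: f) x = (a%:C)%C * (f x : R[i]) :> R[i].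
Proof. exact: scaleRcE. Qed.

Lemma bounded_op_in T : bounded_op K m T -> forall f : V, L f -> L (T f).
Proof. by case. Qed.

Lemma bounded_op_lin T : bounded_op K m T -> forall a (f g : V), L f -> L g ->
  p (T (a *: f + g) - (a *: (T f : V) + T g)) = 0.
Proof.
move=> [Tin _ Tlin _] a f g Lf Lg.
have Laf : L (a *: f + g) by apply: (snD S) => //; exact: (snZ S).
have Lr : L (a *: (T f : V) + T g).
  by apply: (snD S); [apply: (snZ S)|]; exact: Tin.
apply: (aeeq_L1p hK) => //; first exact: Tin.
rewrite (_ : a *: f + g = fun x => (a%:C)%C * f x + g x); last first.
  by apply/funext => x; rewrite -scale_fctE.
rewrite (_ : a *: (T f : V) + T g = fun x => (a%:C)%C * T f x + T g x); last first.
  by apply/funext => x; rewrite -scale_fctE.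
by apply: Tlin => //; case: hK => ->//; exists a.
Qed.

(** The operator norm is a supremum over the unit ball, and [T] is homogeneous only
    up to null elements.  If p f = 0, all multiples of f lie in the unit ball, which
    forces p (T f) = 0. *)
Lemma le_opnorm T (M : R) : (forall f : V, L f -> L (T f)) ->
  (forall a (f g : V), L f -> L g ->
     p (T (a *: f + g) - (a *: (T f : V) + T g)) = 0) ->
  (opnorm K m T <= M%:E)%E -> oper L p M T.
Proof.
move=> Tin Tlin TM.
have L0 : L 0 := sn0 S.
have T0 : p (T 0) = 0.
  have := Tlin 1 0 0 L0 L0; rewrite !scale1r addr0 opprD addrA subrr sub0r.
  by rewrite (sn_opp S)//; exact: Tin.
have unit f : L f -> p f <= 1 -> p (T f) <= M.
  move=> Lf f1; rewrite -lee_fin -(L1normE (K := K))//; last exact: Tin.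
  apply: le_trans TM; apply: ereal_sup_ubound; exists f => //.
  by split => //; rewrite (L1normE (K := K))// lee_fin.
have M0 : 0 <= M by rewrite -T0; apply: unit => //; rewrite (sn_p0 S).
have hom a f : L f -> p (T (a *: f)) = `|a| * p (T f).
  move=> Lf; have := Tlin a f 0 Lf L0; rewrite addr0 => h.
  have La : L (a *: f) by exact: (snZ S).
  have LaT : L (a *: (T f : V)) by apply: (snZ S); exact: Tin.
  have LT0 := Tin _ L0; have LTa := Tin _ La.
  rewrite -(sn_scale S); last exact: Tin.
  apply: (sn_eq S) => //; apply/le_anti; rewrite (sn_ge0 S) andbT.
  apply: le_trans (sn_dist_tri S (g := a *: (T f : V) + T 0) _ _ _) _ => //.
    exact: (snD S).
  by rewrite h add0r addrAC subrr add0r T0.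
split => // f Lf.
have [f0|f0] := eqVneq (p f) 0; last first.
  have pf : 0 < p f by rewrite lt0r f0 (sn_ge0 S).
  have := unit _ (snZ S (p f)^-1 Lf).
  have ip : 0 <= (p f)^-1 by rewrite invr_ge0 ltW.
  rewrite (sn_scale S)// hom// (ger0_norm ip) mulVf// => /(_ (lexx _)).
  by rewrite ler_pdivrMl// mulrC.
rewrite f0 mulr0 leNgt; apply/negP => Tf.
have := unit _ (snZ S ((M + 1) / p (T f)) Lf).
rewrite (sn_scale S)// hom// f0 mulr0 => /(_ ler01).
rewrite ger0_norm; last by rewrite divr_ge0 ?(sn_ge0 S)// addr_ge0.
by rewrite divfK ?gt_eqF//; lra.
Qed.

Lemma bounded_op_oper T : bounded_op K m T -> exists M, oper L p M T.
Proof.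
move=> bT; have Tfin : (opnorm K m T < +oo)%E by case: bT.
exists (Num.max 0 (fine (opnorm K m T))); apply: le_opnorm.
- exact: bounded_op_in.
- exact: bounded_op_lin.
case: (opnorm K m T) Tfin => [r _||] //=; last by rewrite leNye.
by rewrite lee_fin le_max lexx orbT.
Qed.

Section PowersOfT.
Context (T : V -> V).
Hypothesis bT : bounded_op K m T.
Local Notation inv := (inv_op K m T).

Lemma inv_op_oper : exists M, oper L p M inv.
Proof.
have [ex|nex] := pselect (exists S', is_inverse K m T S').
  have [h _] : is_inverse K m T inv by exact: xgetPex.
  exact: bounded_op_oper.
by exists 1; rewrite /inv_op xgetPN; [exact: (op_id S)|exact/forallNP].
Qed.

Lemma powZ_oper k : exists M, oper L p M (powZ K m T k).
Proof.
have iterE (A : V -> V) n M : oper L p M A -> exists M, oper L p M (iter n A).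
  move=> OA; elim: n => [|n [M' OM]]; first by exists 1; exact: (op_id S).
  by exists (M * M'); exact: (op_comp S OA OM).
case: k => n; first by have [M OT] := bounded_op_oper bT; exact: iterE OT.
by have [M OI] := inv_op_oper; exact: (iterE _ n.+1 _ OI).
Qed.

Lemma powZ_in k f : L f -> L (powZ K m T k f).
Proof. by have [M OM] := powZ_oper k; exact: (op_in OM). Qed.

Lemma powZ_bound k M : (opnorm K m (powZ K m T k) <= M%:E)%E ->
  oper L p M (powZ K m T k).
Proof.
have [M' OM] := powZ_oper k; apply: le_opnorm; first exact: (op_in OM).
exact: (op_lin OM).
Qed.

Lemma powZ_add_nat (k l : nat) f : powZ K m T k (powZ K m T l f) =
  powZ K m T (k%:Z + l%:Z) f.
Proof. by rewrite -PoszD /= iterD. Qed.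

(** Only one step at a time is checked: T and its inverse move the exponent by one,
    also across 0. *)
Lemma powZ_add k l f : invertible K m T -> L f ->
  p (powZ K m T k (powZ K m T l f) - powZ K m T (k + l) f) = 0.
Proof.
move=> iT Lf; have [bI hI] : is_inverse K m T inv by exact: xgetPex.
have [MT OT] := bounded_op_oper bT; have [MI OI] := inv_op_oper.
have eqz (f1 f2 : V) : f1 = f2 -> p (f1 - f2) = 0.
  by move=> ->; rewrite subrr (sn_p0 S).
have ITK g : L g -> p (inv (T g) - g) = 0.
  move=> Lg; have [h _] := hI g Lg.
  by apply: (aeeq_L1p hK) => //; apply: (op_in OI); exact: (op_in OT).
have TIK g : L g -> p (T (inv g) - g) = 0.
  move=> Lg; have [_ h] := hI g Lg.
  by apply: (aeeq_L1p hK) => //; apply: (op_in OT); exact: (op_in OI).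
have stepT j : p (T (powZ K m T j f) - powZ K m T (j + 1) f) = 0.
  case: j => [n|[|n]].
  - by apply: eqz; rewrite -PoszD addn1.
  - by have := TIK _ Lf.
  - rewrite (_ : Negz n.+1 + 1 = Negz n); last by rewrite !NegzE; lia.
    exact: (TIK _ (powZ_in (Negz n) Lf)).
have stepI j : p (inv (powZ K m T j f) - powZ K m T (j - 1) f) = 0.
  case: j => [[|n]|n].
  - exact: eqz.
  - rewrite (_ : Posz n.+1 - 1 = Posz n); last by lia.
    exact: (ITK _ (powZ_in (Posz n) Lf)).
  - by apply: eqz; rewrite (_ : Negz n - 1 = Negz n.+1)// !NegzE; lia.
have pin j : L (powZ K m T j f) by exact: powZ_in.
have trans (A : V -> V) M g j j' : oper L p M A -> L g ->
    p (g - powZ K m T j f) = 0 -> p (A (powZ K m T j f) - powZ K m T j' f) = 0 ->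
    p (A g - powZ K m T j' f) = 0.
  move=> OA Lg h1 h2; apply/le_anti; rewrite (sn_ge0 S) andbT.
  apply: le_trans (sn_dist_tri S (g := A (powZ K m T j f)) _ _ _) _ => //;
    try by apply: (op_in OA).
  by rewrite h2 addr0; apply: le_trans (op_lipschitz S OA Lg (pin j)) _; rewrite h1 mulr0.
case: k => n.
  elim: n => [|n IH]; first by apply: eqz; rewrite add0r.
  apply: (trans T _ (powZ K m T n (powZ K m T l f)) (n%:Z + l) _ OT) => //.
    by do 2 apply: powZ_in.
  rewrite (_ : Posz n.+1 + l = n%:Z + l + 1); last by lia.
  exact: stepT.
elim: n => [|n IH].
  apply: (trans inv _ (powZ K m T l f) l _ OI) => //; first exact: eqz.
  rewrite (_ : Negz 0 + l = l - 1); last by rewrite NegzE; lia.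
  exact: stepI.
apply: (trans inv _ (powZ K m T (Negz n) (powZ K m T l f)) (Negz n + l) _ OI) => //.
  by do 2 apply: powZ_in.
rewrite (_ : Negz n.+1 + l = Negz n + l - 1); last by rewrite !NegzE; lia.
exact: stepI.
Qed.

End PowersOfT.

(** ** Limits in the mean *)

Lemma L1limP (u : nat -> V) (B : R) : (forall N, L (u N)) ->
  (forall N, \sum_(0 <= i < N) p (u i.+1 - u i) <= B) ->
  L (L1lim K m u) /\ p (u N - L1lim K m u) @[N --> \oo] --> 0.
Proof.
move=> Lu uB; have [g Lg gu] := L1_complete hK Lu uB.
have normE (f : V) N : L f -> L1norm m (fun x => (u N x : R[i]) - f x) = (p (u N - f))%:E.
  by move=> Lf; rewrite -(L1normE (K := K))//; exact: (snB S).
have ex : exists g : X -> R[i], L1 K m g /\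
    (fun N => L1norm m (fun x => (u N x : R[i]) - g x)) @ \oo --> 0%E.
  exists g; split => //; rewrite (_ : (fun N => _) = (fun N => (p (u N - g))%:E)).
    by apply: cvg_EFin; [near=> N|exact: gu].
  by apply/funext => N; exact: normE.
have [LL w0] : L1 K m (L1lim K m u) /\
    (fun N => L1norm m (fun x => (u N x : R[i]) - L1lim K m u x)) @ \oo --> 0%E.
  exact: (xgetPex _ ex).
split => //; move: w0; set w := L1lim K m u => w0.
rewrite (_ : (fun N => p (u N - w)) =
  fine \o (fun N => L1norm m (fun x => (u N x : R[i]) - w x))).
  exact: fine_cvg.
by apply/funext => N; rewrite /= normE.
Unshelve. all: by end_near. Qed.

End Operators.

(** * Averages of the powers of an operator *)

Section Average.
Context (d : measure_display) (X : measurableType d) (R : realType).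
Context (K : set R[i]) (m : {measure set X -> \bar R}).
Hypothesis hK : scalar_field K.
Local Notation V := (X -> Rcomplex R).
Local Notation L := (L1 K m : set V).
Local Notation p := (@L1p d X R m).
Let S := L1_seminorm m hK.

Context (mu : int -> R) (T : V -> V).
Hypothesis mu_prob : is_probability mu.
Hypothesis bT : bounded_op K m T.
Hypothesis hT : Smu_bounded K m mu T.
Local Notation Tk := (powZ K m T : int -> V -> V).
Local Notation A := (Tmu K m mu T : V -> V).

(** The semigroup is completed by 0, the exponent of the identity. *)
Definition Lambda0 : set int := [set k | k = 0 \/ Lambda mu k].

Lemma LambdaD k l : Lambda mu k -> Lambda mu l -> Lambda mu (k + l).
Proof. by move=> hk hl G HG; apply: (HG.1); [exact: (hk G HG)|exact: (hl G HG)]. Qed.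

Lemma mu_Lambda k : mu k != 0 -> Lambda mu k.
Proof. by move=> mk G [_ sG]; apply: sG; exists 0%N. Qed.

Lemma Lambda0D k l : Lambda0 k -> Lambda0 l -> Lambda0 (k + l).
Proof.
move=> [->|hk]; first by rewrite add0r.
by move=> [->|hl]; [rewrite addr0; right|right; exact: LambdaD].
Qed.

Lemma Lambda0_bounded : exists M, forall k, Lambda0 k -> oper L p M (Tk k).
Proof.
case: hT => _ fin; set s := ereal_sup _ in fin.
have [M M1 sM] : exists2 M : R, 1 <= M & (s <= M%:E)%E.
  exists (Num.max 1 (fine s)); first by rewrite le_max lexx.
  by case: s fin => [r _||] //=; rewrite ?leNye// lee_fin le_max lexx orbT.
exists M => k [->|hk].
  apply: (op_weaken (op_id S)) => [|f Lf]; first exact: le_trans M1.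
  by rewrite ler_peMl// (sn_ge0 S).
apply: (powZ_bound hK bT); apply: le_trans sM; apply: ereal_sup_ubound.
by exists k.
Qed.

(** Without an inverse, the semigroup contains no negative exponent. *)
Lemma powZ_addL k l f : Lambda0 k -> Lambda0 l -> L f ->
  p (Tk k (Tk l f) - Tk (k + l) f) = 0.
Proof.
move=> hk hl Lf; have [iT|niT] := pselect (invertible K m T).
  exact: (powZ_add hK bT).
have pos j : Lambda0 j -> 0 <= j.
  move=> [->//|hj]; rewrite leNgt; apply/negP => j0; apply: niT.
  by case: hT => /(_ j hj j0).
case: k hk => k hk; last by have := pos _ hk.
case: l hl => l hl; last by have := pos _ hl.
by rewrite powZ_add_nat subrr (sn_p0 S).
Qed.

Lemma mass_poly_supported N : supported Lambda0 N%:Z (mass_poly mu N).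
Proof.
move=> i; rewrite coef_poly; case: ifP => _; last by rewrite eqxx.
by move=> /mu_Lambda; right.
Qed.

Let opN N : V -> V := opoly Tk N%:Z (mass_poly mu N).

Lemma opN_psum N f : opN N f = (fun x => psumZ (fun k => (mu k)%:C%C * Tk k f x) N).
Proof.
rewrite /opN /opoly laurent_mass_poly; apply/funext => x.
rewrite /psumZ fct_sumE; apply: eq_bigr => i _.
exact: scale_fctE.
Qed.

Let LT k f : L f -> L (Tk k f). Proof. exact: (powZ_in hK bT). Qed.

Lemma opN_in N f : L f -> L (opN N f).
Proof. exact: (opoly_in S LT). Qed.

Section Bound.
Context (M : R).
Hypothesis OM : forall k, Lambda0 k -> oper L p M (Tk k).

Let L00 : Lambda0 0. Proof. by left. Qed.

Let M0 : 0 <= M. Proof. exact: (op_ge0 (OM L00)). Qed.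

Lemma opN_diff N N' f : (N <= N')%N -> L f ->
  p (opN N' f - opN N f) <= (psumZ mu N' - psumZ mu N) * (M * p f).
Proof.
move=> NN Lf; rewrite -(subnKC NN); elim: (N' - N)%N => [|k IH].
  by rewrite addn0 !subrr mul0r (sn_p0 S).
have term j : p (mu j *: (Tk j f : V)) <= mu j * (M * p f).
  rewrite (sn_scale S); last exact: LT.
  rewrite ger0_norm ?mu_prob.1//.
  have [->|mj] := eqVneq (mu j) 0; first by rewrite !mul0r.
  rewrite ler_wpM2l ?mu_prob.1//; apply: (op_bound (OM _)) => //.
  by right; exact: mu_Lambda.
rewrite addnS; apply: le_trans (sn_dist_tri S (g := opN (N + k) f) _ _ _) _;
  try exact: opN_in.
have Lt j : L (mu j *: (Tk j f : V)) by apply: (snZ S); exact: LT.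
have -> : opN (N + k).+1 f - opN (N + k) f =
    mu (N + k).+1%:Z *: (Tk (N + k).+1%:Z f : V)
      + mu (- (N + k).+1%:Z) *: (Tk (- (N + k).+1%:Z) f : V).
  by rewrite /opN /opoly !laurent_mass_poly psumZS addrAC subrr add0r.
rewrite psumZS [_ + (_ + _) - _]addrAC mulrDl [leLHS]addrC; apply: lerD; first exact: IH.
by apply: le_trans (sn_triangle S _ _) _ => //; rewrite mulrDl; apply: lerD.
Qed.

(** The increments of the symmetric partial sums are bounded by those of the mass of
    mu, so the limit exists and is attained in operator norm. *)
Lemma Tmu_spec f : L f -> L (A f) /\ forall N, p (A f - opN N f) <=
  M * mass_tail mu N * p f.
Proof.
move=> Lf.
have AE : A f = L1lim K m (fun N => opN N f).
  by rewrite /Tmu; congr L1lim; apply/funext => N; rewrite opN_psum.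
have incr N : \sum_(0 <= i < N) p (opN i.+1 f - opN i f) <= M * p f.
  apply: (@le_trans _ _ ((psumZ mu N - psumZ mu 0) * (M * p f))).
    elim: N => [|N IH]; first by rewrite big_geq// subrr mul0r.
    rewrite big_nat_recr//=; apply: le_trans (lerD IH (opN_diff (leqnSn N) Lf)) _.
    by rewrite le_eqVlt; apply/orP; left; apply/eqP; ring.
  rewrite ler_piMl ?mulr_ge0 ?(sn_ge0 S)//.
  by have := psumZ_le1 mu_prob N; have := mu_prob.1 0; rewrite psumZ0; lra.
have [LA cA] := L1limP hK (fun N => opN_in N Lf) incr.
rewrite -AE in LA cA; split => // N.
apply: (le_of_le_add_cvg0 cA); exists N => // N' /= NN.
have LN := opN_in N Lf; have LN' := opN_in N' Lf.
rewrite (sn_dist S LA LN); apply: le_trans (sn_dist_tri S LN LN' LA) _.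
rewrite lerD2r (sn_dist S LN LN').
apply: (le_trans (opN_diff NN Lf)).
rewrite [leRHS](_ : _ = mass_tail mu N * (M * p f)); last by ring.
rewrite ler_wpM2r ?mulr_ge0 ?(sn_ge0 S)//.
by rewrite /mass_tail lerD2r psumZ_le1.
Qed.

Let eta N := M * mass_tail mu N.

Let eta0 : eta @ \oo --> 0.
Proof. by rewrite -(mulr0 M); apply: cvgM; [exact: cvg_cst|exact: mass_tail_cvg0]. Qed.

Let opN_oper N : oper L p M (opN N).
Proof.
have O := opoly_oper S L00 OM LT (@mass_poly_supported N); apply: (op_weaken O M0) => f Lf.
apply: le_trans (op_bound O Lf) _; rewrite ler_wpM2r ?(sn_ge0 S)//.
by rewrite ler_piMr// norm1_mass_poly_le1.
Qed.

Let opN_iter N n f : L f -> p (iter n (opN N) f) <= M * p f.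
Proof.
move=> Lf; apply: (opoly_iter_bound S L00 Lambda0D OM) => //.
- by move=> k l g hk hl Lg; exact: powZ_addL.
- exact: mass_poly_supported.
- exact: norm1_mass_poly_le1.
Qed.

Let LA f : L f -> L (A f). Proof. by move=> /Tmu_spec[]. Qed.
Let AN N f : L f -> p (A f - opN N f) <= eta N * p f.
Proof. by move=> /Tmu_spec[_]; exact. Qed.

Lemma Tmu_oper : oper L p M A.
Proof. exact: (lim_oper S M0 opN_oper LA AN eta0). Qed.

Lemma Tmu_power_bounded n f : L f -> p (iter n A f) <= M * p f.
Proof. exact: (lim_iter_bound S M0 opN_oper opN_iter LA AN eta0). Qed.

(** The l^1 bound on mu^n - mu^(n+1) for the truncated measure transfers to the
    operators [opN N], and then to their limit. *)
Lemma Tmu_ritt (C : R) : (forall n N,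
    norm1 (diff_poly mu n N) <= C / n.+1%:R + (n + n.+1)%:R * mass_tail mu N) ->
  forall n f, L f -> p (iter n A f - iter n.+1 A f) <= M * C / n.+1%:R * p f.
Proof.
move=> hC n; apply: (lim_iter_diff S M0 opN_oper LA AN eta0
  (c := fun N => M * ((n + n.+1)%:R * mass_tail mu N))).
  rewrite -(mulr0 M); apply: cvgM; first exact: cvg_cst.
  rewrite -(mulr0 (n + n.+1)%:R); apply: cvgM; first exact: cvg_cst.
  exact: mass_tail_cvg0.
move=> N f Lf; apply: le_trans
  (opoly_iter_diff S L00 Lambda0D OM _ _ LT n (@mass_poly_supported N) Lf) _ => //.
  by move=> k l g hk hl Lg; exact: powZ_addL.
rewrite ler_wpM2r ?(sn_ge0 S)// -mulrA -mulrDr ler_wpM2l//.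
exact: hC.
Qed.

End Bound.
End Average.

(** * The generalized square function *)

Section PowerSums.
Context (R : realType).

Lemma powR_nat_split (n : nat) (a : R) :
  n.+1%:R `^ a = n.+2%:R `^ a * (n.+1%:R / n.+2%:R) `^ a.
Proof. by rewrite -powRM ?divr_ge0// mulrCA mulfV ?mulr1// pnatr_eq0. Qed.

Let ratio (n : nat) : n.+1%:R / n.+2%:R = 1 - n.+2%:R^-1 :> R.
Proof.
have n2 : n.+2%:R != 0 :> R by rewrite pnatr_eq0.
by apply: (mulIf n2); rewrite mulrBl mul1r mulVf// divfK// -[in RHS]natr1 addrK.
Qed.

Let ratio_gt0 (n : nat) : 0 < n.+1%:R / n.+2%:R :> R.
Proof. by rewrite divr_gt0 ?ltr0n. Qed.

(** Comparison with the telescoping increments of - n^(-e) / e. *)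
Lemma sum_powR_le (e : R) N : 0 < e ->
  \sum_(0 <= n < N) n.+1%:R `^ (- (1 + e)) <= 1 + e^-1.
Proof.
move=> e0; have step n : n.+2%:R `^ (- (1 + e)) <=
    e^-1 * (n.+1%:R `^ (- e) - n.+2%:R `^ (- e)).
  rewrite ler_pdivlMl// lerBrDl (powR_nat_split n (- e)).
  have y : 1 + e / n.+2%:R <= (n.+1%:R / n.+2%:R) `^ (- e).
    rewrite /powR gt_eqF//; apply: le_trans (expR_ge1Dx _) _; rewrite ler_expR.
    have : ln (n.+1%:R / n.+2%:R) <= - n.+2%:R^-1 :> R.
      have := @le_ln1Dx R (- n.+2%:R^-1); rewrite -ratio; apply.
      by rewrite -subr_gt0 opprK addrC -ratio.
    by move=> h; rewrite mulNr -mulrN ler_pM2l// lerNr.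
  have -> : n.+2%:R `^ (- (1 + e)) = n.+2%:R `^ (- e) / n.+2%:R.
    rewrite opprD powRD; last by rewrite pnatr_eq0 implybT.
    by rewrite powR_inv1// mulrC.
  apply: (@le_trans _ _ (n.+2%:R `^ (- e) * (1 + e / n.+2%:R))); last first.
    by rewrite ler_wpM2l ?powR_ge0.
  by rewrite le_eqVlt; apply/orP; left; apply/eqP; ring.
case: N => [|N]; first by rewrite big_geq// addr_ge0// invr_ge0 ltW.
rewrite big_nat_recl// powR1 lerD2l.
apply: (@le_trans _ _ (e^-1 * (1 - N.+1%:R `^ (- e)))).
  elim: N => [|N IH]; first by rewrite big_geq// powR1 subrr mulr0.
  rewrite big_nat_recr//=; apply: le_trans (lerD IH (step N)) _.
  by rewrite -mulrDr addrA subrK.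
by rewrite ler_piMr ?invr_ge0 ?(ltW e0)// lerBlDr lerDl powR_ge0.
Qed.

Lemma powR_increment_le (de : R) n : 0 < de ->
  n.+2%:R `^ de - n.+1%:R `^ de <= 2 * de * n.+2%:R `^ (de - 1).
Proof.
move=> d0; rewrite [X in _ - X](powR_nat_split n de).
have y : 1 - 2 * de / n.+2%:R <= (n.+1%:R / n.+2%:R) `^ de.
  rewrite /powR gt_eqF//; apply: le_trans (expR_ge1Dx _); rewrite lerD2l.
  have h : ln (n.+2%:R / n.+1%:R) <= n.+1%:R^-1 :> R.
    have -> : n.+2%:R / n.+1%:R = 1 + n.+1%:R^-1 :> R.
      by rewrite -[n.+2%:R]nat1r mulrDl mul1r mulfV ?pnatr_eq0// addrC.
    by rewrite -ler_expR lnK ?expR_ge1Dx// posrE addr_gt0 ?invr_gt0 ?ltr0n.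
  have -> : ln (n.+1%:R / n.+2%:R) = - ln (n.+2%:R / n.+1%:R) :> R.
    by rewrite -lnV ?posrE ?divr_gt0 ?ltr0n// invf_div.
  rewrite mulrN lerN2 -mulrA [leRHS]mulrCA ler_pM2l//; apply: (le_trans h).
  rewrite ler_pdivlMr ?ltr0n// mulrC ler_pdivrMr ?ltr0n// -natrM ler_nat; lia.
rewrite powRD ?pnatr_eq0 ?implybT// powR_inv1//.
have := ler_wpM2l (powR_ge0 n.+2%:R de) y.
have -> : n.+2%:R `^ de * (1 - 2 * de / n.+2%:R) =
  n.+2%:R `^ de - 2 * de * (n.+2%:R `^ de / n.+2%:R) by ring.
by rewrite lerBlDr => h; rewrite lerBlDr addrC.
Qed.

End PowerSums.

Section PointwiseBound.
Context (R : realType) (a dif : nat -> R) (de : R).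
Hypothesis a_ge0 : forall n, 0 <= a n.
Hypothesis dif_ge0 : forall n, 0 <= dif n.
Hypothesis a_dif : forall n, a n.+1 <= a n + dif n.
Hypothesis de_gt0 : 0 < de.

(** Bounds the increment of n^de a_n from n = j + 1 to j + 2. *)
Definition majorant (j : nat) : R :=
  (j.+2%:R `^ de - j.+1%:R `^ de) * a j.+1 + j.+2%:R `^ de * dif j.+1.

Lemma majorant_ge0 j : 0 <= majorant j.
Proof.
rewrite addr_ge0 ?mulr_ge0 ?powR_ge0// subr_ge0.
by apply: ge0_ler_powR; rewrite ?nnegrE ?ler_nat ?ltW.
Qed.

Lemma weighted_le_majorant n :
  n.+1%:R `^ de * a n.+1 <= a 1%N + \sum_(0 <= j < n) majorant j.
Proof.
elim: n => [|n IH]; first by rewrite powR1 mul1r big_geq// addr0.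
rewrite big_nat_recr//= addrA.
apply: le_trans (lerD IH (lexx _)).
have := ler_wpM2l (powR_ge0 n.+2%:R de) (a_dif n.+1).
move=> h; apply: (le_trans h); rewrite le_eqVlt; apply/orP; left; apply/eqP.
by rewrite /majorant; ring.
Qed.

Local Open Scope ereal_scope.

(** The bound on n^de a_n is uniform in n, so the series is at most its s-th power
    times Z. *)
Lemma square_sum_le (alpha s Z : R) : (0 < s)%R -> (0 < Z)%R ->
  (forall N, \sum_(0 <= n < N) n.+1%:R `^ (alpha - de * s) <= Z)%R ->
  (\sum_(1 <= n <oo) (n%:R `^ alpha * a n `^ s)%:E) `^ s^-1 <=
  (Z `^ s^-1)%:E * ((a 1%N)%:E + \sum_(0 <= j <oo) (majorant j)%:E).
Proof.
move=> s0 Z0 HZ.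
set U := (a 1%N)%:E + _.
have mj j : 0 <= (majorant j)%:E by rewrite lee_fin majorant_ge0.
have U0 : 0 <= U by rewrite adde_ge0 ?lee_fin// nneseries_ge0.
have Zs : (0 < Z `^ s^-1)%R by rewrite powR_gt0.
have aU n : (n.+1%:R `^ de * a n.+1)%:E <= U.
  apply: le_trans (_ : (a 1%N + \sum_(0 <= j < n) majorant j)%:E <= _).
    by rewrite lee_fin weighted_le_majorant.
  by rewrite EFinD leeD2l// -sumEFin; exact: nneseries_lim_ge.
case: U U0 aU => [v||] // v0 aU; last by rewrite gt0_muley ?lte_fin// leey.
rewrite lee_fin in v0.
have term n : (n.+1%:R `^ alpha * a n.+1 `^ s <= n.+1%:R `^ (alpha - de * s) * v `^ s)%R.
  have n1 : (n.+1%:R != 0 :> R)%R by rewrite pnatr_eq0.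
  have -> : (n.+1%:R `^ alpha * a n.+1 `^ s =
      n.+1%:R `^ (alpha - de * s) * (n.+1%:R `^ de * a n.+1) `^ s)%R.
    rewrite powRM ?powR_ge0// mulrA -powRrM -powRD; last by rewrite n1 implybT.
    by rewrite subrK.
  rewrite ler_wpM2l ?powR_ge0//; apply: ge0_ler_powR; first exact: ltW.
  - by rewrite nnegrE mulr_ge0 ?powR_ge0.
  - by rewrite nnegrE.
  - by have := aU n; rewrite lee_fin.
have partial N : \sum_(1 <= n < N) (n%:R `^ alpha * a n `^ s)%:E <= (Z * v `^ s)%:E.
  case: N => [|N]; first by rewrite big_geq// lee_fin mulr_ge0 ?powR_ge0// ltW.
  rewrite sumEFin lee_fin big_add1/=.
  apply: (@le_trans _ _ (\sum_(0 <= n < N) n.+1%:R `^ (alpha - de * s) * v `^ s)%R).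
    exact: ler_sum.
  by rewrite -mulr_suml ler_wpM2r ?powR_ge0.
have sumle : \sum_(1 <= n <oo) (n%:R `^ alpha * a n `^ s)%:E <= (Z * v `^ s)%:E.
  apply: lime_le.
    by apply: is_cvg_nneseries => n _ _; rewrite lee_fin mulr_ge0 ?powR_ge0.
  near=> N; exact: partial.
have sum0 : 0 <= \sum_(1 <= n <oo) (n%:R `^ alpha * a n `^ s)%:E.
  by apply: nneseries_ge0 => n _ _; rewrite lee_fin mulr_ge0 ?powR_ge0.
apply: (@le_trans _ _ ((Z * v `^ s)%:E `^ s^-1)).
  apply: gt0_ler_poweR => //; rewrite ?in_itv/= ?leey ?andbT//.
    by rewrite invr_ge0 ltW.
  by rewrite lee_fin mulr_ge0 ?powR_ge0// ltW.
rewrite poweR_EFin lee_fin powRM ?powR_ge0 ?(ltW Z0)//.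
by rewrite -powRrM mulfV ?gt_eqF// powRr1.
Unshelve. all: by end_near. Qed.

End PointwiseBound.

Section SquareFunction.
Context (d : measure_display) (X : measurableType d) (R : realType).
Context (K : set R[i]) (m : {measure set X -> \bar R}).
Hypothesis hK : scalar_field K.
Local Notation V := (X -> Rcomplex R).
Local Notation L := (L1 K m : set V).
Local Notation p := (@L1p d X R m).
Local Notation normc := (@Normc.normc R).
Let S := L1_seminorm m hK.

Context (A : V -> V) (M C : R).
Hypothesis OA : oper L p M A.
Hypothesis pb : forall n f, L f -> p (iter n A f) <= M * p f.
Hypothesis C_ge0 : 0 <= C.
Hypothesis ritt : forall n f, L f ->
  p (iter n A f - iter n.+1 A f) <= C / n.+1%:R * p f.

Let M0 : 0 <= M := op_ge0 OA.

Lemma id_subE (B : V -> V) (f : V) : (id_sub B f : V) = f - B f.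
Proof. by []. Qed.

Lemma frac_id_sub_decay (th : R) : 0 <= th < 1 ->
  (forall f, L f -> L (frac_id_sub K m A th f)) /\
  exists2 D : R, 0 <= D & forall n f, L f ->
    p (iter n A (frac_id_sub K m A th f)) <= D * n.+1%:R `^ (- th) * p f.
Proof.
move=> /andP[th0 th1]; rewrite /frac_id_sub; case: eqP => [->|/eqP th_neq0].
  split=> //; exists M => // n f Lf.
  by rewrite oppr0 powRr0 mulr1 pb.
have th01 : 0 < th < 1 by rewrite th1 lt0r th_neq0 th0.
pose u N (f : V) : V := \sum_(1 <= k < N.+1) gcoef th k *: iter k A f.
have LAn k f : L f -> L (iter k A f) by exact: (op_iter_in OA).
have Lu N f : L f -> L (u N f).
  by move=> Lf; apply: (sn_sum S) => k _; apply: (snZ S); exact: LAn.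
have uE f : (fun N x => \sum_(1 <= k < N.+1) (gcoef th k)%:C%C * iter k A f x) =
  (u ^~ f : nat -> V).
  apply/funext => N; apply/funext => x; rewrite /u fct_sumE.
  by apply: eq_bigr => k _; rewrite scale_fctE.
pose B (f : V) : V := L1lim K m (u ^~ f).
have spec f : L f -> L (B f) /\ p (u N f - B f) @[N --> \oo] --> 0.
  move=> Lf; apply: (L1limP hK (B := M * p f)) => [N|N]; first exact: Lu.
  apply: (@le_trans _ _ (\sum_(0 <= i < N) gcoef th i.+1 * (M * p f))).
    apply: ler_sum => i _; rewrite /u big_nat_recr//= addrAC subrr add0r.
    rewrite (sn_scale S); last exact: (LAn i.+1).
    by rewrite ger0_norm ?gcoef_ge0// ler_wpM2l ?gcoef_ge0//; exact: (pb i.+1).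
  rewrite -mulr_suml ler_piMl ?mulr_ge0 ?(sn_ge0 S)//.
  have := sum_gcoef th01 (leq0n N); rewrite big_add1/= => ->.
  by rewrite {1}/frac_tail big_ord0 gerBl frac_tail_ge0.
have -> : (fun f => L1lim K m (fun N x =>
    \sum_(1 <= k < N.+1) (gcoef th k)%:C%C * iter k A f x)) = B.
  by apply/funext => f; rewrite uE.
have LB f : L f -> L (B f) by move=> /spec[].
split=> [f Lf|]; first by apply: (snB S) => //; exact: LB.
exact: (frac_power_decay S OA M0 C_ge0 pb ritt th01 LB (fun f Lf => (spec f Lf).2)).
Qed.

Section Power.
Context (r : R).
Hypothesis r_gt0 : 0 < r.
Local Notation U := (rpow_id_sub K m A r : V -> V).

Lemma truncn_frac : 0 <= r - (Num.truncn r)%:R < 1.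
Proof.
have := truncn_itv (ltW r_gt0) => /andP[h1 h2].
by rewrite subr_ge0 h1 ltrBlDl natr1.
Qed.

Lemma iter_id_sub_in k f : L f -> L (iter k (id_sub A) f).
Proof.
by move=> Lf; elim: k => // k IH; rewrite iterS id_subE; apply: (snB S) => //;
  exact: (op_in OA).
Qed.

Lemma rpow_in f : L f -> L (U f).
Proof.
by move=> Lf; apply: iter_id_sub_in; apply: (frac_id_sub_decay truncn_frac).1.
Qed.

Lemma rpow_decay j : exists2 D : R, 0 <= D & forall n f, L f ->
  p (iter n A (iter j (id_sub A) (U f))) <= D * n.+1%:R `^ (- (r + j%:R)) * p f.
Proof.
have /andP[th0 _] := truncn_frac.
have [LF HF] := frac_id_sub_decay truncn_frac.
have [D D0 hD] := integer_power_decay S OA M0 C_ge0 pb ritt th0 LF HF (j + Num.truncn r).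
exists D => // n f Lf; rewrite /rpow_id_sub -iterD.
apply: le_trans (hD n f Lf) _.
by rewrite (_ : r - (Num.truncn r)%:R + (j + Num.truncn r)%:R = r + j%:R)// natrD; ring.
Qed.

Lemma rpow_diff_decay : exists2 D : R, 0 <= D & forall n f, L f ->
  p (iter n A (U f) - iter n.+1 A (U f)) <= D * n.+1%:R `^ (- (r + 1)) * p f.
Proof.
have [D D0 hD] := rpow_decay 1; exists D => // n f Lf.
apply: le_trans (hD n f Lf); rewrite /= id_subE.
have LU := rpow_in Lf.
rewrite (op_subE S (op_iter S OA M0 pb n))//; last exact: (op_in OA).
by rewrite -iterSr.
Qed.

Context (alpha s : R).
Hypotheses (s_gt0 : 0 < s) (alpha_gt : -1 < alpha) (asr : alpha + 1 < s * r).

(** The exponent [de] lies strictly between the critical exponent [ga] and [r]: the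
    gap above [ga] makes the numerical series converge, the gap [e] below [r]
    makes the series of integrals of the majorant converge. *)
Let ga := (alpha + 1) / s.
Let de := (ga + r) / 2.
Let e := r - de.

Let ga_lt : ga < r. Proof. by rewrite /ga ltr_pdivrMr// mulrC. Qed.
Let ga_gt0 : 0 < ga. Proof. by rewrite divr_gt0// -ltrBlDr sub0r. Qed.
Let de_gt0 : 0 < de. Proof. by rewrite divr_gt0// addr_gt0. Qed.
Let e_gt0 : 0 < e. Proof. by rewrite subr_gt0 /de; have := ga_lt; lra. Qed.

Lemma square_fun_bounded : exists C', forall f, L f ->
  (\int[m]_x square_fun K m A alpha s r f x <= C'%:E * L1norm m f)%E.
Proof.
have [D0 D0_ge0 hD0] := rpow_decay 0.
have [D1 D1_ge0 hD1] := rpow_diff_decay.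
pose q := s * (de - ga).
have q_gt0 : 0 < q by rewrite mulr_gt0// subr_gt0 /de; have := ga_lt; lra.
have alphaE : alpha - de * s = - (1 + q).
  by rewrite /q /ga; field; exact: lt0r_neq0.
pose Z := 1 + q^-1.
have Z_gt0 : 0 < Z by rewrite addr_gt0// invr_gt0.
have Zs : 0 <= Z `^ s^-1 by exact: powR_ge0.
pose W := D0 + (2 * de * D0 + D1) * (1 + e^-1).
exists (Z `^ s^-1 * W) => f Lf.
pose g n : V := iter n A (U f).
pose a n x := normc (g n x).
pose dif n x := normc (g n x - g n.+1 x).
have LU : L (U f) by exact: rpow_in.
have Lg n : L (g n) by exact: (op_iter_in OA).
have Ld n : L (g n - g n.+1) by exact: (snB S).
have a_ge0 x n : 0 <= a n x by exact: normc_ge0.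
have dif_ge0 x n : 0 <= dif n x by exact: normc_ge0.
have a_dif x n : a n.+1 x <= a n x + dif n x.
  rewrite /a -{1}(subKr (g n x : R[i]) (g n.+1 x : R[i])); exact: normcB_le.
have ma n : measurable_fun setT (a n) by exact: L1_measurable_normc (Lg n).
have md n : measurable_fun setT (dif n) by have := L1_measurable_normc (Ld n).
have pf0 : 0 <= p f by exact: (sn_ge0 S).
have inta n : (\int[m]_x (a n x)%:E <= (D0 * n.+1%:R `^ (- r) * p f)%:E)%E.
  rewrite [leLHS](_ : _ = (p (g n))%:E); last by rewrite -(L1normE (Lg n)).
  by rewrite lee_fin; have := hD0 n f Lf; rewrite addr0.
have intd n : (\int[m]_x (dif n x)%:E <= (D1 * n.+1%:R `^ (- (r + 1)) * p f)%:E)%E.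
  rewrite [leLHS](_ : _ = (p (g n - g n.+1))%:E); last by rewrite -(L1normE (Ld n)).
  by rewrite lee_fin; exact: hD1.
pose maj j x := majorant (a ^~ x) (dif ^~ x) de j.
have maj0 j x : 0 <= maj j x by apply: majorant_ge0.
have mmaj j : measurable_fun setT (maj j).
  by apply: measurable_funD; apply: measurable_funM.
have incr0 j : 0 <= j.+2%:R `^ de - j.+1%:R `^ de.
  by rewrite subr_ge0; apply: ge0_ler_powR; rewrite ?nnegrE ?ler_nat ?ltW.
have intmaj j : (\int[m]_x (maj j x)%:E <=
    ((2 * de * D0 + D1) * j.+1%:R `^ (- (1 + e)) * p f)%:E)%E.
  rewrite /maj /majorant; under eq_integral do rewrite EFinD !EFinM.
  rewrite ge0_integralD//; last 4 first.
  - by move=> x _; rewrite -EFinM lee_fin mulr_ge0.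
  - by apply: measurable_funeM; exact/measurable_EFinP.
  - by move=> x _; rewrite -EFinM lee_fin mulr_ge0 ?powR_ge0.
  - by apply: measurable_funeM; exact/measurable_EFinP.
  rewrite !ge0_integralZl//; last 5 first.
  - exact/measurable_EFinP.
  - by move=> x _; rewrite lee_fin.
  - exact/measurable_EFinP.
  - by move=> x _; rewrite lee_fin.
  - by rewrite lee_fin.
  have p1 : (0 <= (j.+2%:R `^ de - j.+1%:R `^ de)%:E)%E by rewrite lee_fin.
  have p2 : (0 <= (j.+2%:R `^ de)%:E)%E by rewrite lee_fin powR_ge0.
  apply: (le_trans (leeD (lee_wpmul2l p1 (inta j.+1)) (lee_wpmul2l p2 (intd j.+1)))).
  rewrite -!EFinM -EFinD lee_fin.
  have n2 (x y : R) : (x + y == 0) ==> (j.+2%:R != 0 :> R) by rewrite pnatr_eq0 implybT.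
  have e1 : j.+2%:R `^ de * (D1 * j.+2%:R `^ (- (r + 1)) * p f) =
     D1 * j.+2%:R `^ (- (1 + e)) * p f.
    rewrite (_ : - (1 + e) = de + - (r + 1)); last by rewrite /e; ring.
    by rewrite powRD//; ring.
  have e2 : 2 * de * j.+2%:R `^ (de - 1) * (D0 * j.+2%:R `^ (- r) * p f) =
     2 * de * D0 * j.+2%:R `^ (- (1 + e)) * p f.
    rewrite (_ : - (1 + e) = (de - 1) + - r); last by rewrite /e; ring.
    by rewrite (@powRD _ _ (de - 1) (- r))//; ring.
  rewrite e1.
  have h3 : (j.+2%:R `^ de - j.+1%:R `^ de) * (D0 * j.+2%:R `^ (- r) * p f) <=
     2 * de * D0 * j.+2%:R `^ (- (1 + e)) * p f.
    rewrite -e2; apply: ler_wpM2r; first by rewrite !mulr_ge0 ?powR_ge0.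
    exact: powR_increment_le.
  apply: (le_trans (lerD h3 (lexx _))); rewrite -!mulrDl.
  rewrite ler_wpM2r// ler_wpM2l//; first by nonneg.
  rewrite !powRN lef_pV2 ?posrE ?powR_gt0 ?ltr0n//.
  by apply: ge0_ler_powR; rewrite ?nnegrE ?ler_nat// addr_ge0// ltW.
pose Maj x := ((a 1%N x)%:E + \sum_(0 <= j <oo) (maj j x)%:E)%E.
have mMajs : measurable_fun setT (fun x => \sum_(0 <= j <oo) (maj j x)%:E)%E.
  apply: (ge0_emeasurable_sum (P := xpredT)) => [j x _ _|j _]; first by rewrite lee_fin.
  exact/measurable_EFinP.
have mMaj : measurable_fun setT Maj.
  by apply: emeasurable_funD => //; exact/measurable_EFinP.
have Majs0 x : (0 <= \sum_(0 <= j <oo) (maj j x)%:E)%E.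
  by apply: nneseries_ge0 => j _ _; rewrite lee_fin.
have Maj0 x : (0 <= Maj x)%E by rewrite adde_ge0// lee_fin.
have intMaj : (\int[m]_x Maj x <= (W * p f)%:E)%E.
  rewrite ge0_integralD//; last 2 first.
  - by move=> x _; rewrite lee_fin.
  - exact/measurable_EFinP.
  rewrite integral_nneseries//; last 2 first.
  - by move=> j; exact/measurable_EFinP.
  - by move=> j x _; rewrite lee_fin.
  rewrite mulrDl EFinD; apply: leeD.
    apply: (le_trans (inta 1%N)); rewrite lee_fin ler_wpM2r// ler_piMr//.
    have two1 : 1 <= 2%:R :> R by rewrite ler1n.
    have h : 2%:R `^ (- r) <= 2%:R `^ 0 :> R.
      by apply: (ler_powR two1); rewrite oppr_le0 ltW.
    by rewrite powRr0 in h.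
  have partial N : (\sum_(0 <= j < N) \int[m]_x (maj j x)%:E <=
      ((2 * de * D0 + D1) * (1 + e^-1) * p f)%:E)%E.
    apply: (@le_trans _ _ (\sum_(0 <= j < N)
       ((2 * de * D0 + D1) * j.+1%:R `^ (- (1 + e)) * p f)%:E)%E).
      by apply: lee_sum => j _.
    rewrite sumEFin lee_fin -mulr_suml -mulr_sumr ler_wpM2r// ler_wpM2l//.
      by nonneg.
    exact: sum_powR_le.
  apply: lime_le; last by near=> N; exact: partial.
  by apply: is_cvg_nneseries => j _ _; apply: integral_ge0 => x _; rewrite lee_fin.
have sq_le x : (square_fun K m A alpha s r f x <= (Z `^ s^-1)%:E * Maj x)%E.
  apply: (@square_sum_le R (a ^~ x) (dif ^~ x) de) => //.
  by move=> N; rewrite alphaE; exact: sum_powR_le.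
have msq : measurable_fun setT (square_fun K m A alpha s r f).
  apply: (measurableT_comp (measurable_poweR _)).
  apply: (@emeasurable_fun_cvg _ _ _ _
    (fun N x => \sum_(1 <= n < N) (n%:R `^ alpha * a n x `^ s)%:E)%E) => [N|x _].
    apply: emeasurable_sum => n; apply/measurable_EFinP; apply: measurable_funM => //.
    exact: (measurableT_comp (measurable_powR _)).
  by apply: is_cvg_nneseries => n _ _; rewrite lee_fin mulr_ge0 ?powR_ge0.
apply: (@le_trans _ _ (\int[m]_x ((Z `^ s^-1)%:E * Maj x))%E).
  apply: ge0_le_integral => //; first by move=> x _; exact: poweR_ge0.
  exact: measurable_funeM.
rewrite ge0_integralZl// ?lee_fin//.
apply: (le_trans (lee_wpmul2l _ intMaj)); first by rewrite lee_fin.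
by rewrite (L1normE Lf) -!EFinM mulrA.
Unshelve. all: by end_near. Qed.

End Power.
End SquareFunction.

Theorem theorem2p4 (R : realType) (d : measure_display) (X : measurableType d)
    (m : {sigma_finite_measure set X -> \bar R})
    (K : set R[i]) (hK : scalar_field K)
    (mu : int -> R) (hmu : is_Mmeasure mu)
    (T : (X -> R[i]) -> X -> R[i]) (hT : bounded_op K m T)
    (hTmu : Smu_bounded K m mu T)
    (alpha s r : R) (hs : 0 < s) (hr : 0 < r) (halpha : -1 < alpha)
    (hsr : alpha + 1 < s * r) :
  exists C : R, forall f : X -> R[i], L1 K m f ->
    (\int[m]_x square_fun K m (Tmu K m mu T) alpha s r f x
       <= C%:E * L1norm m f)%E.
Proof.
have mu_prob : is_probability mu by case: hmu.
have [C C0 hC] := Mmeasure_ritt hmu.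
have [M OM] := Lambda0_bounded hK hT hTmu.
have M0 : 0 <= M by apply: (op_ge0 (OM 0 _)); left.
apply: (square_fun_bounded hK (M := M) (C := M * C)) => //.
- exact: (Tmu_oper hK mu_prob hT OM).
- exact: (Tmu_power_bounded hK mu_prob hT hTmu OM).
- exact: mulr_ge0.
- exact: (Tmu_ritt hK mu_prob hT hTmu OM hC).
Qed.
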